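(* Let $T^-$ be one of the following theories: the theory of partial orders, of lattices, of join semilattices, of meet semilattices, of nontrivial Boolean algebras, or of nontrivial Heyting algebras (nontrivial meaning $0 \neq 1$). Work in the language of $T^-$ expanded by a new binary relation symbol $\ll$, and let $T$ be the extension of $T^-$ obtained by adding one of the following: (1) $\ll$ is a reflexive partial order coarser than $\leq$; or (2) $\ll$ is a linearization of $\leq$; or (3) $\ll$ is an auxiliary relation with respect to $\leq$ (and, in the case of Boolean algebras and Heyting algebras, additionally $0 \ll 0$ and $1 \ll 1$). Alternatively, let $T$ be the theory of causal spaces. Then $T$ has the strong amalgamation property, and more generally the superamalgamation property with respect to $\leq$. Moreover, the class of finite models of $T$ has a Fraïssé limit $\mathbf{M}$, and, except possibly in the cases where $T^-$ is the theory of lattices or of Heyting algebras, the first-order theory of $\mathbf{M}$ is $\omega$-categorical, has quantifier elimination, and is the model completion of $T$.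
   Context: In each structure, $\leq$ denotes the partial order: for partial orders it is the given order; for a join semilattice $a \leq b$ means $a \vee b = b$; for a meet semilattice $a \leq b$ means $a \wedge b = a$; for lattices, Boolean algebras and Heyting algebras it is the natural lattice order. A relation $\ll$ is coarser than $\leq$ if $x \leq y$ implies $x \ll y$; it is finer than $\leq$ if $x \ll y$ implies $x \leq y$. A linearization of $\leq$ is a linear order $\ll$ with $x\le y \Rightarrow x \ll y$. An auxiliary relation on a poset $(S,\leq)$ is a binary relation $\ll$ finer than $\leq$ such that for all $w,x,y,z$: $w \leq x \ll y \leq z$ implies $w \ll z$ (such a relation is automatically transitive and antisymmetric; it is not required to be reflexive or antireflexive). A causal space is a structure $(S,\leq,\ll)$ where $(S,\leq)$ is a poset and $\ll$ is an antireflexive auxiliary relation on it. A class $\mathcal K$ of structures has the amalgamation property if for all $\mathbf A,\mathbf B,\mathbf C\in\mathcal K$ and embeddings $\iota_1:\mathbf C\to\mathbf A$, $\kappa_1:\mathbf C\to\mathbf B$ there exist $\mathbf D\in\mathcal K$ and embeddings $\iota:\mathbf A\to\mathbf D$, $\kappa:\mathbf B\to\mathbf D$ with $\iota\circ\iota_1=\kappa\circ\kappa_1$; the strong amalgamation property if moreover one can always achieve $\iota(A)\cap\kappa(B)=\iota(\iota_1(C))$. For a class of structures with a distinguished binary relation $R$ (here $\leq$), the superamalgamation property with respect to $R$ means: strong amalgamation can always be achieved so that, in addition, for every $a\in A\setminus\iota_1(C)$ and $b\in B\setminus\kappa_1(C)$, if $\iota(a)\, R^{\mathbf D}\, \kappa(b)$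 then there is $c\in C$ with $a\, R^{\mathbf A}\, \iota_1(c)$ and $\kappa_1(c)\, R^{\mathbf B}\, b$, and if $\kappa(b)\, R^{\mathbf D}\, \iota(a)$ then there is $c\in C$ with $b\, R^{\mathbf B}\, \kappa_1(c)$ and $\iota_1(c)\, R^{\mathbf A}\, a$. A theory has one of these properties if its class of models does. *)

(* Defs.v *)
(* MathComp, with the classical sets and cardinalities of MathComp-Analysis. *)
From Stdlib Require List.
From mathcomp Require Import all_boot.
From mathcomp Require Import boolp classical_sets functions cardinality.

Set Implicit Arguments.
Unset Strict Implicit.
Unset Printing Implicit Defensive.

Local Open Scope classical_set_scope.

(* First-order languages with constants, unary and binary operations and binary
   relations; no symbol of another arity occurs in this development. *)
Record language := Language {
  cst : Type;
  op1 : Type;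
  op2 : Type;
  rel2 : Type }.

(* Structures may be empty when there are no constants.  The amalgamation
   properties then include amalgamation over the empty structure, so they imply
   the ones for nonempty structures. *)
Record structure (L : language) := Structure {
  carrier :> Type;
  icst : cst L -> carrier;
  iop1 : op1 L -> carrier -> carrier;
  iop2 : op2 L -> carrier -> carrier -> carrier;
  irel2 : rel2 L -> carrier -> carrier -> Prop }.

Section Syntax.
Variable L : language.

Inductive term (V : Type) : Type :=
| Var of V
| Cst of cst L
| Op1 of op1 L & term V
| Op2 of op2 L & term V & term V.

(* [formula V] is the type of formulas with free variables in [V]; under a
   quantifier the new variable is [None]. *)
Inductive formula (V : Type) : Type :=
| Bot
| Eq of term V & term V
| Rel of rel2 L & term V & term V
| Imp of formula V & formula V
| All of formula (option V).

Definition sentence := formula void.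
Definition theory := set sentence.

Definition Not V (phi : formula V) := Imp phi (Bot V).
Definition Or V (phi psi : formula V) := Imp (Not phi) psi.

Fixpoint quantifier_free V (phi : formula V) : bool :=
  match phi with
  | Imp p q => quantifier_free p && quantifier_free q
  | All _ => false
  | _ => true
  end.

Fixpoint eval (A : structure L) V (v : V -> A) (t : term V) : A :=
  match t with
  | Var x => v x
  | Cst c => icst A c
  | Op1 f t => iop1 f (eval v t)
  | Op2 f t u => iop2 f (eval v t) (eval v u)
  end.

Fixpoint sat (A : structure L) V (v : V -> A) (phi : formula V) : Prop :=
  match phi with
  | Bot => False
  | Eq t u => eval v t = eval v u
  | Rel r t u => irel2 r (eval v t) (eval v u)
  | Imp p q => sat v p -> sat v q
  | All p => forall a : A, sat (oapp v a) p
  end.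

Definition holds (A : structure L) (phi : sentence) : Prop :=
  sat (fun x : void => match x return A with end) phi.

Definition models (T : theory) : set (structure L) :=
  [set A | forall phi, T phi -> holds A phi].

Definition Th (A : structure L) : theory := [set phi | holds A phi].

End Syntax.

Arguments Cst {L V}.
Arguments Op1 {L V}.
Arguments Op2 {L V}.
Arguments Rel {L V}.
Arguments Var {L V}.
Arguments Bot {L V}.

Section ModelTheory.
Variable L : language.
Implicit Types (A B C D M : structure L) (K : set (structure L)) (T : theory L).

Definition embedding A B (f : A -> B) : Prop :=
  [/\ injective f,
      forall c, f (icst A c) = icst B c,
      forall o x, f (iop1 o x) = iop1 o (f x),
      forall o x y, f (iop2 o x y) = iop2 o (f x) (f y) &
      forall r x y, irel2 r x y <-> irel2 r (f x) (f y)].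

Definition embeds A B : Prop := exists f : A -> B, embedding f.

Definition isomorphism A B (f : A -> B) : Prop :=
  embedding f /\ (forall y, exists x, f x = y).

Definition isomorphic A B : Prop := exists f : A -> B, isomorphism f.

Definition amalgam A B C D (i1 : C -> A) (k1 : C -> B)
    (i : A -> D) (k : B -> D) : Prop :=
  [/\ embedding i, embedding k & i \o i1 = k \o k1].

Definition strong_amalgam A B C D (i1 : C -> A) (k1 : C -> B)
    (i : A -> D) (k : B -> D) : Prop :=
  amalgam i1 k1 i k /\ range i `&` range k = range (i \o i1).

Definition super_amalgam (R : forall A, A -> A -> Prop) A B C D
    (i1 : C -> A) (k1 : C -> B) (i : A -> D) (k : B -> D) : Prop :=
  strong_amalgam i1 k1 i k /\
  forall a b, ~ range i1 a -> ~ range k1 b ->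
    (R D (i a) (k b) -> exists c, R A a (i1 c) /\ R B (k1 c) b) /\
    (R D (k b) (i a) -> exists c, R B b (k1 c) /\ R A (i1 c) a).

Definition strong_amalgamation_property K : Prop :=
  forall A B C (i1 : C -> A) (k1 : C -> B),
    K A -> K B -> K C -> embedding i1 -> embedding k1 ->
    exists D (i : A -> D) (k : B -> D), K D /\ strong_amalgam i1 k1 i k.

Definition superamalgamation_property (R : forall A, A -> A -> Prop) K : Prop :=
  forall A B C (i1 : C -> A) (k1 : C -> B),
    K A -> K B -> K C -> embedding i1 -> embedding k1 ->
    exists D (i : A -> D) (k : B -> D), K D /\ super_amalgam R i1 k1 i k.

Definition op_closed A (P : set A) : Prop :=
  [/\ forall c, P (icst A c),
      forall o x, P x -> P (iop1 o x) &
      forall o x y, P x -> P y -> P (iop2 o x y)].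

Definition finitely_generated A : Prop :=
  exists2 X : set A, finite_set X &
    forall P : set A, op_closed P -> X `<=` P -> P = setT.

Definition age M : set (structure L) :=
  [set A | finitely_generated A /\ embeds A M].

Definition ultrahomogeneous M : Prop :=
  forall A (f g : A -> M), finitely_generated A -> embedding f -> embedding g ->
    exists2 h : M -> M, isomorphism h & h \o f = g.

Definition fraisse_limit K M : Prop :=
  [/\ countable [set: M], ultrahomogeneous M & age M = K].

Definition finite_models T : set (structure L) :=
  [set A | models T A /\ finite_set [set: A]].

Definition countably_infinite A : Prop :=
  countable [set: A] /\ infinite_set [set: A].

Definition omega_categorical T : Prop :=
  (exists A, models T A /\ countably_infinite A) /\
  (forall A B, models T A -> countably_infinite A ->
               models T B -> countably_infinite B -> isomorphic A B).

Definition quantifier_elimination T : Prop :=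
  forall n (phi : formula L 'I_n),
    exists2 psi : formula L 'I_n, quantifier_free psi &
      forall A (v : 'I_n -> A), models T A -> (sat v phi <-> sat v psi).

(* [Ts] extends [T], every model of [T] embeds in a model of [Ts], and [Ts]
   together with the diagram of any model [A] of [T] is complete.  A model of
   [Ts] and the diagram of [A] is a model of [Ts] with an embedding of [A], and
   a sentence with parameters in [A] is a formula with free variables in [A]. *)
Definition model_completion T Ts : Prop :=
  [/\ models Ts `<=` models T,
      forall A, models T A -> exists2 B, models Ts B & embeds A B &
      forall A B C (f : A -> B) (g : A -> C),
        models T A -> models Ts B -> models Ts C ->
        embedding f -> embedding g ->
        forall phi : formula L A, sat f phi <-> sat g phi].

End ModelTheory.

(* An axiom is an open formula in the variables x, y, z, w, standing for its
   universal closure. *)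
Definition var4 := option (option (option (option void))).

Section UniversalTheories.
Variable L : language.

Definition universal_closure (phi : formula L var4) : sentence L :=
  All (All (All (All phi))).

Definition axiomatized_by (axs : seq (formula L var4)) : theory L :=
  [set phi | List.In phi (List.map universal_closure axs)].

Local Notation x := (@Var L var4 (Some (Some (Some None)))).
Local Notation y := (@Var L var4 (Some (Some None))).
Local Notation z := (@Var L var4 (Some None)).
Local Notation w := (@Var L var4 None).

Section Orders.
Variables R S : term L var4 -> term L var4 -> formula L var4.

Definition partial_order :=
  [:: R x x;
      Imp (R x y) (Imp (R y x) (Eq x y));
      Imp (R x y) (Imp (R y z) (R x z))].

Definition coarser_relation := [:: Imp (R x y) (S x y)].
Definition total_relation := [:: Or (S x y) (S y x)].

Definition auxiliary_relation :=
  [:: Imp (S x y) (R x y);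
      Imp (R w x) (Imp (S x y) (Imp (R y z) (S w z)))].

Definition antireflexive := [:: Not (S x x)].

End Orders.

Definition semilattice (f : op2 L) :=
  [:: Eq (Op2 f x (Op2 f y z)) (Op2 f (Op2 f x y) z);
      Eq (Op2 f x y) (Op2 f y x);
      Eq (Op2 f x x) x].

Definition lattice (j m : op2 L) :=
  semilattice j ++ semilattice m ++
  [:: Eq (Op2 j x (Op2 m x y)) x;
      Eq (Op2 m x (Op2 j x y)) x].

Definition nontrivial_bounds (j m : op2 L) (zero one : cst L) :=
  [:: Eq (Op2 j x (Cst zero)) x;
      Eq (Op2 m x (Cst one)) x;
      Not (Eq (Cst zero) (Cst one))].

Definition nontrivial_boolean_algebra
    (j m : op2 L) (compl : op1 L) (zero one : cst L) :=
  lattice j m ++ nontrivial_bounds j m zero one ++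
  [:: Eq (Op2 m x (Op2 j y z)) (Op2 j (Op2 m x y) (Op2 m x z));
      Eq (Op2 j x (Op1 compl x)) (Cst one);
      Eq (Op2 m x (Op1 compl x)) (Cst zero)].

Definition nontrivial_heyting_algebra
    (j m imp : op2 L) (zero one : cst L)
    (R : term L var4 -> term L var4 -> formula L var4) :=
  lattice j m ++ nontrivial_bounds j m zero one ++
  [:: Imp (R (Op2 m x y) z) (R x (Op2 imp y z));
      Imp (R x (Op2 imp y z)) (R (Op2 m x y) z)].

End UniversalTheories.

Inductive base :=
  | PartialOrders | Lattices | JoinSemilattices | MeetSemilattices
  | BooleanAlgebras | HeytingAlgebras.

Inductive bound := Zero | One.
Inductive lattice_op := Join | Meet.
Inductive heyting_op := HJoin | HMeet | HImp.

Definition base_language (b : base) : language :=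
  match b with
  | PartialOrders => Language void void void unit
  | Lattices => Language void void lattice_op void
  | JoinSemilattices | MeetSemilattices => Language void void unit void
  | BooleanAlgebras => Language bound unit lattice_op void
  | HeytingAlgebras => Language bound void heyting_op void
  end.

Definition expand (L : language) : language :=
  Language (cst L) (op1 L) (op2 L) (option (rel2 L)).

Definition lang (b : base) : language := expand (base_language b).

(* The new relation symbol, written << on paper, is [None]. *)
Definition ll_formula (b : base) V (t u : term (lang b) V) :
    formula (lang b) V :=
  Rel (None : rel2 (lang b)) t u.

Definition le_formula (b : base) V :
    term (lang b) V -> term (lang b) V -> formula (lang b) V :=
  match b with
  | PartialOrders => fun t u => Rel (Some tt : rel2 (lang PartialOrders)) t u
  | Lattices => fun t u => Eq (Op2 (Join : op2 (lang Lattices)) t u) u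
  | JoinSemilattices =>
      fun t u => Eq (Op2 (tt : op2 (lang JoinSemilattices)) t u) u
  | MeetSemilattices =>
      fun t u => Eq (Op2 (tt : op2 (lang MeetSemilattices)) t u) t
  | BooleanAlgebras =>
      fun t u => Eq (Op2 (Join : op2 (lang BooleanAlgebras)) t u) u
  | HeytingAlgebras =>
      fun t u => Eq (Op2 (HJoin : op2 (lang HeytingAlgebras)) t u) u
  end.

Definition le_in (b : base) (A : structure (lang b)) (x y : A) : Prop :=
  sat (fun i : bool => if i then y else x)
      (le_formula (Var false) (Var true)).

Definition base_axioms (b : base) : seq (formula (lang b) var4) :=
  match b with
  | PartialOrders => partial_order (@le_formula PartialOrders var4)
  | Lattices => lattice (Join : op2 (lang Lattices)) Meet
  | JoinSemilattices => semilattice (tt : op2 (lang JoinSemilattices))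
  | MeetSemilattices => semilattice (tt : op2 (lang MeetSemilattices))
  | BooleanAlgebras =>
      nontrivial_boolean_algebra (L := lang BooleanAlgebras)
        Join Meet tt Zero One
  | HeytingAlgebras =>
      nontrivial_heyting_algebra (L := lang HeytingAlgebras)
        HJoin HMeet HImp Zero One (@le_formula HeytingAlgebras var4)
  end.

Inductive expansion := CoarserOrder | Linearization | AuxiliaryRelation.

(* The axioms 0 << 0 and 1 << 1 when there are bounds. *)
Definition ll_bounds (b : base) : seq (formula (lang b) var4) :=
  match b with
  | BooleanAlgebras =>
      [seq ll_formula (b := BooleanAlgebras)
             (Cst (c : cst (lang BooleanAlgebras)))
             (Cst (c : cst (lang BooleanAlgebras)))
      | c <- [:: Zero; One]]
  | HeytingAlgebras =>
      [seq ll_formula (b := HeytingAlgebras)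
             (Cst (c : cst (lang HeytingAlgebras)))
             (Cst (c : cst (lang HeytingAlgebras)))
      | c <- [:: Zero; One]]
  | _ => [::]
  end.

Definition expansion_axioms (b : base) (e : expansion) :
    seq (formula (lang b) var4) :=
  let le := @le_formula b var4 in
  let ll := @ll_formula b var4 in
  match e with
  | CoarserOrder => partial_order ll ++ coarser_relation le ll
  | Linearization =>
      partial_order ll ++ total_relation ll ++ coarser_relation le ll
  | AuxiliaryRelation => auxiliary_relation le ll ++ ll_bounds b
  end.

Inductive theory_name := Expansion of base & expansion | CausalSpaces.

Definition base_of (t : theory_name) : base :=
  match t with
  | Expansion b _ => b
  | CausalSpaces => PartialOrders
  end.

Definition theory_of (t : theory_name) : theory (lang (base_of t)) :=
  match t with
  | Expansion b e => axiomatized_by (base_axioms b ++ expansion_axioms b e)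
  | CausalSpaces =>
      axiomatized_by (base_axioms PartialOrders ++
        auxiliary_relation (@le_formula PartialOrders var4)
                           (@ll_formula PartialOrders var4) ++
        antireflexive (@ll_formula PartialOrders var4))
  end.

Arguments theory_of t : clear implicits.

(* Main.v *)
From mathcomp Require Import all_boot.
From mathcomp Require Import boolp classical_sets functions cardinality filter.
Require Import Defs.

Set Implicit Arguments.
Unset Strict Implicit.
Unset Printing Implicit Defensive.

Local Open Scope classical_set_scope.

(** Amalgamation.  For orders, semilattices and lattices, glue [A] and [B] along
    [C], putting [a <= b] when [a <= c <= b] for some [c] in [C]; joins and meets
    of [A] and [B] remain joins and meets there, hence also in the MacNeille
    completion.  For Boolean and Heyting algebras, take sets (resp. up-sets) of
    pairs of prime filters of [A] and [B] with the same trace on [C]; implication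
    in [C] supplies the interpolants.  In each case [a <= b] in the amalgam only
    through [C], so [<<] extends: as the transitive closure of its given parts
    with [<=] (then linearized if needed), or, when auxiliary, as
    [x <= u << v <= y].

    Limits.  The construction preserves finiteness, so the finite models have a
    Fraisse limit [M], obtained as the union of a chain that solves at stage [n]
    all extension problems between the first [n] finite structures.  Outside the
    cases of lattices and Heyting algebras there are finitely many terms in given
    variables up to equivalence, so the quantifier-free type of a tuple is a
    single formula; homogeneity of [M] then gives quantifier elimination and, by
    back and forth, categoricity.  Every model of [T] is locally embeddable in
    [M], hence embeds in an ultrapower of [M]. *)

(** * Finite types *)

(** Every base theory feeds one interface, [base_amalgamates]: between the images of [A] and [B] the
    order of the amalgam is exactly [sum_rel]. The extension of [<<] rests on that equivalence and
    never looks at the operations, so six base constructions and three relational ones cover all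
    combinations. Strongness comes along: [i a = k b] amounts to two inequalities, and the two
    interpolants closing such a cycle coincide.

    Joint embedding is amalgamation over an initial structure: the empty one, or the two-element
    algebra when there are constants. There [<<] must be determined on 0 and 1, which is the purpose
    of nontriviality and of the axioms 0 << 0 and 1 << 1.

    Finiteness of terms enters twice: finitely many atomic formulas decide an atomic type, and
    finitely generated substructures of arbitrary models of [T] are finite, hence in the age of [M].
    Finitely generated free lattices and Heyting algebras can be infinite. That [M] is a model of
    [T] holds because universal axioms are tested on finitely generated substructures; that it is
    infinite, because strong amalgams of two copies of a finite [M] do not fit back into [M]. *)

Definition fin (A : Type) : Prop :=
  exists (F : finType) (p : F -> A), forall a, exists x, p x = a.

Lemma fin_finType (F : finType) : fin F.
Proof. by exists F, id => a; exists a. Qed.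

Lemma fin_surj (A B : Type) (f : A -> B) :
  (forall b, exists a, f a = b) -> fin A -> fin B.
Proof.
move=> fs [F [p ps]]; exists F, (f \o p) => b.
by have [a <-] := fs b; have [x <-] := ps a; exists x.
Qed.

Lemma fin_inj (A B : Type) (f : A -> B) : injective f -> fin B -> fin A.
Proof.
move=> fI [F [p ps]].
pose G := {x : F | `[< exists a, f a = p x >]}.
have H (x : G) : exists a, f a = p (val x) by case: x => x /= /asboolP.
have [g gE] := choice H.
exists G, g => a; have [x xE] := ps (f a).
have Px : `[< exists a, f a = p x >] by apply/asboolP; exists a.
by exists (exist _ x Px); apply: fI; rewrite gE.
Qed.

Lemma fin_prod (A B : Type) : fin A -> fin B -> fin (A * B).
Proof.
move=> [F [p ps]] [G [q qs]]; exists (F * G)%type, (fun x => (p x.1, q x.2)).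
by move=> [a b]; have [x <-] := ps a; have [y <-] := qs b; exists (x, y).
Qed.

Lemma fin_sum (A B : Type) : fin A -> fin B -> fin (A + B).
Proof.
move=> [F [p ps]] [G [q qs]].
exists (F + G)%type,
  (fun x => match x with inl x => inl (p x) | inr y => inr (q y) end).
move=> [a|b]; first by have [x <-] := ps a; exists (inl x).
by have [y <-] := qs b; exists (inr y).
Qed.

Lemma fin_option (A : Type) : fin A -> fin (option A).
Proof.
move=> [F [p ps]]; exists (option F), (omap p) => -[a|]; last by exists None.
by have [x <-] := ps a; exists (Some x).
Qed.

Lemma fin_sigT (I : Type) (T : I -> Type) :
  fin I -> (forall i, fin (T i)) -> fin {i & T i}.
Proof.
move=> [F [p ps]] H.
pose G x : finType := sval (cid (H (p x))).
pose q x : G x -> T (p x) := sval (cid (svalP (cid (H (p x))))).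
have qs x a : exists y, q x y = a := svalP (cid (svalP (cid (H (p x))))) a.
exists {x : F & G x}, (fun u => existT T (p (tag u)) (q _ (tagged u))).
move=> [i a]; have [x xE] := ps i; subst i.
by have [y <-] := qs x a; exists (existT _ x y).
Qed.

Lemma fin_fun (A B : Type) : fin A -> fin B -> fin (A -> B).
Proof.
move=> [F [p ps]] [G [q qs]].
have [s sE] := choice ps; have [r rE] := choice qs.
exists {ffun F -> G}, (fun (f : {ffun F -> G}) a => q (f (s a))) => f.
exists [ffun x => r (f (p x))]; apply: funext => a.
by rewrite ffunE rE sE.
Qed.

Lemma fin_Prop : fin Prop.
Proof.
exists bool, (fun b : bool => b : Prop) => P.
by exists `[<P>]; rewrite asboolE.
Qed.

Lemma fin_set (A : Type) : fin A -> fin (set A).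
Proof. by move=> fA; apply: fin_fun fA fin_Prop. Qed.

Lemma finite_set_range (A : Type) (X : set A) :
  finite_set X -> exists (n : nat) (p : 'I_n -> A), X `<=` range p.
Proof.
move=> [n /card_bijP [f [g fK gK]]].
have H (i : 'I_n) : `I_n i by exact: ltn_ord.
exists n, (fun i => val (g (SigSub (mem_set (H i))))) => a Xa.
pose x := f (SigSub (mem_set Xa)); have xP := set_mem (valP x).
exists (Ordinal xP) => //; set y := SigSub _.
have -> : y = x by apply: val_inj.
by rewrite /x fK.
Qed.

(** Surjections from a [finType] pass to images, sums, products and function spaces without
    decidable equality on [A]; this is the bridge back to the notion used in [finite_models]. *)
Lemma finP (A : Type) : fin A <-> finite_set [set: A].
Proof.
split=> [[F [p ps]]|/finite_set_range [n [p ps]]].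
  have -> : [set: A] = range p.
    by apply/seteqP; split=> // a _; have [x <-] := ps a; exists x.
  exact: finite_image finite_finset.
by exists 'I_n, p => a; have [//|x _ <-] := ps a; exists x.
Qed.

Lemma fin_ord_bij (A : Type) :
  fin A -> exists (n : nat) (f : 'I_n -> A), bijective f.
Proof.
move=> /finP [n /card_bijP [f [g fK gK]]].
have H (i : 'I_n) : `I_n i by exact: ltn_ord.
have aT (a : A) : a \in [set: A] by rewrite in_setT.
exists n, (fun i => val (g (SigSub (mem_set (H i))))).
exists (fun a => Ordinal (set_mem (valP (f (SigSub (aT a)))))).
  move=> i; apply: val_inj => /=; set x := g _.
  have -> : SigSub (aT (val x)) = x by apply: val_inj.
  by rewrite /x gK.
move=> a; set y := SigSub _.
have -> : y = f (SigSub (aT a)) by apply: val_inj.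
by rewrite fK.
Qed.

(** A point outside the range would have an injective orbit under [f], embedding [nat] into a finite
    type. *)
Lemma fin_inj_surj (A : Type) (f : A -> A) :
  fin A -> injective f -> forall y, exists x, f x = y.
Proof.
move=> fA fI y; apply: contrapT => ny.
have H m k : iter m f y <> iter (m + k.+1) f y.
  elim: m => [|m IH]; last by rewrite addSn !iterS => /fI.
  by rewrite add0n iterS /= => e; apply: ny; exists (iter k f y).
apply: infinite_nat; apply/finP; apply: (@fin_inj _ _ (fun n => iter n f y)) fA.
move=> m n e; case: (ltngtP m n) => // /subnKC.
- by rewrite addSnnS => nE; case: (H m (n - m.+1)); rewrite nE.
- by rewrite addSnnS => mE; case: (H n (m - n.+1)); rewrite mE.
Qed.

(** * Syntax and embeddings *)

Section Syntax.
Variable L : language.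

Fixpoint rename_term V W (r : V -> W) (t : term L V) : term L W :=
  match t with
  | Var x => Var (r x)
  | Cst c => Cst c
  | Op1 f t => Op1 f (rename_term r t)
  | Op2 f t u => Op2 f (rename_term r t) (rename_term r u)
  end.

Fixpoint rename V W (r : V -> W) (phi : formula L V) : formula L W :=
  match phi with
  | Bot => Bot
  | Eq t u => Eq (rename_term r t) (rename_term r u)
  | Rel s t u => Rel s (rename_term r t) (rename_term r u)
  | Imp p q => Imp (rename r p) (rename r q)
  | All p => All (rename (omap r) p)
  end.

Lemma eval_rename (A : structure L) V W (r : V -> W) (v : W -> A) t :
  eval v (rename_term r t) = eval (v \o r) t.
Proof. by elim: t => //= [f t -> //|f t -> u ->]. Qed.

Lemma sat_rename (A : structure L) V W (r : V -> W) (v : W -> A)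
    (phi : formula L V) :
  sat v (rename r phi) <-> sat (v \o r) phi.
Proof.
elim: phi W r v => {V} [V|V t u|V s t u|V p IHp q IHq|V p IHp] W r v //=.
- by rewrite !eval_rename.
- by rewrite !eval_rename.
- by split=> H /IHp /H /IHq.
- by split=> H a; have := H a; rewrite IHp;
    (have -> : oapp v a \o omap r = oapp (v \o r) a by apply: funext => -[]).
Qed.

Lemma quantifier_free_rename V W (r : V -> W) (phi : formula L V) :
  quantifier_free (rename r phi) = quantifier_free phi.
Proof. by elim: phi W r => {V} //= V p IHp q IHq W r; rewrite IHp IHq. Qed.

(** Quantifiers bind the variable [None] of an [option] type, so [unlift ord0] first turns variable
    0 into [None]. The closure lets a fact about all tuples of [M] travel to every model of
    [Th M]. *)
Fixpoint univ_closure_ord n : formula L 'I_n -> sentence L :=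
  match n return formula L 'I_n -> sentence L with
  | 0 => rename (fun i : 'I_0 => match notF (ltn_ord i) with end)
  | m.+1 => fun phi => univ_closure_ord (All (rename (unlift ord0) phi))
  end.

Lemma holds_univ_closure_ord (A : structure L) n (phi : formula L 'I_n) :
  holds A (univ_closure_ord phi) <-> forall v : 'I_n -> A, sat v phi.
Proof.
elim: n phi => [|n IH] phi /=.
  rewrite /holds sat_rename; set w := (_ \o _); split=> [H v|]; last exact.
  by have -> : v = w by apply: funext => -[].
rewrite IH /=; split=> H v.
  have := H (v \o lift ord0) (v ord0); rewrite sat_rename.
  by set w := (_ \o _); have -> // : w = v;
    apply: funext => i; rewrite /w /=; case: unliftP => [j|] ->.
by move=> a; rewrite sat_rename; exact: H.
Qed.

Definition univ_closure (V : finType) (phi : formula L V) : sentence L :=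
  univ_closure_ord (rename enum_rank phi).

Lemma holds_univ_closure (A : structure L) (V : finType) (phi : formula L V) :
  holds A (univ_closure phi) <-> forall v : V -> A, sat v phi.
Proof.
rewrite holds_univ_closure_ord; split=> H v; last by rewrite sat_rename; exact: H.
have := H (v \o enum_val); rewrite sat_rename.
by congr sat; apply: funext => x /=; rewrite enum_rankK.
Qed.

Lemma sat_Or (A : structure L) V (v : V -> A) (phi psi : formula L V) :
  sat v (Or phi psi) <-> sat v phi \/ sat v psi.
Proof.
split=> /= [H|[p /(_ p)//|//]].
by have [p|p] := pselect (sat v phi); [left|right; apply: H].
Qed.

Definition And V (phi psi : formula L V) := Not (Imp phi (Not psi)).

Lemma sat_And (A : structure L) V (v : V -> A) (phi psi : formula L V) :
  sat v (And phi psi) <-> sat v phi /\ sat v psi.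
Proof.
split=> /= [H|[p q] /(_ p) //].
by split; apply: contrapT => n; apply: H => p q; apply: n.
Qed.

Definition Ex V (phi : formula L (option V)) := Not (All (Not phi)).

Lemma sat_Ex (A : structure L) V (v : V -> A) (phi : formula L (option V)) :
  sat v (Ex phi) <-> exists a, sat (oapp v a) phi.
Proof.
split=> /= [H|[a p] /(_ a) //].
by apply: contrapT => n; apply: H => a p; apply: n; exists a.
Qed.

Definition Iff V (phi psi : formula L V) := And (Imp phi psi) (Imp psi phi).

Lemma sat_Iff (A : structure L) V (v : V -> A) (phi psi : formula L V) :
  sat v (Iff phi psi) <-> (sat v phi <-> sat v psi).
Proof. by rewrite sat_And. Qed.

Lemma embedding_id (A : structure L) : embedding (@id A).
Proof. by split. Qed.

Lemma embedding_comp (A B C : structure L) (f : A -> B) (g : B -> C) :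
  embedding f -> embedding g -> embedding (g \o f).
Proof.
move=> [fI fc f1 f2 fr] [gI gc g1 g2 gr]; split.
- exact: inj_comp.
- by move=> c /=; rewrite fc gc.
- by move=> o x /=; rewrite f1 g1.
- by move=> o x y /=; rewrite f2 g2.
- by move=> r x y /=; rewrite fr gr.
Qed.

Lemma embedding_factor (A B C : structure L) (f : A -> C) (g : B -> C)
    (h : A -> B) :
  embedding f -> embedding g -> (forall x, g (h x) = f x) -> embedding h.
Proof.
move=> [fI fc f1 f2 fr] [gI gc g1 g2 gr] E; split.
- by move=> x y e; apply: fI; rewrite -!E e.
- by move=> c; apply: gI; rewrite E fc gc.
- by move=> o x; apply: gI; rewrite E f1 g1 E.
- by move=> o x y; apply: gI; rewrite E f2 g2 !E.
- by move=> r x y; rewrite fr gr !E.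
Qed.

Lemma eval_embedding (A B : structure L) (f : A -> B) V (v : V -> A) t :
  embedding f -> eval (f \o v) t = f (eval v t).
Proof.
by case=> _ fc f1 f2 _; elim: t => //= [o t ->|o t -> u ->];
  rewrite ?f1 ?f2.
Qed.

Lemma sat_embedding (A B : structure L) (f : A -> B) V (v : V -> A)
    (phi : formula L V) :
  embedding f -> quantifier_free phi -> sat (f \o v) phi <-> sat v phi.
Proof.
move=> fE; have [fI _ _ _ fr] := fE.
elim: phi v => {V} //= [V t u|V s t u|V p IHp q IHq] v.
- by rewrite !eval_embedding //; split=> [/fI|->].
- by rewrite !eval_embedding // -fr.
- by move=> /andP [qp qq]; rewrite IHp // IHq.
Qed.

Lemma sat_isomorphism (A B : structure L) (f : A -> B) V (v : V -> A)
    (phi : formula L V) :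
  isomorphism f -> sat (f \o v) phi <-> sat v phi.
Proof.
move=> [fE fs]; have [fI _ _ _ fr] := fE.
elim: phi v => {V} //= [V t u|V s t u|V p IHp q IHq|V p IHp] v.
- by rewrite !eval_embedding //; split=> [/fI|->].
- by rewrite !eval_embedding // -fr.
- by rewrite IHp IHq.
- have E a : oapp (f \o v) (f a) = f \o oapp v a.
    by apply: funext => -[].
  split=> H a; first by have := H (f a); rewrite E IHp.
  by have [x <-] := fs a; rewrite E IHp.
Qed.

End Syntax.

(** * Generated substructures *)

Section Generated.
Variable L : language.

Section Gen.
Variables (A : structure L) (V : Type) (v : V -> A).

(** Elements carry the mere existence of a term. [gen_term] picks one and the operations act on it,
    so that results are again values of terms; [gen_embedding] shows that the choice does not
    matter. *)
Definition gen_carrier := {x : A | exists t, eval v t = x}.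

Definition gen_elt (t : term L V) : gen_carrier :=
  exist _ (eval v t) (ex_intro _ t erefl).

Definition gen_term (x : gen_carrier) : term L V := sval (cid (svalP x)).

Lemma gen_termK x : eval v (gen_term x) = sval x.
Proof. exact: svalP (cid (svalP x)). Qed.

Definition gen : structure L := @Structure L gen_carrier
  (fun c => gen_elt (Cst c))
  (fun o x => gen_elt (Op1 o (gen_term x)))
  (fun o x y => gen_elt (Op2 o (gen_term x) (gen_term y)))
  (fun r x y => irel2 r (sval x) (sval y)).

Lemma gen_embedding : embedding (sval : gen -> A).
Proof.
split=> //= [x y|o x|o x y]; last 2 first.
- by rewrite gen_termK.
- by rewrite !gen_termK.
- by case: x y => [x px] [y py] /= e; apply: eq_exist.
Qed.

Lemma gen_finitely_generated : fin V -> finitely_generated gen.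
Proof.
move=> fV; exists (range (fun x : V => gen_elt (Var x) : gen)).
  by apply: finite_image; apply/finP.
move=> P [Pc P1 P2] XP; apply/seteqP; split=> // x _.
have tP t : P (gen_elt t).
  elim: t => [y|c|o t IH|o t IHt u IHu].
  - by apply: XP; exists y.
  - by have := Pc c.
  - have := P1 o _ IH; congr P; apply: eq_exist => /=; by rewrite gen_termK.
  - have := P2 o _ _ IHt IHu; congr P; apply: eq_exist => /=.
    by rewrite !gen_termK.
by have := tP (gen_term x); congr P; case: x => x px; apply: eq_exist;
  rewrite /= gen_termK.
Qed.

End Gen.

Definition same_atoms (A B : structure L) V (v : V -> A) (w : V -> B) :=
  (forall t u, eval v t = eval v u <-> eval w t = eval w u) /\
  (forall r t u, irel2 r (eval v t) (eval v u) <->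
                 irel2 r (eval w t) (eval w u)).

(** Tuples of the same atomic type generate isomorphic substructures: sending [eval v t] to
    [eval w t] is well defined and injective by the clause on equalities. *)
Lemma gen_map (A B : structure L) V (v : V -> A) (w : V -> B) :
  same_atoms v w ->
  exists2 g : gen v -> B, embedding g & forall t, g (gen_elt v t) = eval w t.
Proof.
move=> [E R].
have K t : eval w (gen_term (gen_elt v t)) = eval w t.
  by apply/E; rewrite gen_termK.
exists (fun x => eval w (gen_term x)) => //; split.
- by move=> x y /E; rewrite !gen_termK; case: x y => x px [y py] /=;
    apply: eq_exist.
- by move=> c; exact: (K (Cst c)).
- by move=> o x; exact: (K (Op1 o _)).
- by move=> o x y; exact: (K (Op2 o _ _)).
- by move=> r x y; rewrite -R !gen_termK.
Qed.

Lemma fin_finitely_generated (A : structure L) :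
  fin A -> finitely_generated A.
Proof.
move=> /finP fA; exists setT => // P _ H.
by apply/seteqP; split=> // x _; apply: H.
Qed.

End Generated.

(** * Back and forth *)

Section BackAndForth.
Variables (L : language) (M N : structure L).

(** Isomorphisms between substructures are kept as graphs, so that the limit of a chain is a plain
    union and no partial functions occur. *)
Definition local_isomorphism (G : M -> N -> Prop) : Prop :=
  [/\ forall c, G (icst M c) (icst N c),
      forall o x y, G x y -> G (iop1 o x) (iop1 o y),
      forall o x y x' y', G x y -> G x' y' -> G (iop2 o x x') (iop2 o y y'),
      forall x y x' y', G x y -> G x' y' -> (x = x' <-> y = y') &
      forall r x y x' y', G x y -> G x' y' -> (irel2 r x x' <-> irel2 r y y')].

Lemma back_and_forth (GG : set (M -> N -> Prop)) (G0 : M -> N -> Prop) :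
  countable [set: M] -> countable [set: N] ->
  (forall G, GG G -> local_isomorphism G) ->
  (forall G x, GG G -> exists G', [/\ GG G',
     forall a b, G a b -> G' a b & exists y, G' x y]) ->
  (forall G y, GG G -> exists G', [/\ GG G',
     forall a b, G a b -> G' a b & exists x, G' x y]) ->
  GG G0 ->
  exists2 h : M -> N, isomorphism h & forall x y, G0 x y -> h x = y.
Proof.
move=> /countable_injP [f fI] /countable_injP [g gI] GGl forth back GG0.
have {}fI x y : f x = f y -> x = y by apply: fI; rewrite in_setT.
have {}gI x y : g x = g y -> x = y by apply: gI; rewrite in_setT.
(* Stage [n] handles the elements coded by [n], if there are any: the injections into [nat] need not
   be onto. *)
have step (p : nat * {G | GG G}) : exists G' : {G | GG G},
    [/\ forall a b, sval p.2 a b -> sval G' a b,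
        forall x, f x = p.1 -> exists y, sval G' x y &
        forall y, g y = p.1 -> exists x, sval G' x y].
  case: p => n [G GGG] /=.
  have [G1 [GG1 s1 t1]] : exists G1, [/\ GG G1,
      forall a b, G a b -> G1 a b & forall x, f x = n -> exists y, G1 x y].
    have [[x xn]|nx] := pselect (exists x, f x = n); last first.
      by exists G; split=> // x xn; case: nx; exists x.
    have [G1 [GG1 s1 t1]] := forth G x GGG; exists G1; split=> // z zn.
    by rewrite (fI z x) // zn.
  have [G2 [GG2 s2 t2]] : exists G2, [/\ GG G2,
      forall a b, G1 a b -> G2 a b & forall y, g y = n -> exists x, G2 x y].
    have [[y yn]|ny] := pselect (exists y, g y = n); last first.
      by exists G1; split=> // y yn; case: ny; exists y.
    have [G2 [GG2 s2 t2]] := back G1 y GG1; exists G2; split=> // z zn.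
    by rewrite (gI z y) // zn.
  exists (exist _ G2 GG2); split=> //= [a b /s1 /s2 //|x /t1 [y /s2 xy]].
  by exists y.
have [s sE] := choice step.
pose Gs := fix Gs n := match n with
  | 0 => exist _ G0 GG0
  | m.+1 => s (m, Gs m) end.
have mono m n a b : m <= n -> sval (Gs m) a b -> sval (Gs n) a b.
  move=> /subnK <-; elim: (n - m) => // k IH /IH H.
  by rewrite addSn /=; case: (sE (k + m, Gs (k + m))) => /(_ _ _ H).
pose U x y := exists n, sval (Gs n) x y.
have U2 x y x' y' : U x y -> U x' y' ->
    exists n, sval (Gs n) x y /\ sval (Gs n) x' y'.
  move=> [m xy] [n xy']; exists (maxn m n).
  by split; [apply: mono xy|apply: mono xy']; rewrite ?leq_maxl ?leq_maxr.
have Gl n := GGl _ (svalP (Gs n)).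
have Ut x : exists y, U x y.
  have [_ /(_ x erefl) [y xy] _] := sE (f x, Gs (f x)).
  by exists y, (f x).+1.
have Us y : exists x, U x y.
  have [_ _ /(_ y erefl) [x xy]] := sE (g y, Gs (g y)).
  by exists x, (g y).+1.
have Ui x y x' y' : U x y -> U x' y' -> (x = x' <-> y = y').
  by move=> a b; have [n [c d]] := U2 _ _ _ _ a b; case: (Gl n) => _ _ _ + _; apply.
have [h hU] := choice Ut.
exists h; last by move=> x y xy; apply/(Ui x _ x y) => //; exists 0.
have hE x y : U x y -> h x = y by move=> xy; apply/(Ui x _ x y).
split; last by move=> y; have [x xy] := Us y; exists x; exact: hE.
split.
- by move=> x y e; apply/(Ui _ _ _ _ (hU x) (hU y)).
- by move=> c; apply: hE; exists 0; case: (Gl 0).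
- move=> o x; apply: hE; have [n xy] := hU x; exists n.
  by case: (Gl n) => _ + _ _ _; apply.
- move=> o x y; apply: hE; have [n [a b]] := U2 _ _ _ _ (hU x) (hU y).
  by exists n; case: (Gl n) => _ _ + _ _; apply.
- move=> r x y; have [n [a b]] := U2 _ _ _ _ (hU x) (hU y).
  by case: (Gl n) => _ _ _ _; apply.
Qed.

End BackAndForth.

(** * Quantifier elimination and categoricity of homogeneous structures *)

(** Uniform local finiteness: the representatives [tau] serve all models of [T] at once, so they can
    be used inside formulas. *)
Definition finitely_many_terms (L : language) (T : theory L) : Prop :=
  forall V : finType, exists (F : finType) (tau : F -> term L V),
    forall t, exists f, forall (A : structure L) (v : V -> A),
      models T A -> eval v t = eval v (tau f).

Section Homogeneous.
Variable L : language.

(** Over the empty list an invariant property is empty or full. Otherwise [Q] is split by the truth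
    of the head formula, and each half is definable over the tail. *)
Lemma definable (V : Type) (I : eqType) (at_ : I -> formula L V) (l : seq I)
    (M : structure L) (Q : (V -> M) -> Prop) :
  (forall i, quantifier_free (at_ i)) ->
  (forall v w, (forall i, i \in l -> sat v (at_ i) <-> sat w (at_ i)) ->
     Q v -> Q w) ->
  exists2 psi : formula L V, quantifier_free psi &
    forall v : V -> M, Q v <-> sat v psi.
Proof.
move=> qf; elim: l Q => [|i l IH] Q Qinv.
  have [[v Qv]|nQ] := pselect (exists v, Q v).
    exists (Imp Bot Bot) => // w; split=> [_ //|_].
    by apply: (Qinv v) => // i; rewrite in_nil.
  by exists Bot => // w; split=> // Qw; apply: nQ; exists w.
pose same (v w : V -> M) := forall i, i \in l -> sat v (at_ i) <-> sat w (at_ i).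
(* The part of [Q] where [at_ i] holds, saturated under agreement on [l] so that the induction
   hypothesis applies. *)
have [|p1 q1 H1] := IH (fun v => exists w, [/\ same w v, sat w (at_ i) & Q w]).
  move=> v w vw [u [uv iu Qu]]; exists u; split=> // j jl.
  by rewrite uv // vw.
have [|p2 q2 H2] := IH (fun v => exists w, [/\ same w v, ~ sat w (at_ i) & Q w]).
  move=> v w vw [u [uv iu Qu]]; exists u; split=> // j jl.
  by rewrite uv // vw.
exists (Or (And (at_ i) p1) (And (Not (at_ i)) p2)); first by rewrite /= qf q1 q2.
move=> v; rewrite sat_Or !sat_And -H1 -H2; split=> [Qv|].
  by have [vi|vi] := pselect (sat v (at_ i)); [left|right]; split=> //; exists v.
case=> -[vi [w [wv wi Qw]]]; apply: (Qinv w) => // j;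
  rewrite inE => /orP [/eqP ->|/wv //].
  by split.
by split=> [/wi|/vi].
Qed.

(** The conjunction of the listed formulas or their negations, as [v] decides; one formula works for
    every [B]. *)
Lemma complete_type (V : Type) (I : eqType) (at_ : I -> formula L V) (l : seq I)
    (A : structure L) (v : V -> A) :
  exists theta : formula L V, forall (B : structure L) (w : V -> B),
    sat w theta <-> forall i, i \in l -> sat v (at_ i) <-> sat w (at_ i).
Proof.
elim: l => [|i l [th H]].
  by exists (Imp Bot Bot) => B w; split=> [_ i|_ []]; rewrite ?in_nil.
exists (And (if `[< sat v (at_ i) >] then at_ i else Not (at_ i)) th) => B w.
rewrite sat_And H; have -> : sat w (if `[< sat v (at_ i) >] then at_ i
    else Not (at_ i)) <-> (sat v (at_ i) <-> sat w (at_ i)).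
  case: asboolP => /= vi; split=> [wi|[H1 H2]].
  - by split.
  - exact: H1.
  - by split=> [/vi|/wi].
  - by move=> /H2.
split=> [[a b] j|H']; first by rewrite inE => /orP [/eqP -> //|/b].
by split=> [|j jl]; apply: H'; rewrite inE ?eqxx ?jl ?orbT.
Qed.

(** The variable type has no decidable equality, so a finite support is a fresh [finType] mapped
    into it. Arbitrary variable types matter because model completion uses the elements of a model
    as variables. *)
Lemma term_support (U : Type) (t : term L U) :
  exists (W : finType) (t' : term L W) (r : W -> U),
    forall (A : structure L) (v : U -> A), eval v t = eval (v \o r) t'.
Proof.
elim: t => [x|c|o t [W [t' [r E]]]|o t [W [t' [r E]]] u [X [u' [s F]]]].
- by exists unit, (Var tt), (fun=> x).
- by exists void, (Cst c), (@of_void U).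
- by exists W, (Op1 o t'), r => A v /=; rewrite E.
- exists (W + X)%type, (Op2 o (rename_term inl t') (rename_term inr u')),
    (fun x => match x with inl x => r x | inr x => s x end).
  by move=> A v /=; rewrite !eval_rename E F.
Qed.

Lemma qf_support (U : Type) (q : formula L U) :
  quantifier_free q ->
  exists (W : finType) (q' : formula L W) (r : W -> U),
    forall (A : structure L) (v : U -> A), sat v q <-> sat (v \o r) q'.
Proof.
elim: q => {U} // [U|U t u|U s t u|U p IHp q IHq] /=.
- by exists void, Bot, (@of_void U).
- move=> _; have [W [t' [r E]]] := term_support t.
  have [X [u' [s F]]] := term_support u.
  exists (W + X)%type, (Eq (rename_term inl t') (rename_term inr u')),
    (fun x => match x with inl x => r x | inr x => s x end).
  by move=> A v /=; rewrite !eval_rename E F.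
- move=> _; have [W [t' [r E]]] := term_support t.
  have [X [u' [z F]]] := term_support u.
  exists (W + X)%type, (Rel s (rename_term inl t') (rename_term inr u')),
    (fun x => match x with inl x => r x | inr x => z x end).
  by move=> A v /=; rewrite !eval_rename E F.
- move=> /andP [/IHp [W [t' [r E]]] /IHq [X [u' [z F]]]].
  exists (W + X)%type, (Imp (rename inl t') (rename inr u')),
    (fun x => match x with inl x => r x | inr x => z x end).
  by move=> A v /=; rewrite !sat_rename E F.
Qed.

(** The bound variable must stay outside the finite support: support elements sent to [None] are
    merged into it by [insub], the others form the new [W]. *)
Lemma qf_support_option (V : Type) (q : formula L (option V)) :
  quantifier_free q ->
  exists (W : finType) (q' : formula L (option W)) (r : W -> V),
    forall (A : structure L) (v : option V -> A),
      sat v q <-> sat (v \o omap r) q'.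
Proof.
move=> /qf_support [W [q' [r E]]].
have H (w : {w : W | r w}) : exists x, r (val w) = Some x.
  by case: w => w /=; case: (r w) => // x _; exists x.
have [r' r'E] := choice H.
exists {w : W | r w}, (rename insub q'), r' => A v.
rewrite sat_rename E.
suff -> : v \o r = (v \o omap r') \o insub by [].
apply: funext => w /=; case: insubP => [w' _ <-|] /=; first by rewrite r'E.
by case: (r w).
Qed.

Variable T : theory L.
Hypothesis terms_fin : finitely_many_terms T.
Hypothesis rel_fin : fin (rel2 L).

(** Equations and relations between representative terms; finitely many terms and relation symbols
    make the list finite. *)
Lemma test_formulas (V : finType) :
  exists (I : finType) (at_ : I -> formula L V),
    (forall i, quantifier_free (at_ i)) /\
    forall (A B : structure L) (v : V -> A) (w : V -> B),
      models T A -> models T B ->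
      (forall i, i \in enum I -> sat v (at_ i) <-> sat w (at_ i)) ->
      same_atoms v w.
Proof.
have [F [tau tauE]] := terms_fin V; have [R [p ps]] := rel_fin.
exists (F * F * option R)%type, (fun i => let: (f, g, o) := i in
  if o is Some r then Rel (p r) (tau f) (tau g) else Eq (tau f) (tau g)).
split; first by move=> [[f g] [r|]].
move=> A B v w TA TB H.
have {}H i := H i (mem_enum _ _).
split=> [t u|r t u]; have [f fE] := tauE t; have [g gE] := tauE u;
  rewrite !fE ?gE //; first exact: (H (f, g, None)).
by have [x <-] := ps r; exact: (H (f, g, Some x)).
Qed.

Lemma same_atoms_qf (A B : structure L) V (v : V -> A) (w : V -> B)
    (phi : formula L V) :
  same_atoms v w -> quantifier_free phi -> sat v phi <-> sat w phi.
Proof.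
move=> [E R]; elim: phi A B v w E R => //= {}V p IHp q IHq A B v w E R.
by move=> /andP [pq qq]; rewrite (IHp A B v w) // (IHq A B v w).
Qed.

Variable M : structure L.
Hypothesis TM : models T M.
Hypothesis Mh : ultrahomogeneous M.

Lemma models_Th (A : structure L) : models (Th M) A -> models T A.
Proof. by move=> MA phi /TM; exact: MA. Qed.

(** The isomorphism of generated substructures extends to an automorphism of [M] carrying [v] to
    [w], and automorphisms preserve all formulas. *)
Lemma homogeneous_same_atoms (V : finType) (v w : V -> M) (phi : formula L V) :
  same_atoms v w -> sat v phi <-> sat w phi.
Proof.
move=> vw; have [g gE gw] := gen_map vw.
have [h hI hE] := Mh (gen_finitely_generated v (fin_finType V))
  (gen_embedding v) gE.
rewrite -(sat_isomorphism v phi hI).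
suff -> : h \o v = w by [].
apply: funext => x; have := gw (Var x); rewrite -hE /=; exact.
Qed.

(** In [M] the property defined by [phi] depends only on the atomic type, hence is definable without
    quantifiers; the resulting equivalence is a sentence of [Th M] and holds in all its models. *)
Lemma qe_finType (V : finType) (phi : formula L V) :
  exists2 psi : formula L V, quantifier_free psi &
    forall (A : structure L) (v : V -> A),
      models (Th M) A -> (sat v phi <-> sat v psi).
Proof.
have [I [at_ [qf test]]] := test_formulas V.
have [v w H|psi qpsi E] := @definable V I at_ (enum I) M (fun v => sat v phi) qf.
  by rewrite (homogeneous_same_atoms phi (test _ _ v w TM TM H)).
exists psi => // A v MA.
have : holds A (univ_closure (Iff phi psi)).
  by apply: MA; apply/holds_univ_closure => w; apply/sat_Iff.
by move/holds_univ_closure => /(_ v) /sat_Iff.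
Qed.

(** Eliminating the innermost quantifiers first leaves a body with finitely many variables besides
    the bound one, which reduces arbitrary [V] to the finite case. *)
Lemma qe_any (V : Type) (phi : formula L V) :
  exists2 psi : formula L V, quantifier_free psi &
    forall (A : structure L) (v : V -> A),
      models (Th M) A -> (sat v phi <-> sat v psi).
Proof.
elim: phi => {V} [V|V t u|V r t u|V p [p' qp Ep] q [q' qq Fq]|V p [p' qp Ep]].
- by exists Bot.
- by exists (Eq t u).
- by exists (Rel r t u).
- exists (Imp p' q') => /= [|A v MA]; first by rewrite qp qq.
  by rewrite Ep // Fq.
- have [W [q [r E]]] := qf_support_option qp.
  have [psi qpsi F] := qe_finType (All q).
  exists (rename r psi) => [|A v MA]; first by rewrite quantifier_free_rename.
  rewrite sat_rename -F //=.
  have oE a : oapp v a \o omap r = oapp (v \o r) a by apply: funext => -[].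
  by split=> H a; have := H a; rewrite Ep // E oE.
Qed.

Lemma homogeneous_quantifier_elimination : quantifier_elimination (Th M).
Proof. by move=> n phi; have := qe_finType phi. Qed.

(** After elimination both sides are the truth in [A] of one quantifier-free formula under the
    identity valuation. *)
Lemma homogeneous_completeness (A B C : structure L) (f : A -> B) (g : A -> C) :
  models (Th M) B -> models (Th M) C -> embedding f -> embedding g ->
  forall phi : formula L A, sat f phi <-> sat g phi.
Proof.
move=> MB MC fE gE phi; have [psi qpsi E] := qe_any phi.
by rewrite !E // -[f]/(f \o id) -[g]/(g \o id) !sat_embedding.
Qed.

(** A single formula [theta] expresses the atomic type of [v] extended by [a]. It is realized over
    [w] because [v] and [w] agree on [Ex theta], and quantifier elimination upgrades atomic
    agreement to full agreement. *)
Lemma extend_elementary (A B : structure L) (V : finType) (v : V -> A)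
    (w : V -> B) (a : A) :
  models (Th M) A -> models (Th M) B ->
  (forall phi : formula L V, sat v phi <-> sat w phi) ->
  exists b, forall phi : formula L (option V),
    sat (oapp v a) phi <-> sat (oapp w b) phi.
Proof.
move=> MA MB vw; have [I [at_ [qf test]]] := test_formulas (option V).
have [theta tE] := complete_type at_ (enum I) (oapp v a).
have /vw /sat_Ex [b /tE H] : sat v (Ex theta).
  by apply/sat_Ex; exists a; apply/tE.
exists b => phi; have [psi qpsi E] := qe_finType phi.
rewrite !E //; apply: same_atoms_qf qpsi; apply: test H; exact: models_Th.
Qed.

(** Back and forth between finite tuples satisfying the same formulas, each represented by the graph
    on the substructures it generates. *)
Lemma homogeneous_categorical (A B : structure L) :
  models (Th M) A -> countable [set: A] ->
  models (Th M) B -> countable [set: B] -> isomorphic A B.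
Proof.
move=> MA cA MB cB.
pose graph V (v : V -> A) (w : V -> B) := fun x y =>
  exists t : term L V, x = eval v t /\ y = eval w t.
pose GG := [set G | exists (V : finType) (v : V -> A) (w : V -> B),
  (forall phi : formula L V, sat v phi <-> sat w phi) /\ G = graph V v w].
pose e A := of_void A.
have mono V (v : V -> A) (w : V -> B) a b x y :
    graph V v w x y -> graph (option V) (oapp v a) (oapp w b) x y.
  by move=> [t [-> ->]]; exists (rename_term Some t); rewrite !eval_rename.
have [|G x [V [v [w [vw ->]]]]|G y [V [v [w [vw ->]]]]||h hI _] :=
    @back_and_forth L A B GG (graph void (e A) (e B)) cA cB.
- move=> _ [V [v [w [vw ->]]]]; split.
  + by move=> c; exists (Cst c).
  + by move=> o x y [t [-> ->]]; exists (Op1 o t).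
  + by move=> o x y x' y' [t [-> ->]] [u [-> ->]]; exists (Op2 o t u).
  + by move=> x y x' y' [t [-> ->]] [u [-> ->]]; exact: (vw (Eq t u)).
  + by move=> r x y x' y' [t [-> ->]] [u [-> ->]]; exact: (vw (Rel r t u)).
- have [y vwy] := extend_elementary x MA MB vw.
  exists (graph _ (oapp v x) (oapp w y)); split; last by exists y, (Var None).
    by exists (option V), (oapp v x), (oapp w y).
  exact: mono.
- have wv phi : sat w phi <-> sat v phi by rewrite vw.
  have [x vwx] := extend_elementary y MB MA wv.
  exists (graph _ (oapp v x) (oapp w y)); split; last by exists x, (Var None).
    by exists (option V), (oapp v x), (oapp w y); split=> // phi; rewrite vwx.
  exact: mono.
(* On the empty tuple formulas are sentences, and both models decide them as [M] does. *)
- exists void, (e A), (e B); split=> // phi.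
  have noE (C : structure L) (v w : void -> C) : v = w.
    by apply: funext => -[].
  have hE (C : structure L) : models (Th M) C -> (sat (e C) phi <-> holds M phi).
    move=> MC; have -> : sat (e C) phi <-> holds C phi.
      by rewrite /holds; set w := (X in _ <-> sat X _); rewrite (noE _ w (e C)).
    split=> [H|/MC //]; apply: contrapT => n.
    exact: (MC (Not phi) n).
  by rewrite !hE.
- by exists h.
Qed.

End Homogeneous.

(** * Direct limits of chains *)

Section DirectLimit.
Variables (L : language) (S : nat -> structure L).
Variable iota : forall n, S n -> S n.+1.
Hypothesis iotaE : forall n, embedding (@iota n).

Let point := {n & S n}.
Let next (p : point) : point := existT _ (tag p).+1 (iota (tagged p)).
Let pt n (x : S n) : point := existT _ n x.

(** Injectivity of dependent pairs at a fixed index, by uniqueness of equality proofs on [nat]. *)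
Lemma pt_inj n (x y : S n) : pt x = pt y -> x = y.
Proof.
move=> e; have H : tag (pt x) = tag (pt y) by rewrite e.
have : eq_rect _ S (tagged (pt x)) _ H = tagged (pt y).
  by case: _ / e H => /= H; rewrite eq_axiomK.
by rewrite /= eq_axiomK.
Qed.

Lemma next_inj : injective next.
Proof.
move=> [n x] [m y] e; have [nm] : (tag (next (pt x))) = tag (next (pt y)).
  by rewrite /pt e.
subst m; congr existT; have [iI _ _ _ _] := iotaE n; apply: iI.
exact: pt_inj e.
Qed.

(** Iterating [next] on dependent pairs avoids composite maps from [S m] to [S n] and the casts
    between indices they would require. *)
Let equiv p q := exists k l, iter k next p = iter l next q.

Lemma equiv_trans p q r : equiv p q -> equiv q r -> equiv p r.
Proof.
move=> [k [l e]] [k' [l' e']]; exists (k' + k), (l + l').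
by rewrite iterD e -iterD addnC iterD e' -iterD.
Qed.

Lemma equiv_sym p q : equiv p q -> equiv q p.
Proof. by move=> [k [l e]]; exists l, k. Qed.

(* [point -> Prop] rather than [set point], whose universe lies strictly above
   that of the carriers of structures. *)
Definition limit_carrier :=
  {X : point -> Prop | exists p, X = fun q => equiv p q}.

Definition limit_class (p : point) : limit_carrier :=
  exist _ (fun q => equiv p q) (ex_intro _ p erefl).

Lemma limit_classP p q : limit_class p = limit_class q <-> equiv p q.
Proof.
split=> [/(congr1 sval) /= e|e].
  have : equiv q q by exists 0, 0.
  by rewrite -[equiv q q]/((fun r => equiv q r) q) -e.
apply: eq_exist; apply: funext => r; apply: propext; split; apply: equiv_trans => //.
exact: equiv_sym.
Qed.

Definition to_limit n (x : S n) : limit_carrier := limit_class (pt x).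

Lemma to_limit_next n (x : S n) : to_limit (iota x) = to_limit x.
Proof. by apply/limit_classP; exists 0, 1. Qed.

Lemma tag_iter_next k p : tag (iter k next p) = k + tag p.
Proof. by elim: k => //= k ->. Qed.

Lemma to_limit_inj n : injective (@to_limit n).
Proof.
move=> x y /limit_classP [k [l e]].
have /eqP := congr1 (@tag _ _) e; rewrite !tag_iter_next eqn_add2r => /eqP kl.
subst l; apply: pt_inj; elim: k e => //= k IH /next_inj; exact: IH.
Qed.

Lemma limit_lift m n : m <= n ->
  exists2 f : S m -> S n, embedding f & forall x, to_limit (f x) = to_limit x.
Proof.
elim: n => [|n IH]; first by rewrite leqn0 => /eqP ->; exists id => //; exact: embedding_id.
rewrite leq_eqVlt => /orP [/eqP ->|/IH [f fE fl]].
  by exists id => //; exact: embedding_id.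
exists (@iota n \o f); first exact: embedding_comp.
by move=> x /=; rewrite to_limit_next.
Qed.

Lemma limit_rep (X : limit_carrier) :
  exists n, forall m, n <= m -> exists x : S m, to_limit x = X.
Proof.
case: X => X [[n x] XE]; exists n => m /limit_lift [f _ fl]; exists (f x).
rewrite fl; apply: eq_exist; by rewrite XE.
Qed.

Lemma limit_rep_fin (I : Type) (u : I -> limit_carrier) : fin I ->
  exists n, forall m, n <= m -> exists f : I -> S m, forall i, to_limit (f i) = u i.
Proof.
move=> [F [p ps]]; have [d dP] := choice (fun i => limit_rep (u (p i))).
exists (\max_i d i) => m dm.
suff H i : exists x : S m, to_limit x = u i by have [f fE] := choice H; exists f.
have [x <-] := ps i; apply: dP; exact: leq_trans (leq_bigmax x) dm.
Qed.

Lemma limit_rep2 (X Y : limit_carrier) :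
  exists t : {n & (S n * S n)%type},
    to_limit (tagged t).1 = X /\ to_limit (tagged t).2 = Y.
Proof.
have [n /(_ n (leqnn n)) [f fE]] :=
  limit_rep_fin (fun b : bool => if b then X else Y) (fin_finType bool).
exists (existT _ n (f true, f false)); split; [exact: (fE true)|exact: (fE false)].
Qed.

Lemma limit_rep1 (X : limit_carrier) : exists t : point, to_limit (tagged t) = X.
Proof. by have [t [e _]] := limit_rep2 X X; exists (pt (tagged t).1). Qed.

Let rep1 X := sval (cid (limit_rep1 X)).
Let rep2 X Y := sval (cid (limit_rep2 X Y)).

(** Operations and relations are computed at some stage holding representatives of all arguments;
    [to_limit_embedding] shows independence of the stage. *)
Definition limit : structure L := @Structure L limit_carrier
  (fun c => to_limit (icst (S 0) c))
  (fun o X => to_limit (iop1 o (tagged (rep1 X))))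
  (fun o X Y => to_limit (iop2 o (tagged (rep2 X Y)).1 (tagged (rep2 X Y)).2))
  (fun r X Y => irel2 r (tagged (rep2 X Y)).1 (tagged (rep2 X Y)).2).

Lemma to_limit_embedding n : embedding (@to_limit n : S n -> limit).
Proof.
(* The chosen and the given representatives live at different stages; both move to a common one,
   where injectivity of [to_limit] identifies them. *)
have lift2 m : exists N (f : S n -> S N) (g : S m -> S N),
    [/\ embedding f, embedding g, forall x, to_limit (f x) = to_limit x,
        forall x, to_limit (g x) = to_limit x &
        forall x y, to_limit x = to_limit y -> f x = g y].
  have [f fE fl] := limit_lift (leq_maxl n m).
  have [g gE gl] := limit_lift (leq_maxr n m).
  exists (maxn n m), f, g; split=> // x y e; apply: to_limit_inj.
  by rewrite fl gl.
split.
- exact: to_limit_inj.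
- move=> c /=; have [f [_ fc _ _ _] fl] := limit_lift (leq0n n).
  by rewrite -fc fl.
- move=> o x /=; move: (svalP (cid (limit_rep1 (to_limit x)))).
  rewrite -/(rep1 _); case: (rep1 _) => m y /= e.
  have [N [f [g [[_ _ f1 _ _] [_ _ g1 _ _] fl gl E]]]] := lift2 m.
  by rewrite -fl -gl f1 g1 (E _ _ (esym e)).
- move=> o x x' /=; move: (svalP (cid (limit_rep2 (to_limit x) (to_limit x')))).
  rewrite -/(rep2 _ _); case: (rep2 _ _) => m [y y'] /= [e e'].
  have [N [f [g [[_ _ _ f2 _] [_ _ _ g2 _] fl gl E]]]] := lift2 m.
  by rewrite -fl -gl f2 g2 (E _ _ (esym e)) (E _ _ (esym e')).
- move=> r x x' /=; move: (svalP (cid (limit_rep2 (to_limit x) (to_limit x')))).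
  rewrite -/(rep2 _ _); case: (rep2 _ _) => m [y y'] /= [e e'].
  have [N [f [g [[_ _ _ _ fr] [_ _ _ _ gr] fl gl E]]]] := lift2 m.
  by rewrite fr gr (E _ _ (esym e)) (E _ _ (esym e')).
Qed.

Lemma limit_countable : (forall n, fin (S n)) -> countable [set: limit].
Proof.
move=> fS; have -> : [set: limit] = \bigcup_n range (@to_limit n).
  apply/seteqP; split=> // X _; have [[n x] <-] := limit_rep1 X.
  by exists n => //; exists x.
apply: bigcup_countable => // n _; apply: finite_set_countable.
by apply: finite_image; apply/finP.
Qed.

End DirectLimit.

(** * Fraisse limits of classes of finite structures *)

Lemma isomorphism_inv (L : language) (A B : structure L) (f : A -> B) :
  isomorphism f -> exists g : B -> A,
    [/\ embedding g, cancel f g & cancel g f].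
Proof.
move=> [fE fs]; have [g gK] := choice fs; exists g.
have [fI _ _ _ _] := fE; split=> // [|x]; last exact: fI.
exact: embedding_factor (embedding_id B) fE gK.
Qed.

Section Fraisse.
Variable L : language.
Hypothesis cst_fin : fin (cst L).
Hypothesis op1_fin : fin (op1 L).
Hypothesis op2_fin : fin (op2 L).
Hypothesis rel_fin : fin (rel2 L).

(** The language is finite, so each initial segment [O n] of [nat] carries finitely many
    interpretations, collected in [D n]; [pickle] numbers all of them. *)
Lemma finite_structures_enum : exists E : nat -> structure L,
  (forall n, fin (E n)) /\
  forall A : structure L, fin A -> exists n (f : E n -> A), isomorphism f.
Proof.
(* The universe of ['I_n] is too large for a carrier. *)
pose O n := {i : nat | i < n}.
have OE n (i : nat) (h h' : i < n) : exist _ i h = exist _ i h' :> O n.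
  exact: eq_exist.
have fO n : fin (O n).
  apply: (@fin_surj 'I_n _ (fun i => exist _ (val i) (ltn_ord i) : O n)).
    by move=> [i h]; exists (Ordinal h); exact: OE.
  exact: fin_finType.
pose D n := ((cst L -> O n) * (op1 L -> O n -> O n) *
  (op2 L -> O n -> O n -> O n) * (rel2 L -> O n -> O n -> Prop))%type.
have fD n : fin (D n).
  rewrite /D.
  do ?[exact: fin_Prop | exact: fO | done | apply: fin_prod | apply: fin_fun].
pose F n : finType := sval (cid (fD n)).
pose p n : F n -> D n := sval (cid (svalP (cid (fD n)))).
have ps n a : exists y, p n y = a := svalP (cid (svalP (cid (fD n)))) a.
pose st n (d : D n) := @Structure L (O n) d.1.1.1 d.1.1.2 d.1.2 d.2.
(* Numbers that decode to nothing get a one-element structure, an arbitrary finite default. *)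
pose E k := match unpickle k : option {n : nat & F n} with
  | Some u => st _ (p (tag u) (tagged u))
  | None => @Structure L unit (fun=> tt) (fun _ _ => tt) (fun _ _ _ => tt)
              (fun _ _ _ => True) end.
exists E; split=> [k|A /fin_ord_bij [n [f0 [g0 f0K g0K]]]].
  by rewrite /E; case: unpickle => [u|]; [exact: fO|exact: fin_finType].
pose f (i : O n) := f0 (Ordinal (svalP i)).
pose g a : O n := exist _ (val (g0 a)) (ltn_ord (g0 a)).
have fK : cancel f g.
  by move=> [i h]; rewrite /g /f f0K; exact: OE.
have gK : cancel g f.
  by move=> a; rewrite /f -[RHS]g0K; congr f0; exact: val_inj.
have [y yE] := ps n ((fun c => g (icst A c)), (fun o x => g (iop1 o (f x))),
  (fun o x y => g (iop2 o (f x) (f y))), (fun r x y => irel2 r (f x) (f y))).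
exists (pickle (existT (fun n => F n) n y)); rewrite /E pickleK /= yE.
exists f; split; last by move=> a; exists (g a).
by split=> //=; exact: can_inj fK.
Qed.

Variable K : set (structure L).
Hypothesis K_fin : forall A, K A -> fin A.
Hypothesis K_sub : forall (A B : structure L) (f : A -> B),
  embedding f -> K B -> K A.
Hypothesis K_amalgamation : forall (A B C : structure L) (i1 : C -> A) (k1 : C -> B),
  K A -> K B -> K C -> embedding i1 -> embedding k1 ->
  exists (D : structure L) (i : A -> D) (k : B -> D), K D /\ amalgam i1 k1 i k.
Variable C0 : structure L.
Hypothesis K_C0 : K C0.
Hypothesis C0_initial : forall A, K A -> embeds C0 A.

(** The hypotheses are built in so that arbitrary functions can be listed as problems: there are
    finitely many between finite types, and those that are no embeddings are solved vacuously. *)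
Definition solves (S S' : structure L) (iota : S -> S')
    (A B : structure L) (e : A -> B) (f : A -> S) : Prop :=
  K A -> K B -> embedding e -> embedding f ->
  exists2 g : B -> S', embedding g & forall x, g (e x) = iota (f x).

Lemma solve_list (I : eqType) (A B : I -> structure L)
    (e : forall i, A i -> B i) (l : seq I)
    (S : structure L) (f : forall i, A i -> S) : K S ->
  exists (S' : structure L) (iota : S -> S'), [/\ K S', embedding iota &
    forall i, i \in l -> solves iota (e i) (f i)].
Proof.
elim: l S f => [|i l IH] S f KS.
  by exists S, id; split=> //; exact: embedding_id.
have [S1 [j [KS1 jE jS]]] : exists (S1 : structure L) (j : S -> S1),
    [/\ K S1, embedding j & solves j (e i) (f i)].
  have [[[KA KB] [eE fE]]|n] := pselect ((K (A i) /\ K (B i)) /\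
      (embedding (e i) /\ embedding (f i))); last first.
    exists S, id; split=> //; first exact: embedding_id.
    by move=> *; case: n.
  have [D [i0 [k0 [KD [iE kE com]]]]] := K_amalgamation KS KB KA fE eE.
  exists D, i0; split=> // _ _ _ _; exists k0 => // x.
  by have := congr1 (fun h => h x) com => /= ->.
have [S2 [j2 [KS2 j2E j2S]]] := IH S1 (fun i => j \o f i) KS1.
exists S2, (j2 \o j); split=> //; first exact: embedding_comp.
move=> k; rewrite inE => /orP [/eqP ->|kl] KA KB eE fE.
  have [g gE gP] := jS KA KB eE fE.
  exists (j2 \o g); first exact: embedding_comp.
  by move=> x /=; rewrite gP.
have [|g gE gP] := j2S k kl KA KB eE; first exact: embedding_comp.
by exists g.
Qed.

(** The problems with both codes at most [n] form a finite type, so one finite structure solves them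
    all. *)
Lemma fraisse_step (E : nat -> structure L) (n : nat) (S : {S | K S}) :
  (forall n, fin (E n)) ->
  exists r : {S' : {S | K S} & sval S -> sval S'},
    embedding (tagged r) /\
    forall j k (e : E j -> E k) (f : E j -> sval S), j <= n -> k <= n ->
      solves (tagged r) e f.
Proof.
move=> fE; case: S => S KS.
pose I := {j : 'I_n.+1 & {k : 'I_n.+1 & ((E j -> E k) * (E j -> S))%type}}.
have fI : fin I.
  apply: fin_sigT => [|j]; first exact: fin_finType.
  apply: fin_sigT => [|k]; first exact: fin_finType.
  by apply: fin_prod; apply: fin_fun => //; exact: K_fin.
have [F [p ps]] := fI.
have [S' [iota [KS' iE sol]]] := @solve_list F (fun x => E (tag (p x)))
  (fun x => E (tag (tagged (p x)))) (fun x => (tagged (tagged (p x))).1)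
  (enum F) S (fun x => (tagged (tagged (p x))).2) KS.
exists (existT (fun S' : {S | K S} => S -> sval S') (exist _ S' KS') iota).
split=> // j k e f jn kn.
have [x xE] := ps (existT _ (Ordinal (jn : j < n.+1))
  (existT _ (Ordinal (kn : k < n.+1)) (e, f))).
by have := sol x (mem_enum _ _); rewrite xE.
Qed.

Lemma fraisse_chain : exists (S : nat -> structure L)
    (iota : forall n, S n -> S n.+1),
  [/\ forall n, K (S n), forall n, embedding (@iota n) &
    forall n (A B : structure L) (e : A -> B) (f : A -> S n),
      exists m, forall (N : nat) (h : S n -> S N),
        m <= N -> embedding h -> solves (@iota N) e (h \o f)].
Proof.
have [E [fE EP]] := finite_structures_enum.
pose step n S := sval (cid (@fraisse_step E n S fE)).
have stepP n S := svalP (cid (@fraisse_step E n S fE)).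
pose Ss := fix Ss n : {S | K S} := match n with
  | 0 => exist _ C0 K_C0
  | m.+1 => tag (step m (Ss m)) end.
exists (fun n => sval (Ss n)), (fun n => tagged (step n (Ss n))); split.
- by move=> n; exact: svalP (Ss n).
- by move=> n; case: (stepP n (Ss n)).
move=> n A B e f.
have [[KA KB]|nK] := pselect (K A /\ K B); last first.
  by exists 0 => N h _ _ KA KB; case: nK.
have [j [a aI]] := EP A (K_fin KA); have [k [b bI]] := EP B (K_fin KB).
have [b' [b'E bK b'K]] := isomorphism_inv bI.
have [a' [a'E aK a'K]] := isomorphism_inv aI.
(* From stage [maxn j k] on the codes of [A] and [B] are both treated; the problem is transported to
   the listed copies along [a] and [b]. *)
exists (maxn j k) => N h; rewrite geq_max => /andP [jN kN] hE _ _ eE fE'.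
have [_ H] := stepP N (Ss N).
have [||||g gE gP] := H j k (b' \o e \o a) (h \o f \o a) jN kN.
- exact: K_sub (proj1 aI) KA.
- exact: K_sub (proj1 bI) KB.
- exact: embedding_comp (proj1 aI) (embedding_comp eE b'E).
- exact: embedding_comp (proj1 aI) fE'.
exists (g \o b'); first exact: embedding_comp.
by move=> x /=; have := gP (a' x); rewrite /= !a'K.
Qed.

Lemma fraisse_exists : exists M : structure L, fraisse_limit K M.
Proof.
have [S [iota [KS iE sol]]] := fraisse_chain.
pose M := limit iE; pose c n : S n -> M := @to_limit L S iota n.
have cE n : embedding (c n) := to_limit_embedding iE n.
have rep (I : Type) (u : I -> M) := limit_rep_fin iE u.
have EP (A B : structure L) (e : A -> B) (f : A -> M) :
    K A -> K B -> embedding e -> embedding f ->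
    exists2 g : B -> M, embedding g & forall x, g (e x) = f x.
  move=> KA KB eE fE; have [n /(_ n (leqnn n)) [f' f'P]] := rep _ f (K_fin KA).
  have f'E : embedding f' := embedding_factor fE (cE n) f'P.
  have [m mP] := sol n A B e f'.
  have [h hE hl] := limit_lift iE (leq_maxl n m).
  have [|g gE gP] := mP _ h (leq_maxr n m) hE KA KB eE.
    exact: embedding_comp.
  exists (c _ \o g); first exact: embedding_comp.
  by move=> x; rewrite /= gP /c to_limit_next hl; exact: f'P.
(* The images of finitely many generators appear at one stage; the elements of [A] landing in that
   stage are closed under the operations, so all of [A] embeds there. *)
have fgK (A : structure L) (f : A -> M) :
    finitely_generated A -> embedding f -> K A.
  move=> [X /finite_set_range [k [p Xp]] XP] fE.
  have [n /(_ n (leqnn n)) [u uP]] := rep _ (f \o p) (fin_finType 'I_k).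
  have [fI fc f1 f2 fr] := fE; have [cI cc c1 c2 cr] := cE n.
  have PT := XP [set a | exists s : S n, c n s = f a].
  have H a : exists s : S n, c n s = f a.
    have : [set: A] a by []; rewrite -PT //.
      split=> [d|o x [s sE]|o x y [s sE] [t tE]] /=.
      - by exists (icst (S n) d); rewrite cc fc.
      - by exists (iop1 o s); rewrite c1 f1 sE.
      - by exists (iop2 o s t); rewrite c2 f2 sE tE.
    by move=> x /Xp [i _ <-]; exists (u i); exact: uP.
  have [h hP] := choice H; apply: (K_sub _ (KS n)).
  exact: embedding_factor fE (cE n) hP.
have cM : countable [set: M] by apply: limit_countable => n; exact: K_fin.
exists M; split=> //; last first.
  apply/seteqP; split=> [A [fgA [f fE]]|A KA] /=; first exact: fgK fE.
  split; first exact/fin_finitely_generated/K_fin.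
  (* Joint embedding: the map from [C0] to [M] is extended along the embedding of [C0] into [A]. *)
  have [e eE] := C0_initial KA.
  have [e0 e0E] : embeds C0 M.
    have [h hE] := C0_initial (KS 0).
    by exists (c 0 \o h); exact: embedding_comp.
  by have [g gE _] := EP _ _ e e0 K_C0 KA eE e0E; exists g.
move=> A f g fgA fE gE.
pose graph (B : structure L) (p q : B -> M) := fun x y =>
  exists b, p b = x /\ q b = y.
pose GG := [set G | exists (B : structure L) (p q : B -> M),
  [/\ K B, embedding p, embedding q & G = graph B p q]].
(* The image of [p] and the point [x] lie in a common stage [S n]; this whole stage serves as [B'],
   and [q] extends to it by [EP]. Exchanging [p] and [q] gives the other direction. *)
have ext (B : structure L) (p q : B -> M) (x : M) :
    K B -> embedding p -> embedding q ->
    exists (B' : structure L) (p' q' : B' -> M),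
    [/\ K B', embedding p', embedding q',
       forall b, exists b', p' b' = p b /\ q' b' = q b &
       exists b', p' b' = x].
  move=> KB pE qE.
  have fB : fin (option B) by apply: fin_option; exact: K_fin.
  have [n /(_ n (leqnn n)) [u uP]] := rep _ (oapp p x) fB.
  have eE : embedding (u \o Some).
    by apply: embedding_factor pE (cE n) _ => b; exact: (uP (Some b)).
  have [q' q'E q'P] := EP _ _ _ q KB (KS n) eE qE.
  exists (S n), (c n), q'; split=> //; last by exists (u None); exact: (uP None).
  by move=> b; exists (u (Some b)); split; [exact: (uP (Some b))|exact: q'P].
have [|G x [B [p [q [KB pE qE ->]]]]|G y [B [p [q [KB pE qE ->]]]]||h hI hE] :=
    @back_and_forth L M M GG (graph A f g) cM cM.
- move=> _ [B [p [q [KB [pI pc p1 p2 pr] [qI qc q1 q2 qr] ->]]]]; split.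
  + by move=> d; exists (icst B d); rewrite pc qc.
  + by move=> o x y [b [<- <-]]; exists (iop1 o b); rewrite p1 q1.
  + by move=> o x y x' y' [b [<- <-]] [b' [<- <-]]; exists (iop2 o b b');
      rewrite p2 q2.
  + by move=> x y x' y' [b [<- <-]] [b' [<- <-]]; split=> [/pI ->|/qI ->].
  + by move=> r x y x' y' [b [<- <-]] [b' [<- <-]]; rewrite -pr -qr.
- have [B' [p' [q' [KB' p'E q'E sub [b' b'x]]]]] := ext B p q x KB pE qE.
  exists (graph B' p' q'); split; first by exists B', p', q'.
    by move=> a d [b [<- <-]]; exact: sub.
  by exists (q' b'), b'.
- have [B' [q' [p' [KB' q'E p'E sub [b' b'y]]]]] := ext B q p y KB qE pE.
  exists (graph B' p' q'); split; first by exists B', p', q'.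
    by move=> a d [b [<- <-]]; have [z [zq zp]] := sub b; exists z.
  by exists (p' b'), b'.
- by exists A, f, g; split=> //; exact: fgK fE.
- by exists h => //; apply: funext => a; apply: hE; exists a.
Qed.

End Fraisse.

(** * Ultrapowers *)

Section Ultrapower.
Variables (L : language) (M : structure L) (I : Type) (U : set_system I).
Hypothesis Uu : UltraFilter U.

Let Up : ProperFilter U := @ultra_proper _ _ Uu.
Let Uf : Filter U := @filter_filter _ _ Up.

Lemma ultra_not (P : set I) : U (~` P) <-> ~ U P.
Proof.
split=> [nP uP|nP]; last by case: (in_ultra_setVsetC P Uu).
have := @filterI _ _ Uf _ _ nP uP; rewrite setICl; exact: (@filter_not_empty _ _ Up).
Qed.

Lemma ultra_imp (P Q : set I) : U [set i | P i -> Q i] <-> (U P -> U Q).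
Proof.
split=> [H uP|H].
  by apply: (@filterS _ _ Uf) (@filterI _ _ Uf _ _ H uP) => i [pq p]; exact: pq.
have [/H uQ|/ultra_not nP] := pselect (U P).
  by apply: (@filterS _ _ Uf) uQ => i q _.
by apply: (@filterS _ _ Uf) nP => i np p.
Qed.

Definition ultra_eq (f g : I -> M) : Prop := U [set i | f i = g i].

Definition ultra_carrier := {X : (I -> M) -> Prop | exists f, X = ultra_eq f}.

Definition ultra_class f : ultra_carrier := exist _ (ultra_eq f) (ex_intro _ f erefl).

Lemma ultra_classP f g : ultra_class f = ultra_class g <-> ultra_eq f g.
Proof.
have refl h : ultra_eq h h by apply: (@filterS _ _ Uf) (@filterT _ _ Uf).
split=> [/(congr1 sval) /= ->|e]; first exact: refl.
apply: eq_exist; apply: funext => h; apply: propext; split=> e';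
  by apply: (@filterS _ _ Uf) (@filterI _ _ Uf _ _ e e') => i [/= -> ->].
Qed.

Definition ultra_rep (X : ultra_carrier) : I -> M := sval (cid (svalP X)).

Lemma ultra_repK X : ultra_class (ultra_rep X) = X.
Proof.
rewrite /ultra_rep; case: cid => f /= e.
by case: X e => X p /= e; apply: eq_exist.
Qed.

Definition ultrapower : structure L := @Structure L ultra_carrier
  (fun c => ultra_class (fun=> icst M c))
  (fun o X => ultra_class (fun i => iop1 o (ultra_rep X i)))
  (fun o X Y => ultra_class (fun i => iop2 o (ultra_rep X i) (ultra_rep Y i)))
  (fun r X Y => U [set i | irel2 r (ultra_rep X i) (ultra_rep Y i)]).

Let cls f : ultrapower := ultra_class f.

Lemma ultra_op1 o f : iop1 o (cls f) = cls (fun i => iop1 o (f i)).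
Proof.
apply/ultra_classP; have /ultra_classP := ultra_repK (cls f).
by apply: (@filterS _ _ Uf) => i /= ->.
Qed.

Lemma ultra_op2 o f g : iop2 o (cls f) (cls g) = cls (fun i => iop2 o (f i) (g i)).
Proof.
apply/ultra_classP; have /ultra_classP F := ultra_repK (cls f).
have /ultra_classP G := ultra_repK (cls g).
by apply: (@filterS _ _ Uf) (@filterI _ _ Uf _ _ F G) => i [/= -> ->].
Qed.

Lemma ultra_rel r f g : irel2 r (cls f) (cls g) <-> U [set i | irel2 r (f i) (g i)].
Proof.
have /ultra_classP F := ultra_repK (cls f).
have /ultra_classP G := ultra_repK (cls g).
split=> H; apply: (@filterS _ _ Uf)
    (@filterI _ _ Uf _ _ H (@filterI _ _ Uf _ _ F G)) => i [/= + [E E']].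
  by rewrite E E'.
by rewrite -E -E'.
Qed.

Lemma ultra_eval V (v : V -> I -> M) t :
  eval (fun x => cls (v x)) t = cls (fun i => eval (fun x => v x i) t).
Proof.
elim: t => [x|c|o t IH|o t IHt u IHu] //.
- exact: etrans (congr1 (iop1 o) IH) (ultra_op1 _ _).
- exact: etrans (congr2 (iop2 o) IHt IHu) (ultra_op2 _ _ _).
Qed.

Lemma los V (phi : formula L V) (v : V -> I -> M) :
  sat (fun x => cls (v x)) phi <-> U [set i | sat (fun x => v x i) phi].
Proof.
elim: phi v => {V} [V|V t u|V r t u|V p IHp q IHq|V p IHp] v /=.
- by split=> //; exact: (@filter_not_empty _ _ Up).
- by rewrite !ultra_eval; exact: ultra_classP.
- by rewrite !ultra_eval; exact: ultra_rel.
- by rewrite IHp IHq ultra_imp.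
have oE (g : I -> M) : oapp (fun x => cls (v x)) (cls g) =
    (fun x => cls (oapp v g x)) by apply: funext => -[].
have oE' (g : I -> M) i : (fun x => oapp v g x i) = oapp (fun x => v x i) (g i).
  by apply: funext => -[].
split=> [H|H X]; last first.
  rewrite -(ultra_repK X) oE IHp; apply: (@filterS _ _ Uf) H => i /= H.
  by rewrite oE'.
apply: contrapT => /ultra_not nH.
have ex i : exists a, ~ (forall b, sat (oapp (fun x => v x i) b) p) ->
    ~ sat (oapp (fun x => v x i) a) p.
  have [[a na]|na] := pselect (exists a, ~ sat (oapp (fun x => v x i) a) p).
    by exists a.
  (* Where no counterexample exists some default element of [M] is still required. It comes from an
     index at which the universal formula fails; the set of these belongs to [U], hence is
     nonempty. *)
  have [i0] : exists j, ~ (forall b, sat (oapp (fun x => v x j) b) p).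
    apply: contrapT => nj; apply: (@filter_not_empty _ _ Up).
    by apply: (@filterS _ _ Uf) nH => j /= nb; apply: nj; exists j.
  move=> /existsNP [b _]; exists b => n; case: n => c.
  by apply: contrapT => nc; apply: na; exists c.
have [g gP] := choice ex.
have := H (cls g); rewrite oE IHp => H'.
apply: (@filter_not_empty _ _ Up).
apply: (@filterS _ _ Uf) (@filterI _ _ Uf _ _ nH H') => i [/= /gP n].
by rewrite oE'.
Qed.

Lemma ultrapower_Th : models (Th M) ultrapower.
Proof.
move=> phi Mphi; rewrite /holds.
have -> : (fun x : void => match x return ultrapower with end) =
    (fun x => cls (of_void (I -> M) x)) by apply: funext => -[].
apply/los; apply: (@filterS _ _ Uf) (@filterT _ _ Uf) => i _ /=.
by move: Mphi; rewrite /Th /= /holds; congr sat; apply: funext => -[].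
Qed.

End Ultrapower.

Lemma fin_In (A : Type) (s : seq A) : fin {x | List.In x s}.
Proof.
elim: s => [|a s IH]; first by exists void, (@of_void _) => -[].
apply: (@fin_surj (unit + {x | List.In x s}) _ (fun u => match u with
  | inl _ => exist _ a (or_introl erefl)
  | inr x => exist _ (sval x) (or_intror (svalP x)) end)).
  move=> [x /= [e|xs]]; first by exists (inl tt); apply: eq_exist.
  by exists (inr (exist _ x xs)); apply: eq_exist.
by apply: fin_sum => //; exact: fin_finType.
Qed.

(** Compactness through an ultrapower indexed by finite lists of elements of [A]: each list [s] has
    a local embedding [F s], and [a] goes to the class of its values under all [F s]. *)
Lemma embeds_ultrapower (L : language) (A M : structure L) (m0 : M) :
  (forall V (v : V -> A), fin V -> embeds (gen v) M) ->
  exists2 B : structure L, models (Th M) B & embeds A B.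
Proof.
move=> H.
have loc (s : seq A) : exists F : A -> M,
   [/\ forall x y, List.In x s -> List.In y s -> F x = F y -> x = y,
       forall c, F (icst A c) = icst M c,
       forall o x, List.In x s -> F (iop1 o x) = iop1 o (F x),
       forall o x y, List.In x s -> List.In y s ->
         F (iop2 o x y) = iop2 o (F x) (F y) &
       forall r x y, List.In x s -> List.In y s ->
         (irel2 r x y <-> irel2 r (F x) (F y))].
  pose v : {x | List.In x s} -> A := sval.
  have [f [fI fc f1 f2 fr]] := H _ v (fin_In s).
  (* Off the substructure generated by [s] the value is the default [m0]; on it the value does not
     depend on the term. *)
  have ex a : exists m, forall t (e : eval v t = a), m = f (gen_elt v t).
    have [[t tE]|n] := pselect (exists t, eval v t = a).
      exists (f (gen_elt v t)) => u uE; congr f; apply: eq_exist.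
      by rewrite tE uE.
    by exists m0 => t tE; case: n; exists t.
  have [F FE] := choice ex.
  have Fs x (xs : List.In x s) : F x = f (gen_elt v (Var (exist _ x xs))).
    exact: FE.
  have gK x (xs : List.In x s) :
      eval v (gen_term (gen_elt v (Var (exist _ x xs)))) = x.
    by rewrite gen_termK.
  exists F; split.
  - by move=> x y xs ys; rewrite (Fs x xs) (Fs y ys) => /fI /(congr1 sval).
  - by move=> c; rewrite (FE _ (Cst c)) //; exact: fc.
  - move=> o x xs; rewrite (Fs x xs) -f1; apply: FE => /=; by rewrite gK.
  - move=> o x y xs ys; rewrite (Fs x xs) (Fs y ys) -f2; apply: FE => /=; by rewrite !gK.
  - by move=> r x y xs ys; rewrite (Fs x xs) (Fs y ys) -fr.
have [F FP] := choice loc.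
(* The filter generated by the sets of lists containing a given finite list: almost every [s]
   contains any prescribed elements. *)
pose base : set_system (seq A) := [set X | exists s0, forall s,
  (forall x, List.In x s0 -> List.In x s) -> X s].
have baseP : ProperFilter base.
  split; first by move=> [s0 /(_ s0)]; apply.
  split; first by exists [::].
    move=> X Y [s sX] [t tY]; exists (s ++ t)%list => u uP.
    by split; [apply: sX|apply: tY] => x xs; apply: uP;
      apply/List.in_or_app; [left|right].
  by move=> X Y XY [s sX]; exists s => u /sX /XY.
have [U [Uu bU]] := ultraFilterLemma baseP.
exists (@ultrapower L M _ U); first exact: ultrapower_Th.
pose c a : ultrapower M U := ultra_class U (fun s => F s a).
have near1 x (P : seq A -> Prop) : (forall s, List.In x s -> P s) -> U P.
  by move=> xP; apply: bU; exists [:: x] => s sP; apply: xP; apply: sP; left.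
have near2 x y (P : seq A -> Prop) :
    (forall s, List.In x s -> List.In y s -> P s) -> U P.
  move=> xP; apply: bU; exists [:: x; y] => s sP; apply: xP; apply: sP.
    by left.
  by right; left.
have Uf := @filter_filter _ _ (@ultra_proper _ _ Uu).
have neU P (Q : Prop) : U P -> (forall s, P s -> Q) -> Q.
  move=> uP PQ; apply: contrapT => n.
  apply: (@filter_not_empty _ _ (@ultra_proper _ _ Uu)).
  by apply: (@filterS _ _ Uf) uP => s /PQ.
exists c; split.
- move=> x y /(ultra_classP Uu) e.
  have xyP := near2 x y (fun s => List.In x s /\ List.In y s) (fun s a b => conj a b).
  apply: neU (@filterI _ _ Uf _ _ e xyP) _ => s [/= E [xs ys]].
  by case: (FP s) => + _ _ _ _; apply.
- move=> d; apply/(ultra_classP Uu); apply: bU; exists [::] => s _ /=.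
  by case: (FP s).
- move=> o x; rewrite /c ultra_op1; apply/(ultra_classP Uu); apply: (near1 x) => s xs.
  by case: (FP s) => _ _ + _ _; apply.
- move=> o x y; rewrite /c ultra_op2; apply/(ultra_classP Uu).
  by apply: (near2 x y) => s xs ys; case: (FP s) => _ _ _ + _; apply.
- move=> r x y; rewrite /c ultra_rel; split=> [rxy|uxy].
    by apply: (near2 x y) => s xs ys; case: (FP s) => _ _ _ _ /(_ r x y xs ys) [+ _]; apply.
  have xyP := near2 x y (fun s => List.In x s /\ List.In y s) (fun s a b => conj a b).
  apply: neU (@filterI _ _ Uf _ _ uxy xyP) _ => s [/= E [xs ys]].
  by case: (FP s) => _ _ _ _ /(_ r x y xs ys) [_]; apply.
Qed.

(** * Amalgamation of orders *)

Section Relations.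
Variable D : Type.
Implicit Types le ll : D -> D -> Prop.

Definition is_order le : Prop :=
  [/\ forall x, le x x,
      forall x y, le x y -> le y x -> x = y &
      forall x y z, le x y -> le y z -> le x z].

Definition is_coarser le ll : Prop :=
  is_order ll /\ forall x y, le x y -> ll x y.

Definition is_linearization le ll : Prop :=
  is_coarser le ll /\ forall x y, ll x y \/ ll y x.

Definition is_auxiliary le ll : Prop :=
  (forall x y, ll x y -> le x y) /\
  (forall x y z w, le w x -> ll x y -> le y z -> ll w z).

(** Szpilrajn's theorem: an order maximal among the coarser ones is total. *)
Lemma linear_extension le : is_order le -> exists ll, is_linearization le ll.
Proof.
move=> ole; pose X := {ll | is_coarser le ll}.
pose sub (s t : X) : bool := `[< forall x y, sval s x y -> sval t x y >].
have [||||[ll [oll lell]] max] := @Zorn X sub.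
- by move=> s; apply/asboolP.
- by move=> r s t /asboolP rs /asboolP st; apply/asboolP => x y /rs /st.
- move=> [s sP] [t tP] /asboolP /= st /asboolP /= ts; apply: eq_exist.
  by apply: funext => x; apply: funext => y; apply: propext; split=> [/st|/ts].
(* The disjunct [le x y] keeps the union an upper bound inside [X] even for the empty chain. *)
- move=> F Ftot; pose r x y := le x y \/ exists2 s : X, F s & sval s x y.
  have [refl anti trans] := ole.
  have join (s t : X) : F s -> F t -> exists2 u : X, F u &
      forall x y, sval s x y \/ sval t x y -> sval u x y.
    move=> Fs Ft; case: (Ftot s t Fs Ft) => /asboolP H.
      by exists t => // x y [/H|].
    by exists s => // x y [|/H].
  have up (s : X) x y : le x y -> sval s x y by case: s => s [? H] /=; exact: H.
  have so (s : X) : is_order (sval s) by case: (svalP s).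
  have rP : is_coarser le r.
    split; last by move=> x y; left.
    split.
    + by move=> x; left.
    + move=> x y [xy|[s Fs xy]] [yx|[t Ft yx]]; first exact: anti.
      * by have [_ + _] := so t; apply=> //; exact: up.
      * by have [_ + _] := so s; apply=> //; exact: up.
      * have [u Fu uP] := join _ _ Fs Ft.
        by have [_ + _] := so u; apply; apply: uP; [left|right].
    + move=> x y z [xy|[s Fs xy]] [yz|[t Ft yz]].
      * by left; exact: trans yz.
      * right; exists t => //; have [_ _ tt] := so t.
        by apply: tt yz; exact: up.
      * right; exists s => //; have [_ _ tt] := so s.
        by apply: tt xy _; exact: up.
      * have [u Fu uP] := join _ _ Fs Ft; right; exists u => //.
        have [_ _ tt] := so u.
        by apply: (tt _ y); apply: uP; [left|right].
  exists (exist _ r rP) => s Fs; apply/asboolP => x y /= xy.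
  by right; exists s.
exists ll; split=> // x y; apply: contrapT => /not_orP [nxy nyx].
have [refl anti trans] := oll.
(* Adds the pair of [x] and [y] with its consequences; any cycle through a new pair would yield
   [ll y x]. *)
pose r u v := ll u v \/ (ll u x /\ ll y v).
have rP : is_coarser le r.
  split; last by move=> u v /lell; left.
  split.
  - by move=> u; left.
  - move=> u v [uv|[ux yv]] [vu|[vx yu]].
    + exact: anti.
    + by case: nyx; apply: (trans) yu _; apply: (trans) uv vx.
    + by case: nyx; apply: (trans) yv _; apply: (trans) vu ux.
    + by case: nyx; apply: (trans) yu ux.
  - move=> u v w [uv|[ux yv]] [vw|[vx yw]].
    + by left; exact: trans vw.
    + by right; split=> //; exact: trans vx.
    + by right; split=> //; exact: trans vw.
    + by right.
have /max /(congr1 sval) /= rE : sub (exist _ ll (conj oll lell)) (exist _ r rP).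
  by apply/asboolP => u v /=; left.
by apply: nxy; rewrite -rE; right.
Qed.

End Relations.

Section SumRelation.
Variables (A B C : Type) (i1 : C -> A) (k1 : C -> B).
Variables (rA : A -> A -> Prop) (rB : B -> B -> Prop).

(** The two copies of an element of [C] are not identified but lie below each other, so this is a
    preorder and its quotient is left to the amalgam. *)
Definition sum_rel (x y : A + B) : Prop :=
  match x, y with
  | inl a, inl a' => rA a a'
  | inr b, inr b' => rB b b'
  | inl a, inr b => exists c, rA a (i1 c) /\ rB (k1 c) b
  | inr b, inl a => exists c, rB b (k1 c) /\ rA (i1 c) a
  end.

Hypothesis compat : forall c c', rA (i1 c) (i1 c') <-> rB (k1 c) (k1 c').

Lemma sum_rel_trans :
  (forall x y z, rA x y -> rA y z -> rA x z) ->
  (forall x y z, rB x y -> rB y z -> rB x z) ->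
  forall x y z, sum_rel x y -> sum_rel y z -> sum_rel x z.
Proof.
move=> tA tB [x|x] [y|y] [z|z] /=.
- exact: tA.
- by move=> xy [c [yc cz]]; exists c; split=> //; exact: tA yc.
- move=> [c [xc cy]] [d [yd dz]]; apply: (tA) xc _; apply: (tA) dz.
  by apply/compat; exact: tB yd.
- by move=> [c [xc cy]] yz; exists c; split=> //; exact: tB yz.
- by move=> [c [xc cy]] yz; exists c; split=> //; exact: tA yz.
- move=> [c [xc cy]] [d [yd dz]]; apply: (tB) xc _; apply: (tB) dz.
  by apply/compat; exact: tA yd.
- by move=> xy [c [yc cz]]; exists c; split=> //; exact: tB yc.
- exact: tB.
Qed.

(** With [a] below [c], [c] below [b], [b] below [d] and [d] below [a], [compat] carries each
    comparison of [c] and [d] to the other side, and antisymmetry in [A] and in [B] collapses the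
    cycle. *)
Lemma sum_rel_common : is_order rA -> is_order rB ->
  forall a b, sum_rel (inl a) (inr b) -> sum_rel (inr b) (inl a) ->
  exists c, a = i1 c /\ b = k1 c.
Proof.
move=> [refA aA tA] [refB aB tB] a b /= [c [ac cb]] [d [bd da]].
have cd : rB (k1 c) (k1 d) by exact: tB bd.
have dc : rA (i1 d) (i1 c) by exact: tA ac.
exists c; split; first by apply: aA => //; apply: (tA) da; apply/compat.
by apply: aB => //; apply: (tB) bd _; apply/compat.
Qed.

Lemma sum_rel_anti (D : Type) (i : A -> D) (k : B -> D) :
  is_order rA -> is_order rB -> (forall c, i (i1 c) = k (k1 c)) ->
  let j x := match x with inl a => i a | inr b => k b end in
  forall x y, sum_rel x y -> sum_rel y x -> j x = j y.
Proof.
move=> oA oB com j [x|x] [y|y].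
- by move=> xy yx; case: oA => _ aA _; rewrite /j (aA x y).
- move=> xy yx; have [c [-> ->]] := sum_rel_common oA oB xy yx.
  exact: com.
- move=> xy yx; have [c [-> ->]] := sum_rel_common oA oB yx xy.
  by rewrite /j com.
- by move=> xy yx; case: oB => _ aB _; rewrite /j (aB x y).
Qed.

End SumRelation.

Section OrderAmalgam.
Variables (A B C D : Type) (i1 : C -> A) (k1 : C -> B) (i : A -> D) (k : B -> D).
Variables (leA : A -> A -> Prop) (leB : B -> B -> Prop) (leD : D -> D -> Prop).
Variables (llA : A -> A -> Prop) (llB : B -> B -> Prop).

Definition sum_map (x : A + B) : D := match x with inl a => i a | inr b => k b end.

Hypothesis oD : is_order leD.
Hypothesis com : forall c, i (i1 c) = k (k1 c).
Hypothesis leE : forall x y, leD (sum_map x) (sum_map y) <-> sum_rel i1 k1 leA leB x y.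
Hypothesis ll_compat : forall c c', llA (i1 c) (i1 c') <-> llB (k1 c) (k1 c').

Definition ll_extends (llD : D -> D -> Prop) : Prop :=
  (forall a a', llA a a' <-> llD (i a) (i a')) /\
  (forall b b', llB b b' <-> llD (k b) (k b')).

(** One step of [q] between two steps of [leD] is already transitive: [leD] between images is
    contained in [q] ([leq]), so longer alternations shrink. Likewise a cycle becomes a cycle of
    [q], which [sum_rel_anti] collapses in [D]. *)
Lemma coarser_amalgam :
  is_coarser leA llA -> is_coarser leB llB ->
  exists2 llD, is_coarser leD llD & ll_extends llD.
Proof.
move=> [olA lA] [olB lB]; have [refl anti trans] := oD.
pose q := sum_rel i1 k1 llA llB.
have [rA _ tA] := olA; have [rB _ tB] := olB.
have qt : forall x y z, q x y -> q y z -> q x z := sum_rel_trans ll_compat tA tB.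
have leq u v : leD (sum_map u) (sum_map v) -> q u v.
  rewrite leE; case: u v => [u|u] [v|v] /=; [exact: lA| | |exact: lB];
    by move=> [c [x y]]; exists c; split; [exact: lA || exact: lB|exact: lA || exact: lB].
pose llD x y := leD x y \/
  exists u v, [/\ leD x (sum_map u), q u v & leD (sum_map v) y].
have qa u v : q u v -> q v u -> sum_map u = sum_map v.
  exact: (sum_rel_anti ll_compat olA olB com).
have llE u v : q u v <-> llD (sum_map u) (sum_map v).
  split=> [uv|[/leq //|[u' [v' [/leq a b /leq c]]]]].
    by right; exists u, v; split.
  by apply: (qt) a _; apply: (qt) b _.
exists llD; last first.
  by split=> x y; [exact: (llE (inl x) (inl y))|exact: (llE (inr x) (inr y))].
split; last by left.
split.
- by left.
- move=> x y [xy|[u [v [xu uv vy]]]] [yx|[u' [v' [yu' uv' vx']]]].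
  + exact: anti.
  + have /leq vu : leD (sum_map v') (sum_map u') by apply: (trans) vx' _; exact: trans yu'.
    have e := qa _ _ uv' vu; apply: anti => //; apply: (trans) yu' _.
    by rewrite e.
  + have /leq vu : leD (sum_map v) (sum_map u) by apply: (trans) vy _; exact: trans xu.
    have e := qa _ _ uv vu; apply: anti => //; apply: (trans) xu _.
    by rewrite e.
  + have /leq a : leD (sum_map v) (sum_map u') := trans _ _ _ vy yu'.
    have /leq b : leD (sum_map v') (sum_map u) := trans _ _ _ vx' xu.
    have e : sum_map u = sum_map v by apply: qa => //; apply: (qt) a _; apply: (qt) uv' _.
    have e' : sum_map u' = sum_map v' by apply: qa => //; apply: (qt) b _; apply: (qt) uv _.
    by apply: anti; [apply: (trans) xu _; rewrite e|apply: (trans) yu' _; rewrite e'].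
- move=> x y z [xy|[u [v [xu uv vy]]]] [yz|[u' [v' [yu' uv' vz']]]].
  + by left; exact: trans yz.
  + by right; exists u', v'; split=> //; exact: trans yu'.
  + by right; exists u, v; split=> //; exact: trans yz.
  + right; exists u, v'; split=> //; apply: (qt) uv _; apply: (qt) uv'.
    by apply: leq; exact: trans yu'.
Qed.

(** Linearizing the coarser amalgam adds nothing inside [A] or [B]: these are already linear, and a
    new pair against an old one would break antisymmetry. *)
Lemma linearization_amalgam : injective i -> injective k ->
  is_linearization leA llA -> is_linearization leB llB ->
  exists2 llD, is_linearization leD llD & ll_extends llD.
Proof.
move=> iI kI [cA totA] [cB totB].
have [r [orr ler] [rA rB]] := coarser_amalgam cA cB.
have [ll [[oll rll] totll]] := linear_extension orr.
have [_ anti _] := oll.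
exists ll; first by split=> //; split=> // x y /ler /rll.
have [[[reA _ _] _] [[reB _ _] _]] := (cA, cB).
split=> x y; split.
- by move=> /rA /rll.
- case: (totA x y) => // yx xy; have /rA /rll yx' := yx.
  by rewrite (iI _ _ (anti _ _ xy yx')).
- by move=> /rB /rll.
- case: (totB x y) => // yx xy; have /rB /rll yx' := yx.
  by rewrite (kI _ _ (anti _ _ xy yx')).
Qed.

(** The core [s] relates only elements of one side; mixed pairs arise by composing with [leD], which
    is what the auxiliary axiom demands. *)
Lemma auxiliary_amalgam :
  is_auxiliary leA llA -> is_auxiliary leB llB ->
  exists llD, [/\ is_auxiliary leD llD, ll_extends llD &
    (forall a, ~ llA a a) -> (forall b, ~ llB b b) -> forall d, ~ llD d d].
Proof.
move=> [fA aA] [fB aB]; have [refl anti trans] := oD.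
pose s (x y : A + B) := match x, y with
  | inl a, inl a' => llA a a' | inr b, inr b' => llB b b' | _, _ => False end.
pose llD x y := exists u v, [/\ leD x (sum_map u), s u v & leD (sum_map v) y].
have sle u v : s u v -> leD (sum_map u) (sum_map v).
  by rewrite leE; case: u v => [u|u] [v|v] //=; [exact: fA|exact: fB].
have lE u v : s u v -> llD (sum_map u) (sum_map v) by move=> uv; exists u, v.
have EA a a' : llD (i a) (i a') -> llA a a'.
  move=> [u [v []]]; rewrite -[i a]/(sum_map (inl a)) -[i a']/(sum_map (inl a')) !leE.
  case: u v => [u|u] [v|v] //=; first by move=> x y z; exact: aA y z.
  (* A detour of [A] through [B] enters at [c] and leaves at [d]; in [B] it gives [k1 c] << [k1 d],
     which [ll_compat] brings back to [A]. *)
  move=> [c [ac cu]] uv [d [vd da]]; apply: aA ac _ da; apply/ll_compat.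
  exact: aB uv vd.
have EB b b' : llD (k b) (k b') -> llB b b'.
  move=> [u [v []]]; rewrite -[k b]/(sum_map (inr b)) -[k b']/(sum_map (inr b')) !leE.
  case: u v => [u|u] [v|v] //=; last by move=> x y z; exact: aB y z.
  move=> [c [ac cu]] uv [d [vd da]]; apply: aB ac _ da; apply/ll_compat.
  exact: aA uv vd.
exists llD; split.
- split=> [x y [u [v [xu /sle uv vy]]]|x y z w wx [u [v [xu uv vy]]] yz].
    by apply: (trans) xu _; exact: trans uv vy.
  by exists u, v; split=> //; [exact: trans xu|exact: trans yz].
- split=> x y; split; [exact: (lE (inl x) (inl y))|exact: EA| |exact: EB].
  exact: (lE (inr x) (inr y)).
(* If [d] << [d] passes through [u] << [v], then [v] is below [d] and [d] below [u], whence [u] <<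
   [u] inside [A] or [B]. *)
- move=> nA nB d [u [v [du uv vd]]].
  have : llD (sum_map u) (sum_map u) by exists u, v; split=> //; exact: trans du.
  by case: u {du uv} => [a /EA /nA|b /EB /nB].
Qed.

End OrderAmalgam.

(** * Lattices as orders *)

Definition dual D (le : D -> D -> Prop) x y := le y x.

Definition is_join D (le : D -> D -> Prop) (j : D -> D -> D) : Prop :=
  [/\ forall x y, le x (j x y), forall x y, le y (j x y) &
      forall x y z, le x z -> le y z -> le (j x y) z].

Definition is_meet D (le : D -> D -> Prop) := is_join (dual le).

Definition semilattice_eqs D (j : D -> D -> D) : Prop :=
  [/\ forall x y z, j x (j y z) = j (j x y) z,
      forall x y, j x y = j y x & forall x, j x x = x].

Lemma order_dual D (le : D -> D -> Prop) : is_order le -> is_order (dual le).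
Proof.
move=> [r a t]; split=> // [x y xy yx|x y z xy yz]; first exact: a.
exact: t xy.
Qed.

Lemma join_eqs D (le : D -> D -> Prop) j :
  is_order le -> is_join le j ->
  semilattice_eqs j /\ forall x y, le x y <-> j x y = y.
Proof.
move=> [r a t] [jl jr jm]; have ? := (jl, jr, jm, r).
split; last by move=> x y; split=> [xy|<- //]; apply: a => //; exact: jm.
split=> [x y z|x y|x]; apply: a => //.
- apply: (jm); first exact: t (jl _ _) _.
  by apply: (jm) => //; apply: t (jl _ _).
- apply: (jm); last exact: t (jr _ _) _.
  by apply: (jm) => //; apply: t (jr _ _).
- exact: jm.
- exact: jm.
- exact: jm.
Qed.

Lemma eqs_join D (j : D -> D -> D) :
  semilattice_eqs j ->
  is_order (fun x y => j x y = y) /\ is_join (fun x y => j x y = y) j.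
Proof.
move=> [jA jC jI]; split; split=> //.
- by move=> x y xy yx; rewrite -xy jC yx.
- by move=> x y z xy yz; rewrite -yz jA xy.
- by move=> x y; rewrite jA jI.
- by move=> x y; rewrite jC -jA jI.
- by move=> x y z xz yz; rewrite -jA yz.
Qed.

(** * MacNeille completions *)

Section MacNeille.
Variables (P : Type) (q : P -> P -> Prop).
Hypothesis q_refl : forall x, q x x.
Hypothesis q_trans : forall x y z, q x y -> q y z -> q x z.

(** Lower bounds of the upper bounds. [q] is only a preorder; comparing closed sets by inclusion
    makes the completion antisymmetric. *)
Definition cut_closure (X : P -> Prop) (y : P) : Prop :=
  forall z, (forall x, X x -> q x z) -> q y z.

Lemma sub_cut_closure X x : X x -> cut_closure X x.
Proof. by move=> Xx z; exact. Qed.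

Lemma cut_closure_min (X Y : P -> Prop) : cut_closure Y = Y ->
  (forall x, X x -> Y x) -> forall x, cut_closure X x -> Y x.
Proof.
by move=> <- XY x Xx z Yz; apply: Xx => y /XY Yy; exact: Yy.
Qed.

Lemma cut_eq (X : P -> Prop) :
  (forall x, cut_closure X x -> X x) -> cut_closure X = X.
Proof.
move=> H; apply: funext => x; apply: propext.
by split; [exact: H|exact: sub_cut_closure].
Qed.

Definition cut := {X : P -> Prop | cut_closure X = X}.

Definition cut_le (X Y : cut) : Prop := forall x, sval X x -> sval Y x.

Lemma cut_order : is_order cut_le.
Proof.
split=> [x //|X Y XY YX|X Y Z XY YZ x /XY /YZ //].
case: X Y XY YX => X ? [Y ?] XY YX; apply: eq_exist; apply: funext => x.
by apply: propext; split; [exact: XY|exact: YX].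
Qed.

Lemma cut_joinP (X Y : cut) :
  cut_closure (cut_closure (fun x => sval X x \/ sval Y x)) =
  cut_closure (fun x => sval X x \/ sval Y x).
Proof.
apply: cut_eq => x Hx z Hz; apply: Hx => y; exact.
Qed.

Definition cut_join X Y : cut := exist _ _ (cut_joinP X Y).

Lemma cut_meetP (X Y : cut) :
  cut_closure (fun x => sval X x /\ sval Y x) = (fun x => sval X x /\ sval Y x).
Proof.
apply: cut_eq => x Hx; split.
  by apply: (cut_closure_min (svalP X)) Hx => y [].
by apply: (cut_closure_min (svalP Y)) Hx => y [].
Qed.

Definition cut_meet X Y : cut := exist _ _ (cut_meetP X Y).

Lemma cut_is_join : is_join cut_le cut_join.
Proof.
split=> [X Y x Xx|X Y x Yx|X Y Z XZ YZ].
- by apply: sub_cut_closure; left.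
- by apply: sub_cut_closure; right.
- by apply: cut_closure_min => [|x [/XZ|/YZ]//]; exact: svalP Z.
Qed.

Lemma cut_is_meet : is_meet cut_le cut_meet.
Proof.
by split=> [X Y x []|X Y x []|X Y Z XZ YZ x Zx] //; split; [exact: XZ|exact: YZ].
Qed.

Lemma downP (p : P) : cut_closure (fun x => q x p) = fun x => q x p.
Proof. by apply: cut_eq => x; exact. Qed.

Definition down p : cut := exist _ _ (downP p).

Lemma down_le x y : cut_le (down x) (down y) <-> q x y.
Proof.
split=> [|xy z zx]; first exact.
exact: q_trans xy.
Qed.

(** Every upper bound of [x] and [y] lies above [z], so [z] is in the closure of their union: joins
    that exist survive in the completion. *)
Lemma down_join x y z : q x z -> q y z -> (forall w, q x w -> q y w -> q z w) ->
  down z = cut_join (down x) (down y).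
Proof.
move=> xz yz lub; have [_ anti _] := cut_order; apply: anti.
  move=> t tz w H; apply: q_trans tz _; apply: lub; apply: H; [left|right]; exact: q_refl.
have [_ _] := cut_is_join; apply; exact/down_le.
Qed.

Lemma down_meet x y z : q z x -> q z y -> (forall w, q w x -> q w y -> q w z) ->
  down z = cut_meet (down x) (down y).
Proof.
move=> zx zy glb; have [_ anti _] := cut_order; apply: anti.
  by have [_ _] := cut_is_meet; apply; exact/down_le.
by move=> t [tx ty]; exact: glb.
Qed.

Lemma fin_cut : fin P -> fin cut.
Proof.
move=> fP; apply: (@fin_inj _ (P -> Prop) sval) (fin_set fP).
by move=> [X ?] [Y ?] /= e; apply: eq_exist.
Qed.

End MacNeille.

(** If [c] and [d] interpolate between [x] and [w] and between [y] and [w], then their join in [C],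
    preserved by both embeddings, interpolates between the join of [x] and [y] and [w]. *)
Lemma sum_rel_join (A B C : Type) (i1 : C -> A) (k1 : C -> B)
    (leA : A -> A -> Prop) (leB : B -> B -> Prop) jA jB jC :
  is_order leA -> is_order leB -> is_join leA jA -> is_join leB jB ->
  (forall c d, i1 (jC c d) = jA (i1 c) (i1 d)) ->
  (forall c d, k1 (jC c d) = jB (k1 c) (k1 d)) ->
  (forall x y w, sum_rel i1 k1 leA leB (inl x) w ->
     sum_rel i1 k1 leA leB (inl y) w -> sum_rel i1 k1 leA leB (inl (jA x y)) w) /\
  (forall x y w, sum_rel i1 k1 leA leB (inr x) w ->
     sum_rel i1 k1 leA leB (inr y) w -> sum_rel i1 k1 leA leB (inr (jB x y)) w).
Proof.
move=> [rA _ tA] [rB _ tB] [lA rrA mA] [lB rrB mB] iE kE.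
split=> x y [w|w] /=; [exact: mA| | |exact: mB];
  move=> [c [xc cw]] [d [yd dw]]; exists (jC c d); rewrite iE kE; split;
  do ?[by apply: mA|by apply: mB].
- by apply: mA; [apply: tA xc _|apply: tA yd _].
- by apply: mB; [apply: tB xc _|apply: tB yd _].
Qed.

Lemma sum_rel_dual (A B C : Type) (i1 : C -> A) (k1 : C -> B)
    (leA : A -> A -> Prop) (leB : B -> B -> Prop) x y :
  sum_rel i1 k1 (dual leA) (dual leB) x y <-> sum_rel i1 k1 leA leB y x.
Proof. by case: x y => [x|x] [y|y] //=; split=> -[c []]; exists c. Qed.

(** * Heyting algebras and prime filters *)

Definition is_heyting D (le : D -> D -> Prop) j m imp z o : Prop :=
  [/\ is_order le, is_join le j, is_meet le m, forall x : D, le z x /\ le x o &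
      forall x y w : D, le (m x y) w <-> le x (imp y w)].

Section PrimeFilters.
Variables (D : Type) (le : D -> D -> Prop) (j m imp : D -> D -> D) (z o : D).
Hypothesis H : is_heyting le j m imp z o.

Definition is_filter (F : D -> Prop) : Prop :=
  [/\ F o, forall x y, le x y -> F x -> F y & forall x y, F x -> F y -> F (m x y)].

Definition is_ideal (I : D -> Prop) : Prop :=
  [/\ I z, forall x y, le x y -> I y -> I x & forall x y, I x -> I y -> I (j x y)].

Definition is_prime (F : D -> Prop) : Prop :=
  [/\ is_filter F, ~ F z & forall x y, F (j x y) -> F x \/ F y].

Lemma heyting_refl x : le x x. Proof. by case: H => -[]. Qed.

Lemma heyting_trans y x w : le x y -> le y w -> le x w.
Proof. by case: H => -[_ _ t] _ _ _ _; exact: t. Qed.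

Lemma meet_le1 x y : le (m x y) x. Proof. by case: H => _ _ [+ _ _] _ _; apply. Qed.
Lemma meet_le2 x y : le (m x y) y. Proof. by case: H => _ _ [_ + _] _ _; apply. Qed.
Lemma le_meet x y w : le w x -> le w y -> le w (m x y).
Proof. by case: H => _ _ [_ _ +] _ _ => h a b; apply: h. Qed.
Lemma le_join1 x y : le x (j x y). Proof. by case: H => _ [+ _ _] _ _ _; apply. Qed.
Lemma le_join2 x y : le y (j x y). Proof. by case: H => _ [_ + _] _ _ _; apply. Qed.
Lemma join_le x y w : le x w -> le y w -> le (j x y) w.
Proof. by case: H => _ [_ _ +] _ _ _; apply. Qed.
Lemma meet_mono x y x' y' : le x x' -> le y y' -> le (m x y) (m x' y').
Proof.
move=> a b; apply: le_meet; [apply: heyting_trans a|apply: heyting_trans b];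
  [exact: meet_le1|exact: meet_le2].
Qed.
Lemma meet_swap x y : le (m x y) (m y x).
Proof. by apply: le_meet; [exact: meet_le2|exact: meet_le1]. Qed.
Lemma residuation x y w : le (m x y) w <-> le x (imp y w). Proof. by case: H. Qed.

Lemma meet_join_le x y w : le (m x (j y w)) (j (m x y) (m x w)).
Proof.
apply: heyting_trans (meet_swap _ _) _; apply/residuation; apply: join_le;
  apply/residuation; apply: heyting_trans (meet_swap _ _) _;
  [exact: le_join1|exact: le_join2].
Qed.

(** A filter maximal among those containing [F] and disjoint from [I] is prime by distributivity.
    All prime filters below come from this lemma with suitable [F] and [I]. *)
Lemma prime_separation F I : is_filter F -> is_ideal I ->
  (forall x, F x -> ~ I x) ->
  exists P, [/\ is_prime P, forall x, F x -> P x & forall x, P x -> ~ I x].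
Proof.
move=> fF [I0 Id Ij] FI.
pose X := {P | [/\ is_filter P, forall x, F x -> P x & forall x, P x -> ~ I x]}.
pose sub (s t : X) : bool := `[< forall x, sval s x -> sval t x >].
have [||||[P [fP FP PI]] max] := @Zorn X sub.
- by move=> s; apply/asboolP.
- by move=> r s t /asboolP rs /asboolP st; apply/asboolP => x /rs /st.
- move=> [s sP] [t tP] /asboolP /= st /asboolP /= ts; apply: eq_exist.
  by apply: funext => x; apply: propext; split=> [/st|/ts].
- move=> G Gtot; pose r x := F x \/ exists2 s : X, G s & sval s x.
  have [F1 Fu Fm] := fF.
  have rP : [/\ is_filter r, forall x, F x -> r x & forall x, r x -> ~ I x].
    split; last 2 first.
    + by move=> x; left.
    + by move=> x [/FI //|[s _]]; case: (svalP s) => _ _; exact.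
    split; first by left.
      move=> x y xy [Fx|[s Gs sx]]; first by left; exact: Fu Fx.
      right; exists s => //; have [[_ u _] _ _] := svalP s; exact: u sx.
    move=> x y [Fx|[s Gs sx]] [Fy|[t Gt ty]].
    + by left; exact: Fm.
    + right; exists t => //; have [[_ _ u] v _] := svalP t; apply: u => //; exact: v.
    + right; exists s => //; have [[_ _ u] v _] := svalP s; apply: u => //; exact: v.
    + case: (Gtot s t Gs Gt) => /asboolP st; right; [exists t|exists s] => //.
        by have [[_ _ u] v _] := svalP t; apply: u => //; exact: st.
      by have [[_ _ u] v _] := svalP s; apply: u => //; exact: st.
  exists (exist _ r rP) => s Gs; apply/asboolP => x /= sx.
  by right; exists s.
have [P1 Pu Pm] := fP.
(* By maximality the filter generated by [P] and [x] must meet the ideal. *)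
have meets x : ~ P x -> exists p, P p /\ I (m p x).
  move=> nPx; apply: contrapT => n.
  pose r y := exists2 p, P p & le (m p x) y.
  have rP : [/\ is_filter r, forall y, F y -> r y & forall y, r y -> ~ I y].
    split; last 2 first.
    + by move=> y /FP Py; exists y => //; exact: meet_le1.
    + by move=> y [p Pp py] Iy; apply: n; exists p; split=> //; exact: Id Iy.
    split; first by exists o => //; exact: meet_le1.
      by move=> y w yw [p Pp py]; exists p => //; exact: heyting_trans yw.
    move=> y w [p Pp py] [p' Pp' pw]; exists (m p p'); first exact: Pm.
    apply: le_meet; [apply: heyting_trans py|apply: heyting_trans pw];
      apply: meet_mono; rewrite ?meet_le1 ?meet_le2 //; try exact: heyting_refl.
    + exact: meet_le1.
    + exact: meet_le2.
  have /max /(congr1 sval) /= rE : sub (exist _ P (And3 fP FP PI)) (exist _ r rP).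
    by apply/asboolP => y /= Py; exists y => //; exact: meet_le1.
  by apply: nPx; rewrite -rE; exists o => //; exact: meet_le2.
exists P; split=> //; split=> // [Pz|x y Pxy]; first exact: PI Pz I0.
apply: contrapT => /not_orP [/meets [p [Pp Ip]] /meets [p' [Pp' Ip']]].
(* Distributivity bounds this element of [P] by a join of two elements of [I], a contradiction. *)
have Pq : P (m (m p p') (j x y)) by apply: (Pm) => //; exact: Pm.
apply: (PI) Pq _; apply: (Id) (meet_join_le _ _ _) _; apply: Ij.
  by apply: Id Ip; apply: meet_mono; [exact: meet_le1|exact: heyting_refl].
by apply: Id Ip'; apply: meet_mono; [exact: meet_le2|exact: heyting_refl].
Qed.

Lemma prime_le (P : D -> Prop) x y : is_prime P -> le x y -> P x -> P y.
Proof. by move=> [[_ u _] _ _]; exact: u. Qed.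

Lemma prime_meet (P : D -> Prop) x y : is_prime P -> P (m x y) <-> P x /\ P y.
Proof.
move=> pP; split=> [xy|[px py]]; last by case: pP => -[_ _ +] _ _; apply.
by split; apply: prime_le xy => //; [exact: meet_le1|exact: meet_le2].
Qed.

Lemma prime_join (P : D -> Prop) x y : is_prime P -> P (j x y) <-> P x \/ P y.
Proof.
move=> pP; split; first by case: pP => _ _; exact.
by move=> [] xy; apply: prime_le xy => //; [exact: le_join1|exact: le_join2].
Qed.

Lemma prime_imp (P : D -> Prop) x y : is_prime P -> P (imp x y) -> P x -> P y.
Proof.
move=> pP pi px; have : P (m (imp x y) x) by apply/prime_meet.
by apply: prime_le => //; apply/residuation; exact: heyting_refl.
Qed.

Lemma prime_exists x y : ~ le x y -> exists P, [/\ is_prime P, P x & ~ P y].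
Proof.
move=> n; have [|||P [pP FP PI]] := @prime_separation (le x) (le^~ y).
- split.
  + by case: H => _ _ _ b _; case: (b x).
  + by move=> u v uv xu; exact: heyting_trans uv.
  + by move=> u v; exact: le_meet.
- split.
  + by case: H => _ _ _ b _; case: (b y).
  + by move=> u v uv xu; exact: heyting_trans xu.
  + by move=> u v; exact: join_le.
- by move=> w xw wy; apply: n; exact: heyting_trans wy.
exists P; split=> //; first by apply: FP; exact: heyting_refl.
by move=> /PI; apply; exact: heyting_refl.
Qed.

End PrimeFilters.

Record heyting := Heyting {
  hsort :> Type;
  hle : hsort -> hsort -> Prop;
  hjoin : hsort -> hsort -> hsort;
  hmeet : hsort -> hsort -> hsort;
  himp : hsort -> hsort -> hsort;
  hbot : hsort;
  htop : hsort;
  heytingP : is_heyting hle hjoin hmeet himp hbot htop }.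

Definition hprime (A : heyting) (P : A -> Prop) : Prop :=
  is_prime (@hle A) (@hjoin A) (@hmeet A) (hbot A) (htop A) P.

Definition hembedding (A B : heyting) (f : A -> B) : Prop :=
  [/\ forall x y, hle x y <-> hle (f x) (f y),
      forall x y, f (hjoin x y) = hjoin (f x) (f y),
      forall x y, f (hmeet x y) = hmeet (f x) (f y),
      forall x y, f (himp x y) = himp (f x) (f y) &
      f (hbot A) = hbot B /\ f (htop A) = htop B].

(** * Lifting prime filters along embeddings *)

Section PrimeExtension.
Variables (C B : heyting) (k : C -> B).
Hypothesis kE : hembedding k.

Let le_trans := heyting_trans (heytingP B).

Lemma prime_trace (Q : B -> Prop) : hprime Q -> hprime (Q \o k).
Proof.
have [le_ j_ m_ _ [z_ o_]] := kE.
move=> [[Q1 Qu Qm] Q0 Qj]; split=> /=.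
- split=> [|x y xy|x y] /=; first by rewrite o_.
    by apply: Qu; apply/le_.
  by rewrite m_; exact: Qm.
- by rewrite z_.
- by move=> x y; rewrite j_; exact: Qj.
Qed.

(** Separates the filter generated by [G] and the image of [P] from the ideal generated by the image
    of the complement of [P]. The latter is an ideal since [P] is prime, and the last hypothesis
    says that the two are disjoint. *)
Lemma prime_extend (G : B -> Prop) (P : C -> Prop) :
  is_filter (@hle B) (@hmeet B) (htop B) G -> hprime P ->
  (forall q c d, G q -> P c -> hle (hmeet q (k c)) (k d) -> P d) ->
  exists Q, [/\ hprime Q, forall x, G x -> Q x & forall c, Q (k c) <-> P c].
Proof.
have [le_ j_ m_ _ [z_ o_]] := kE; have HB := heytingP B.
move=> [G1 Gu Gm] pP GP; have [[P1 Pu Pm] P0 Pj] := pP.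
have [|||Q [pQ FQ QI]] := @prime_separation B _ _ _ _ _ _ HB
  (fun x => exists q c, [/\ G q, P c & hle (hmeet q (k c)) x])
  (fun x => exists2 d, ~ P d & hle x (k d)).
- split.
  + by exists (htop B), (htop C); split=> //; exact: meet_le1 HB _ _.
  + move=> x y xy [q [c [Gq Pc qx]]]; exists q, c; split=> //.
    exact: le_trans xy.
  + move=> x y [q [c [Gq Pc qx]]] [q' [c' [Gq' Pc' qx']]].
    exists (hmeet q q'), (hmeet c c'); split; [exact: Gm|exact: Pm|].
    rewrite m_; apply: (le_meet HB).
      apply: le_trans qx; apply: (meet_mono HB); exact: meet_le1 HB _ _.
    apply: le_trans qx'; apply: (meet_mono HB); exact: meet_le2 HB _ _.
- split.
  + by exists (hbot C) => //; rewrite z_; exact: heyting_refl HB _.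
  + by move=> x y xy [d nd yd]; exists d => //; exact: le_trans yd.
  + move=> x y [d nd xd] [e ne ye]; exists (hjoin d e); first by move=> /Pj [].
    rewrite j_; apply: (join_le HB).
      by apply: le_trans xd _; exact: le_join1 HB _ _.
    by apply: le_trans ye _; exact: le_join2 HB _ _.
- move=> x [q [c [Gq Pc qx]]] [d nd xd]; apply: nd; apply: GP Gq Pc _.
  exact: le_trans xd.
exists Q; split=> // [x Gx|c].
  by apply: FQ; exists x, (htop C); split=> //; exact: meet_le1 HB _ _.
split=> [Qc|Pc]; last first.
  by apply: FQ; exists (htop B), c; split=> //; exact: meet_le2 HB _ _.
by apply: contrapT => nc; apply: QI Qc _; exists c => //; exact: heyting_refl HB _.
Qed.

Lemma prime_lift (P : C -> Prop) : hprime P ->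
  exists2 Q, hprime Q & forall c, Q (k c) <-> P c.
Proof.
have [le_ j_ m_ _ [z_ o_]] := kE; have HB := heytingP B.
move=> pP; have [|q c d|Q [pQ _ QP]] := @prime_extend (hle (htop B)) P _ pP.
- split; first exact: heyting_refl HB _.
    by move=> x y xy ox; exact: le_trans xy.
  by move=> x y; exact: (le_meet HB).
- move=> oq Pc cd; apply: (prime_le pP) Pc; apply/le_; apply: le_trans cd.
  apply: (le_meet HB); last exact: heyting_refl HB _.
  by apply: le_trans oq; case: HB => _ _ _ b _; case: (b (k c)).
- by exists Q.
Qed.

(** If [q] meets [k c] below [k d], residuation puts [k (himp c d)] into [Q], so [himp c d] is in
    [P] and modus ponens gives [d]. Preservation of implication is what makes restriction a
    p-morphism of spectra. *)
Lemma prime_lift_above (Q : B -> Prop) (P : C -> Prop) : hprime Q -> hprime P ->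
  (forall c, Q (k c) -> P c) ->
  exists Q', [/\ hprime Q', forall x, Q x -> Q' x & forall c, Q' (k c) <-> P c].
Proof.
have [le_ j_ m_ i_ [z_ o_]] := kE; have HB := heytingP B.
move=> pQ pP QP; apply: prime_extend => //; first by case: pQ.
move=> q c d Qq Pc qcd; apply: (prime_imp (heytingP C) pP) Pc.
apply: QP; rewrite i_; apply: (prime_le pQ) Qq; exact/(residuation HB).
Qed.

End PrimeExtension.

(** Kripke semantics of implication: the filter generated by [P] and [a] avoids the ideal below
    [a'], since otherwise residuation would put [himp a a'] into [P]. *)
Lemma prime_imp_extend (A : heyting) (P : A -> Prop) (a a' : A) :
  hprime P -> ~ P (himp a a') ->
  exists P', [/\ hprime P', forall x, P x -> P' x, P' a & ~ P' a'].
Proof.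
have HA := heytingP A.
move=> pP nP; have [[P1 Pu Pm] P0 Pj] := pP.
have [|||P' [pP' FP PI]] := @prime_separation A _ _ _ _ _ _ HA
  (fun x => exists2 p, P p & hle (hmeet p a) x) (fun x => hle x a').
- split.
  + by exists (htop A) => //; exact: meet_le1 HA _ _.
  + by move=> x y xy [p Pp px]; exists p => //; exact: (heyting_trans HA px xy).
  + move=> x y [p Pp px] [q Pq qy]; exists (hmeet p q); first exact: Pm.
    apply: (le_meet HA).
      apply: (heyting_trans HA) px; apply: (meet_mono HA); first exact: meet_le1 HA _ _.
      exact: heyting_refl HA _.
    apply: (heyting_trans HA) qy; apply: (meet_mono HA); first exact: meet_le2 HA _ _.
    exact: heyting_refl HA _.
- split.
  + by case: HA => _ _ _ b _; case: (b a').
  + by move=> x y xy ya; exact: (heyting_trans HA xy ya).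
  + by move=> x y; exact: (join_le HA).
- move=> x [p Pp px] xa; apply: nP; apply: Pu Pp; apply/(residuation HA).
  exact: (heyting_trans HA px xa).
exists P'; split=> //.
- by move=> x Px; apply: FP; exists x => //; exact: meet_le1 HA _ _.
- by apply: FP; exists (htop A) => //; exact: meet_le2 HA _ _.
- by move=> /PI; apply; exact: heyting_refl HA _.
Qed.

(** First [Q] is chosen to avoid [b] and contain [k1 c] for all [c] above [a]. Then [P] extends the
    filter above [a] with the trace of [Q]: an obstruction would place [a] below [i1 (himp c d)],
    and [Q] already contains [k1 (himp c d)]. *)
Lemma prime_interpolation (A B C : heyting) (i1 : C -> A) (k1 : C -> B) a b :
  hembedding i1 -> hembedding k1 ->
  ~ (exists c, hle a (i1 c) /\ hle (k1 c) b) ->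
  exists P Q, [/\ hprime P, hprime Q, forall c, P (i1 c) <-> Q (k1 c), P a & ~ Q b].
Proof.
move=> iE kE n; have [HA HB] := (heytingP A, heytingP B).
have [ile ij im ii [iz io]] := iE; have [kle kj km ki [kz ko]] := kE.
have [|||Q [pQ FQ QI]] := @prime_separation B _ _ _ _ _ _ HB
  (fun x => exists2 c, hle a (i1 c) & hle (k1 c) x) (fun x => hle x b).
- split.
  + exists (htop C); first by rewrite io; case: HA => _ _ _ t _; case: (t a).
    by rewrite ko; exact: heyting_refl HB _.
  + by move=> x y xy [c ac cx]; exists c => //; exact: (heyting_trans HB cx xy).
  + move=> x y [c ac cx] [d ad dy]; exists (hmeet c d).
      by rewrite im; exact: (le_meet HA ac ad).
    by rewrite km; exact: (meet_mono HB cx dy).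
- split.
  + by case: HB => _ _ _ t _; case: (t b).
  + by move=> x y xy ya; exact: (heyting_trans HB xy ya).
  + by move=> x y; exact: (join_le HB).
- by move=> x [c ac cx] xb; apply: n; exists c; split=> //; exact: (heyting_trans HB cx xb).
have pT := prime_trace kE pQ.
have [|q c d aq Qc acd|P [pP GP PQ]] := prime_extend iE _ pT (G := hle a).
- split.
  + by case: HA => _ _ _ t _; case: (t a).
  + by move=> x y xy ax; exact: (heyting_trans HA ax xy).
  + by move=> x y; exact: (le_meet HA).
- have : Q (k1 (himp c d)).
    apply: FQ; exists (himp c d); last exact: heyting_refl HB _.
    rewrite ii; apply/(residuation HA); apply: (heyting_trans HA) acd.
    by apply: (meet_mono HA) => //; exact: heyting_refl HA _.
  by rewrite ki => Qi; exact: (prime_imp HB pQ Qi Qc).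
exists P, Q; split=> //; first by apply: GP; exact: heyting_refl HA _.
by move=> /QI; apply; exact: heyting_refl HB _.
Qed.

(** * The Heyting algebra of up-sets of a preorder *)

Section Upsets.
Variables (X : Type) (ord : X -> X -> Prop).
Hypothesis ord_refl : forall x, ord x x.
Hypothesis ord_trans : forall x y z, ord x y -> ord y z -> ord x z.

Definition is_upset (U : X -> Prop) : Prop := forall x y, ord x y -> U x -> U y.
Definition upset := {U | is_upset U}.

Definition up_le (U V : upset) : Prop := forall x, sval U x -> sval V x.

Lemma upset_eq (U V : upset) : (forall x, sval U x <-> sval V x) -> U = V.
Proof.
case: U V => U ? [V ?] E; apply: eq_exist; apply: funext => x.
by apply: propext; exact: E.
Qed.

Definition up_join (U V : upset) : upset.
Proof.
exists (fun x => sval U x \/ sval V x).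
by move=> x y xy []; [left; exact: (svalP U) xy _|right; exact: (svalP V) xy _].
Defined.

Definition up_meet (U V : upset) : upset.
Proof.
exists (fun x => sval U x /\ sval V x).
by move=> x y xy [u v]; split; [exact: (svalP U) xy _|exact: (svalP V) xy _].
Defined.

Definition up_imp (U V : upset) : upset.
Proof.
exists (fun x => forall y, ord x y -> sval U y -> sval V y).
by move=> x y xy uv z yz; apply: uv; exact: ord_trans yz.
Defined.

Definition up_bot : upset := exist is_upset (fun=> False) (fun _ _ _ => id).
Definition up_top : upset := exist is_upset (fun=> True) (fun _ _ _ => id).

Lemma upset_heyting : is_heyting up_le up_join up_meet up_imp up_bot up_top.
Proof.
split.
- split=> [U x //|U V UV VU|U V W UV VW x /UV /VW //].
  by apply: upset_eq => x; split; [exact: UV|exact: VU].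
- split=> [U V x|U V x|U V W UW VW x [/UW|/VW]] //=; by [left|right].
- by split=> [U V x []|U V x []|U V W UW VW x Wx] //=; split; [exact: UW|exact: VW].
- by move=> U; split=> x.
- move=> U V W; split=> [H x Ux y xy Vy|H x [/H Hx Vx]].
    by apply: H; split=> //; exact: (svalP U) xy _.
  exact: Hx.
Qed.

Definition upset_algebra : heyting := Heyting upset_heyting.

Lemma fin_upset : fin X -> fin upset.
Proof.
move=> fX; apply: (@fin_inj _ (X -> Prop) sval) (fin_set fX).
by move=> [U ?] [V ?] /= e; apply: eq_exist.
Qed.

End Upsets.

(** * Amalgams dual to pullbacks of spectra *)

Section HeytingAmalgam.
Variables (A B C : heyting) (i1 : C -> A) (k1 : C -> B).
Hypothesis iE : hembedding i1.
Hypothesis kE : hembedding k1.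

(** The pullback of the prime spectra of [A] and [B] over that of [C]. *)
Definition prime_pair := {p : (A -> Prop) * (B -> Prop) |
  [/\ hprime p.1, hprime p.2 & forall c, p.1 (i1 c) <-> p.2 (k1 c)]}.

Lemma fin_prime_pair : fin A -> fin B -> fin prime_pair.
Proof.
move=> fA fB; apply: (@fin_inj _ _ sval) (fin_prod (fin_set fA) (fin_set fB)).
by move=> [p ?] [q ?] /= e; apply: eq_exist.
Qed.

(** Surjectivity of the projection to the spectrum of [A], which makes [amalgam1] reflect the
    order. *)
Lemma prime_pair1 (P : A -> Prop) :
  hprime P -> exists x : prime_pair, (sval x).1 = P.
Proof.
move=> pP; have [Q pQ QP] := prime_lift kE (prime_trace iE pP).
have xP : [/\ hprime (P, Q).1, hprime (P, Q).2 &
  forall c, (P, Q).1 (i1 c) <-> (P, Q).2 (k1 c)] by split=> //= c; rewrite QP.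
by exists (exist _ (P, Q) xP).
Qed.

Lemma prime_pair2 (Q : B -> Prop) :
  hprime Q -> exists x : prime_pair, (sval x).2 = Q.
Proof.
move=> pQ; have [P pP PQ] := prime_lift iE (prime_trace kE pQ).
have xP : [/\ hprime (P, Q).1, hprime (P, Q).2 &
  forall c, (P, Q).1 (i1 c) <-> (P, Q).2 (k1 c)] by split=> //= c; rewrite PQ.
by exists (exist _ (P, Q) xP).
Qed.

(** The order stays a parameter: componentwise inclusion serves Heyting algebras, and equality gives
    the power set for Boolean algebras. [imp1] and [imp2] demand enough successors to refute
    implications. *)
Variable ord : prime_pair -> prime_pair -> Prop.
Hypothesis ord_refl : forall x, ord x x.
Hypothesis ord_trans : forall x y z, ord x y -> ord y z -> ord x z.
Hypothesis ord1 : forall x y, ord x y -> forall a, (sval x).1 a -> (sval y).1 a.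
Hypothesis ord2 : forall x y, ord x y -> forall b, (sval x).2 b -> (sval y).2 b.
Hypothesis imp1 : forall (x : prime_pair) a a', ~ (sval x).1 (himp a a') ->
  exists y, [/\ ord x y, (sval y).1 a & ~ (sval y).1 a'].
Hypothesis imp2 : forall (x : prime_pair) b b', ~ (sval x).2 (himp b b') ->
  exists y, [/\ ord x y, (sval y).2 b & ~ (sval y).2 b'].

Let D := upset_algebra ord_refl ord_trans.

Definition amalgam1 (a : A) : D :=
  exist (is_upset ord) (fun x => (sval x).1 a) (fun _ _ xy => ord1 xy (a := a)).
Definition amalgam2 (b : B) : D :=
  exist (is_upset ord) (fun x => (sval x).2 b) (fun _ _ xy => ord2 xy (b := b)).

Lemma amalgam1_embedding : hembedding amalgam1.
Proof.
have HA := heytingP A.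
have pr (x : prime_pair) : hprime (sval x).1 by case: (svalP x).
split=> [a a'|a a'|a a'|a a'|].
- split=> [aa' x|H]; first exact: prime_le (pr x) aa'.
  apply: contrapT => /(prime_exists HA) [P [pP Pa nP]].
  have [x xE] := prime_pair1 pP; by move: (H x) => /=; rewrite xE => /(_ Pa) /nP.
- by apply: upset_eq => x /=; exact: (prime_join HA _ _ (pr x)).
- by apply: upset_eq => x /=; exact: (prime_meet HA _ _ (pr x)).
- apply: upset_eq => x /=; split=> [xi y xy|H].
    exact: (prime_imp HA (pr y) (ord1 xy xi)).
  by apply: contrapT => /imp1 [y [xy ya]]; apply; exact: H.
- split; apply: upset_eq => x /=; split=> //; first by case: (pr x).
  by move=> _; case: (pr x) => -[].
Qed.

Lemma amalgam2_embedding : hembedding amalgam2.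
Proof.
have HB := heytingP B.
have pr (x : prime_pair) : hprime (sval x).2 by case: (svalP x).
split=> [a a'|a a'|a a'|a a'|].
- split=> [aa' x|H]; first exact: prime_le (pr x) aa'.
  apply: contrapT => /(prime_exists HB) [P [pP Pa nP]].
  have [x xE] := prime_pair2 pP; by move: (H x) => /=; rewrite xE => /(_ Pa) /nP.
- by apply: upset_eq => x /=; exact: (prime_join HB _ _ (pr x)).
- by apply: upset_eq => x /=; exact: (prime_meet HB _ _ (pr x)).
- apply: upset_eq => x /=; split=> [xi y xy|H].
    exact: (prime_imp HB (pr y) (ord2 xy xi)).
  by apply: contrapT => /imp2 [y [xy ya]]; apply; exact: H.
- split; apply: upset_eq => x /=; split=> //; first by case: (pr x).
  by move=> _; case: (pr x) => -[].
Qed.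

Lemma amalgam12 c : amalgam1 (i1 c) = amalgam2 (k1 c).
Proof. by apply: upset_eq => x /=; case: (svalP x). Qed.

Lemma amalgam12_le a b : hle (amalgam1 a) (amalgam2 b) ->
  exists c, hle a (i1 c) /\ hle (k1 c) b.
Proof.
move=> H; apply: contrapT => /(prime_interpolation iE kE).
move=> [P [Q [pP pQ PQ Pa nQ]]]; apply: nQ.
exact: (H (exist _ (P, Q) (And3 pP pQ PQ))).
Qed.

Lemma amalgam21_le a b : hle (amalgam2 b) (amalgam1 a) ->
  exists c, hle b (k1 c) /\ hle (i1 c) a.
Proof.
move=> H; apply: contrapT => /(prime_interpolation kE iE).
move=> [Q [P [pQ pP PQ Qb nP]]]; apply: nP.
have PQ' c : P (i1 c) <-> Q (k1 c) by rewrite PQ.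
exact: (H (exist _ (P, Q) (And3 pP pQ PQ'))).
Qed.

End HeytingAmalgam.

(** * Meaning of the axioms *)

Section Semantics.
Variables (L : language) (S : structure L).

Definition env4 (x y z w : S) : var4 -> S :=
  oapp (oapp (oapp (oapp (fun e : void => match e return S with end) x) y) z) w.

Fixpoint all_hold (axs : seq (formula L var4)) : Prop :=
  match axs with
  | [::] => True
  | phi :: l => (forall x y z w, sat (env4 x y z w) phi) /\ all_hold l
  end.

Lemma models_all_hold axs : models (axiomatized_by axs) S <-> all_hold axs.
Proof.
elim: axs => [|phi l IH]; first by split=> // _ psi [].
rewrite /= -IH; split=> [H|[H1 H2] psi [<-|/H2]] //.
by split=> [|psi Hpsi]; [exact: (H _ (or_introl erefl))|apply: H; right].
Qed.

Lemma all_hold_cat s1 s2 : all_hold (s1 ++ s2) <-> all_hold s1 /\ all_hold s2.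
Proof.
elim: s1 => [|phi l IH] /=; first by split=> [|[]].
by rewrite IH; split=> [[a [b c]]|[[a b] c]].
Qed.

Section Orders.
Variables R Q : term L var4 -> term L var4 -> formula L var4.
Variables r q : S -> S -> Prop.
Hypothesis RE : forall (v : var4 -> S) t u, sat v (R t u) <-> r (eval v t) (eval v u).
Hypothesis QE : forall (v : var4 -> S) t u, sat v (Q t u) <-> q (eval v t) (eval v u).

Lemma all_hold_partial_order : all_hold (partial_order R) <-> is_order r.
Proof.
split=> [[h1 [h2 [h3 _]]]|[h1 h2 h3]].
  split=> [x|x y|x y z]; first by have := h1 x x x x; rewrite RE.
    by have := h2 x y x x; rewrite /= !RE.
  by have := h3 x y z x; rewrite /= !RE.
split=> [x y z w|]; first by rewrite RE.
split=> [x y z w|]; first by rewrite /= !RE; exact: h2.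
by split=> // x y z w; rewrite /= !RE; exact: h3.
Qed.

Lemma all_hold_coarser_relation :
  all_hold (coarser_relation R Q) <-> forall x y, r x y -> q x y.
Proof.
split=> [[h _] x y|h]; first by have := h x y x x; rewrite /= RE QE.
by split=> // x y z w; rewrite /= RE QE; exact: h.
Qed.

Lemma all_hold_total_relation :
  all_hold (total_relation Q) <-> forall x y, q x y \/ q y x.
Proof.
split=> [[h _] x y|h]; first by have := h x y x x; rewrite sat_Or !QE.
by split=> // x y z w; rewrite sat_Or !QE; exact: h.
Qed.

Lemma all_hold_auxiliary_relation :
  all_hold (auxiliary_relation R Q) <-> is_auxiliary r q.
Proof.
split=> [[h1 [h2 _]]|[h1 h2]].
  split=> [x y|x y z w]; first by have := h1 x y x x; rewrite /= RE QE.
  by have := h2 x y z w; rewrite /= !RE !QE.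
split=> [x y z w|]; first by rewrite /= RE QE; exact: h1.
by split=> // x y z w; rewrite /= !RE !QE; exact: h2.
Qed.

Lemma all_hold_antireflexive : all_hold (antireflexive Q) <-> forall x, ~ q x x.
Proof.
split=> [[h _] x|h]; first by have := h x x x x; rewrite /= QE.
by split=> // x y z w; rewrite /= QE; exact: h.
Qed.

End Orders.

Lemma all_hold_semilattice f :
  all_hold (semilattice f) <-> semilattice_eqs (iop2 (s := S) f).
Proof.
split=> [[h1 [h2 [h3 _]]]|[h1 h2 h3]] /=.
  split=> [x y z|x y|x]; first exact: (h1 x y z x).
    exact: (h2 x y x x).
  exact: (h3 x x x x).
by split=> [x y z w|]; [exact: h1|split=> [x y z w|]; [exact: h2|]].
Qed.

(** Absorption says that the orders read off from [j] and from [m] are opposite to each other. *)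
Lemma semilattices_absorption (j m : S -> S -> S) :
  [/\ semilattice_eqs j, semilattice_eqs m &
    (forall x y, j x (m x y) = x) /\ (forall x y, m x (j x y) = x)] <->
  let le x y := j x y = y in
  [/\ is_order le, is_join le j & is_meet le m].
Proof.
split=> [[ej em [jm mj]] le|[ole jle mle]].
  have [ole jle] := eqs_join ej; split=> //.
  have [[_ mC mI] [om jm']] := (em, eqs_join em).
  rewrite /is_meet; have -> : dual le = (fun x y => m x y = y).
    apply: funext => x; apply: funext => y; apply: propext; split.
      by move=> h; have := mj y x; rewrite h mC.
    by move=> h; rewrite /dual /le; have := jm x y; rewrite h; case: ej => _ -> _.
  exact: jm'.
have [ej leE] := join_eqs ole jle.
have [em geE] := join_eqs (order_dual ole) mle.
split=> //; have [[_ jC _] [_ mC _]] := (ej, em).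
split=> x y; first by rewrite jC; case: mle => + _ _; apply.
by rewrite mC; apply/geE; case: jle => + _ _; apply.
Qed.

Lemma all_hold_lattice (j m : op2 L) : all_hold (lattice j m) <->
  let le (x y : S) := iop2 j x y = y in
  [/\ is_order le, is_join le (iop2 j) & is_meet le (iop2 m)].
Proof.
rewrite /lattice !all_hold_cat !all_hold_semilattice.
apply: iff_trans (semilattices_absorption _ _).
split=> [[h1 [h2 [h3 [h4 _]]]]|[h1 h2 [h3 h4]]].
  split=> //; split=> x y; [exact: (h3 x y x x)|exact: (h4 x y x x)].
by do 2 split=> //; split=> [x y z w|]; [exact: h3|split=> // x y z w; exact: h4].
Qed.

Lemma all_hold_bounds (j m : op2 L) (zero one : cst L) :
  let le (x y : S) := iop2 j x y = y in
  is_order le -> is_join le (iop2 j) -> is_meet le (iop2 m) ->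
  all_hold (nontrivial_bounds j m zero one) <->
  (forall x, le (icst S zero) x /\ le x (icst S one)) /\
  icst S zero <> icst S one.
Proof.
move=> le ole jle mle.
have [[_ jC _] leE] := join_eqs ole jle.
have [[_ mC _] geE] := join_eqs (order_dual ole) mle.
split=> [[h1 [h2 [h3 _]]]|[h nt]].
  split; last by have e := icst S zero; have := h3 e e e e.
  move=> x; split; first by rewrite leE jC; exact: (h1 x x x x).
  by apply/(geE _ x); rewrite mC; exact: (h2 x x x x).
split=> [x y z w|] /=; first by rewrite jC; have [] := h x.
split=> [x y z w|] /=; last by [].
by rewrite mC; apply/(geE _ x); have [] := h x.
Qed.

End Semantics.

Definition is_boolean D (le : D -> D -> Prop) j m cmp (z o : D) : Prop :=
  [/\ is_order le, is_join le j, is_meet le m, forall x, le z x /\ le x o &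
      [/\ forall x y w, m x (j y w) = j (m x y) (m x w),
          forall x, j x (cmp x) = o & forall x, m x (cmp x) = z]].

Definition base_sem (b : base) : structure (lang b) -> Prop :=
  match b with
  | PartialOrders => fun S => is_order (@le_in PartialOrders S)
  | Lattices => fun S =>
      [/\ is_order (@le_in Lattices S),
          is_join (@le_in Lattices S) (iop2 (Join : op2 (lang Lattices))) &
          is_meet (@le_in Lattices S) (iop2 (Meet : op2 (lang Lattices)))]
  | JoinSemilattices => fun S => is_order (@le_in JoinSemilattices S) /\
      is_join (@le_in JoinSemilattices S) (iop2 (tt : op2 (lang JoinSemilattices)))
  | MeetSemilattices => fun S => is_order (@le_in MeetSemilattices S) /\
      is_meet (@le_in MeetSemilattices S) (iop2 (tt : op2 (lang MeetSemilattices)))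
  | BooleanAlgebras => fun S =>
      is_boolean (@le_in BooleanAlgebras S)
        (iop2 (Join : op2 (lang BooleanAlgebras)))
        (iop2 (Meet : op2 (lang BooleanAlgebras)))
        (iop1 (tt : op1 (lang BooleanAlgebras)))
        (icst S (Zero : cst (lang BooleanAlgebras)))
        (icst S (One : cst (lang BooleanAlgebras))) /\
      icst S (Zero : cst (lang BooleanAlgebras)) <>
      icst S (One : cst (lang BooleanAlgebras))
  | HeytingAlgebras => fun S =>
      is_heyting (@le_in HeytingAlgebras S)
        (iop2 (HJoin : op2 (lang HeytingAlgebras)))
        (iop2 (HMeet : op2 (lang HeytingAlgebras)))
        (iop2 (HImp : op2 (lang HeytingAlgebras)))
        (icst S (Zero : cst (lang HeytingAlgebras)))
        (icst S (One : cst (lang HeytingAlgebras))) /\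
      icst S (Zero : cst (lang HeytingAlgebras)) <>
      icst S (One : cst (lang HeytingAlgebras))
  end.

Lemma sat_le_formula b (S : structure (lang b)) V (v : V -> S) t u :
  sat v (le_formula t u) <-> le_in (eval v t) (eval v u).
Proof. by case: b S v t u. Qed.

Lemma meet_le_in (S : structure (lang MeetSemilattices)) :
  is_order (@le_in MeetSemilattices S) /\
  is_meet (@le_in MeetSemilattices S) (iop2 (tt : op2 (lang MeetSemilattices))) <->
  semilattice_eqs (iop2 (s := S) (tt : op2 (lang MeetSemilattices))).
Proof.
set m := iop2 _; split=> [[ole mle]|eqs].
  by have [] := join_eqs (order_dual ole) mle.
have [om jm] := eqs_join eqs; have [_ mC _] := eqs.
have E : dual (@le_in MeetSemilattices S) = (fun x y => m x y = y).
  apply: funext => x; apply: funext => y; apply: propext.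
  by rewrite /dual -[le_in y x]/(m y x = y) mC.
split; last by rewrite /is_meet E.
rewrite -[X in is_order X]/(dual (dual (@le_in MeetSemilattices S))).
by apply: order_dual; rewrite E.
Qed.

Lemma base_semP b (S : structure (lang b)) :
  all_hold S (base_axioms b) <-> base_sem S.
Proof.
case: b S => S.
- exact: all_hold_partial_order (@sat_le_formula PartialOrders S var4).
- exact: all_hold_lattice.
- rewrite /base_axioms all_hold_semilattice; split=> [/eqs_join //|[ole jle]].
  by have [] := join_eqs ole jle.
- by rewrite /base_axioms all_hold_semilattice; apply: iff_sym; exact: meet_le_in.
- rewrite /base_axioms /nontrivial_boolean_algebra all_hold_cat all_hold_lattice all_hold_cat.
  split=> [[[ole jle mle]]|[[ole jle mle bd [h1 h2 h3]] nt]].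
    rewrite all_hold_bounds // => -[[bd nt] [h1 [h2 [h3 _]]]].
    split=> //; split=> //; split=> [x y w|x|x].
    + exact: (h1 x y w x).
    + exact: (h2 x x x x).
    + exact: (h3 x x x x).
  split=> //; rewrite all_hold_bounds //; split=> //.
  split=> [x y z w|]; first exact: h1.
  by split=> [x y z w|]; [exact: h2|split=> // x y z w; exact: h3].
- rewrite /base_axioms /nontrivial_heyting_algebra all_hold_cat all_hold_lattice all_hold_cat.
  split=> [[[ole jle mle]]|[[ole jle mle bd h] nt]].
    rewrite all_hold_bounds // => -[[bd nt] [h1 [h2 _]]].
    split=> //; split=> // x y w; split; first exact: (h1 x y w x).
    exact: (h2 x y w x).
  split=> //; rewrite all_hold_bounds //; split=> //.
  split=> [x y z w|]; first by have [] := h x y z.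
  by split=> // x y z w; have [] := h x y z.
Qed.

Definition ll_in b (S : structure (lang b)) (x y : S) : Prop :=
  irel2 (None : rel2 (lang b)) x y.

Definition ll_bounds_sem (b : base) : structure (lang b) -> Prop :=
  match b with
  | BooleanAlgebras => fun S => forall c : cst (lang BooleanAlgebras),
      @ll_in BooleanAlgebras S (icst S c) (icst S c)
  | HeytingAlgebras => fun S => forall c : cst (lang HeytingAlgebras),
      @ll_in HeytingAlgebras S (icst S c) (icst S c)
  | _ => fun=> True
  end.

Definition ll_sem (t : theory_name) : structure (lang (base_of t)) -> Prop :=
  match t with
  | Expansion b CoarserOrder => fun S => is_coarser (@le_in b S) (@ll_in b S)
  | Expansion b Linearization => fun S => is_linearization (@le_in b S) (@ll_in b S)
  | Expansion b AuxiliaryRelation => fun S =>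
      is_auxiliary (@le_in b S) (@ll_in b S) /\ ll_bounds_sem S
  | CausalSpaces => fun S =>
      is_auxiliary (@le_in PartialOrders S) (@ll_in PartialOrders S) /\
      forall x : S, ~ @ll_in PartialOrders S x x
  end.

Lemma theory_semP t (S : structure (lang (base_of t))) :
  models (theory_of t) S <-> base_sem S /\ ll_sem S.
Proof.
have leP b (S' : structure (lang b)) := @sat_le_formula b S' var4.
have llP b (S' : structure (lang b)) (v : var4 -> S') t1 t2 :
  sat v (@ll_formula b var4 t1 t2) <-> ll_in (eval v t1) (eval v t2) by [].
case: t S => [b []|] S; rewrite models_all_hold all_hold_cat base_semP
  /expansion_axioms all_hold_cat; last first.
- by rewrite (all_hold_auxiliary_relation (leP _ S) (llP _ S))
    (all_hold_antireflexive (llP _ S)).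
- rewrite (all_hold_auxiliary_relation (leP _ S) (llP _ S)).
  suff -> : all_hold S (ll_bounds b) <-> ll_bounds_sem S by [].
  case: b S => S //; split=> [[h0 [h1 _]]|h];
    [|by split=> // [|]; [move=> x y z w; exact: (h Zero)|
      split=> // x y z w; exact: (h One)]| |
      by split=> // [|]; [move=> x y z w; exact: (h Zero)|
      split=> // x y z w; exact: (h One)]].
  + by have e := icst S (Zero : cst (lang BooleanAlgebras));
      case; [exact: (h0 e e e e)|exact: (h1 e e e e)].
  + by have e := icst S (Zero : cst (lang HeytingAlgebras));
      case; [exact: (h0 e e e e)|exact: (h1 e e e e)].
- rewrite all_hold_cat (all_hold_partial_order (llP _ S)) (all_hold_total_relation (llP _ S))
    (all_hold_coarser_relation (leP _ S) (llP _ S)).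
  by split=> [[h [h1 [h2 h3]]]|[h [[h1 h3] h2]]].
- by rewrite (all_hold_partial_order (llP _ S))
    (all_hold_coarser_relation (leP _ S) (llP _ S)).
Qed.

(** * Superamalgamation of the base theories *)

(** The amalgam of the base reducts carries a dummy [<<], overwritten here once its order is
    known. *)
Definition with_ll b (S : structure (lang b)) (r : S -> S -> Prop) :
    structure (lang b) :=
  @Structure (lang b) S (icst S) (iop1 (s := S)) (iop2 (s := S))
    (fun s : option (rel2 (base_language b)) =>
       if s is Some s' then irel2 (Some s' : rel2 (lang b)) else r).

Lemma base_sem_with_ll b (S : structure (lang b)) (r : S -> S -> Prop) :
  base_sem (with_ll r) <-> base_sem S.
Proof. by case: b S r. Qed.

Lemma le_in_with_ll b (S : structure (lang b)) (r : S -> S -> Prop) :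
  @le_in b (with_ll r) = @le_in b S.
Proof. by case: b S r. Qed.

Lemma base_sem_order b (S : structure (lang b)) : base_sem S -> is_order (@le_in b S).
Proof. by case: b S => S //= [] // [].  Qed.

Definition base_embedding b (A B : structure (lang b)) (f : A -> B) : Prop :=
  [/\ injective f, forall c, f (icst A c) = icst B c,
      forall o x, f (iop1 o x) = iop1 o (f x),
      forall o x y, f (iop2 o x y) = iop2 o (f x) (f y) &
      forall (r : rel2 (base_language b)) x y,
        irel2 (Some r : rel2 (lang b)) x y <->
        irel2 (Some r : rel2 (lang b)) (f x) (f y)].

Lemma embeddingE b (A B : structure (lang b)) (f : A -> B) :
  embedding f <->
  base_embedding f /\ forall x y, ll_in x y <-> ll_in (f x) (f y).
Proof.
split=> [[fI fc f1 f2 fr]|[[fI fc f1 f2 fr] fll]].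
  by split; [split=> // r; exact: fr|move=> x y; exact: fr].
by split=> // -[r|] x y; [exact: fr|exact: fll].
Qed.

Lemma le_in_embedding b (A B : structure (lang b)) (f : A -> B) x y :
  base_embedding f -> le_in x y <-> le_in (f x) (f y).
Proof.
move=> [fI _ _ f2 fr]; case: b A B f fI f2 fr x y => A B f fI f2 fr x y.
- exact: fr.
all: rewrite /le_in /=; rewrite -f2.
all: by split=> [->|/fI].
Qed.

Definition base_amalgamates (b : base) : Prop :=
  forall (A B C : structure (lang b)) (i1 : C -> A) (k1 : C -> B),
    base_sem A -> base_sem B -> base_sem C ->
    base_embedding i1 -> base_embedding k1 ->
    exists (D : structure (lang b)) (i : A -> D) (k : B -> D),
      [/\ base_sem D, base_embedding i, base_embedding k,
          forall c, i (i1 c) = k (k1 c) &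
          (forall x y, le_in (sum_map i k x) (sum_map i k y) <->
             sum_rel i1 k1 (@le_in b A) (@le_in b B) x y) /\
          (fin A -> fin B -> fin D)].

Section MacNeilleAmalgam.
Variables (A B C : Type) (i1 : C -> A) (k1 : C -> B).
Variables (leA : A -> A -> Prop) (leB : B -> B -> Prop).
Hypothesis oA : is_order leA.
Hypothesis oB : is_order leB.
Hypothesis compat : forall c c', leA (i1 c) (i1 c') <-> leB (k1 c) (k1 c').

Let q := sum_rel i1 k1 leA leB.

Lemma mac_refl x : q x x.
Proof. by case: oA oB x => [rA _ _] [rB _ _] [x|x] /=. Qed.

Lemma mac_trans x y z : q x y -> q y z -> q x z.
Proof. by case: oA oB => [_ _ tA] [_ _ tB]; exact: sum_rel_trans. Qed.

Definition mac1 (a : A) : cut q := down q (inl a).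
Definition mac2 (b : B) : cut q := down q (inr b).

Lemma sum_map_mac x : sum_map mac1 mac2 x = down q x.
Proof. by case: x. Qed.

Lemma mac_le x y :
  cut_le (sum_map mac1 mac2 x) (sum_map mac1 mac2 y) <-> q x y.
Proof. by rewrite !sum_map_mac; exact: down_le mac_refl mac_trans _ _. Qed.

Lemma mac_com c : mac1 (i1 c) = mac2 (k1 c).
Proof.
have [_ anti _] := cut_order q; have [[rA _ _] [rB _ _]] := (oA, oB).
apply: anti; first by apply/(mac_le (inl _) (inr _)); exists c.
by apply/(mac_le (inr _) (inl _)); exists c.
Qed.

Lemma mac1_inj : injective mac1.
Proof.
move=> x y e; have [rD _ _] := cut_order q; have [_ anti _] := oA.
by apply: anti; [apply/(mac_le (inl x) (inl y))|apply/(mac_le (inl y) (inl x))];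
  rewrite /= e.
Qed.

Lemma mac2_inj : injective mac2.
Proof.
move=> x y e; have [rD _ _] := cut_order q; have [_ anti _] := oB.
by apply: anti; [apply/(mac_le (inr x) (inr y))|apply/(mac_le (inr y) (inr x))];
  rewrite /= e.
Qed.

Lemma mac_join jA jB jC : is_join leA jA -> is_join leB jB ->
  (forall c d, i1 (jC c d) = jA (i1 c) (i1 d)) ->
  (forall c d, k1 (jC c d) = jB (k1 c) (k1 d)) ->
  (forall x y, mac1 (jA x y) = cut_join (mac1 x) (mac1 y)) /\
  (forall x y, mac2 (jB x y) = cut_join (mac2 x) (mac2 y)).
Proof.
move=> jleA jleB iE kE; have [H1 H2] := sum_rel_join oA oB jleA jleB iE kE.
split=> x y; apply: (down_join mac_refl mac_trans).
- by case: jleA => + _ _; apply.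
- by case: jleA => _ + _; apply.
- exact: H1.
- by case: jleB => + _ _; apply.
- by case: jleB => _ + _; apply.
- exact: H2.
Qed.

Lemma mac_meet mA mB mC : is_meet leA mA -> is_meet leB mB ->
  (forall c d, i1 (mC c d) = mA (i1 c) (i1 d)) ->
  (forall c d, k1 (mC c d) = mB (k1 c) (k1 d)) ->
  (forall x y, mac1 (mA x y) = cut_meet (mac1 x) (mac1 y)) /\
  (forall x y, mac2 (mB x y) = cut_meet (mac2 x) (mac2 y)).
Proof.
move=> mleA mleB iE kE.
have [H1 H2] := sum_rel_join (order_dual oA) (order_dual oB) mleA mleB iE kE.
have dE := sum_rel_dual i1 k1 leA leB.
split=> x y; apply: (down_meet mac_refl mac_trans).
- by case: mleA => + _ _; apply.
- by case: mleA => _ + _; apply.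
- by move=> w wx wy; apply/dE; apply: H1; apply/dE.
- by case: mleB => + _ _; apply.
- by case: mleB => _ + _; apply.
- by move=> w wx wy; apply/dE; apply: H2; apply/dE.
Qed.

Lemma fin_mac : fin A -> fin B -> fin (cut q).
Proof. by move=> fA fB; apply: fin_cut; exact: fin_sum. Qed.

End MacNeilleAmalgam.

Lemma le_in_compat b (A B C : structure (lang b)) (i1 : C -> A) (k1 : C -> B) :
  base_embedding i1 -> base_embedding k1 ->
  forall c c', le_in (i1 c) (i1 c') <-> le_in (k1 c) (k1 c').
Proof. by move=> iE kE c c'; rewrite -!le_in_embedding. Qed.

(** Cuts stand in for the quotient of the preorder [sum_rel]: they are antisymmetric by
    extensionality. *)
Lemma partial_orders_amalgamate : base_amalgamates PartialOrders.
Proof.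
move=> A B C i1 k1 oA oB _ iE kE; have co := le_in_compat iE kE.
pose D := @Structure (lang PartialOrders)
  (cut (sum_rel i1 k1 (@le_in PartialOrders A) (@le_in PartialOrders B)))
  (fun c => match c with end) (fun o => match o with end) (fun o => match o with end)
  (fun r => if r is Some _ then @cut_le _ _ else fun _ _ => False).
exists D, (mac1 i1 k1 (@le_in PartialOrders A) (@le_in PartialOrders B)),
  (mac2 i1 k1 (@le_in PartialOrders A) (@le_in PartialOrders B)); split.
- exact: cut_order.
- split=> [|[]|[]|[]|[] x y] //; first exact: mac1_inj.
  by apply: iff_sym; exact: (mac_le oA oB co (inl x) (inl y)).
- split=> [|[]|[]|[]|[] x y] //; first exact: mac2_inj.
  by apply: iff_sym; exact: (mac_le oA oB co (inr x) (inr y)).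
- exact: mac_com.
- by split; [exact: mac_le|exact: fin_mac].
Qed.

Lemma lattices_amalgamate : base_amalgamates Lattices.
Proof.
move=> A B C i1 k1 [oA jA mA] [oB jB mB] _ iE kE; have co := le_in_compat iE kE.
pose q := sum_rel i1 k1 (@le_in Lattices A) (@le_in Lattices B).
pose D := @Structure (lang Lattices) (cut q)
  (fun c => match c with end) (fun o => match o with end)
  (fun o => match o with Join => @cut_join _ q | Meet => @cut_meet _ q end)
  (fun _ _ _ => False).
have leD : @le_in Lattices D = @cut_le _ q.
  apply: funext => x; apply: funext => y; apply: propext; apply: iff_sym.
  by have [_] := join_eqs (cut_order q) (@cut_is_join _ q); exact.
have [[_ _ _ i2 _] [_ _ _ k2 _]] := (iE, kE).
have [J1 J2] := mac_join oA oB co jA jB (i2 Join) (k2 Join).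
have [M1 M2] := mac_meet oA oB co mA mB (i2 Meet) (k2 Meet).
exists D, (mac1 i1 k1 (@le_in Lattices A) (@le_in Lattices B)),
  (mac2 i1 k1 (@le_in Lattices A) (@le_in Lattices B)); split.
- by rewrite /base_sem leD; split;
    [exact: cut_order|exact: cut_is_join|exact: cut_is_meet].
- by split=> [|[]|[]|[]|[]] //; exact: mac1_inj.
- by split=> [|[]|[]|[]|[]] //; exact: mac2_inj.
- exact: mac_com.
- by rewrite leD; split; [exact: mac_le|exact: fin_mac].
Qed.

Lemma join_semilattices_amalgamate : base_amalgamates JoinSemilattices.
Proof.
move=> A B C i1 k1 [oA jA] [oB jB] _ iE kE; have co := le_in_compat iE kE.
pose q := sum_rel i1 k1 (@le_in JoinSemilattices A) (@le_in JoinSemilattices B).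
pose D := @Structure (lang JoinSemilattices) (cut q)
  (fun c => match c with end) (fun o => match o with end)
  (fun=> @cut_join _ q) (fun _ _ _ => False).
have leD : @le_in JoinSemilattices D = @cut_le _ q.
  apply: funext => x; apply: funext => y; apply: propext; apply: iff_sym.
  by have [_] := join_eqs (cut_order q) (@cut_is_join _ q); exact.
have [[_ _ _ i2 _] [_ _ _ k2 _]] := (iE, kE).
have [J1 J2] := mac_join oA oB co jA jB (i2 tt) (k2 tt).
exists D, (mac1 i1 k1 (@le_in JoinSemilattices A) (@le_in JoinSemilattices B)),
  (mac2 i1 k1 (@le_in JoinSemilattices A) (@le_in JoinSemilattices B)); split.
- by rewrite /base_sem leD; split; [exact: cut_order|exact: cut_is_join].
- by split=> [|[]|[]|[]|[]] //; exact: mac1_inj.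
- by split=> [|[]|[]|[]|[]] //; exact: mac2_inj.
- exact: mac_com.
- by rewrite leD; split; [exact: mac_le|exact: fin_mac].
Qed.

Lemma meet_semilattices_amalgamate : base_amalgamates MeetSemilattices.
Proof.
move=> A B C i1 k1 [oA mA] [oB mB] _ iE kE; have co := le_in_compat iE kE.
pose q := sum_rel i1 k1 (@le_in MeetSemilattices A) (@le_in MeetSemilattices B).
pose D := @Structure (lang MeetSemilattices) (cut q)
  (fun c => match c with end) (fun o => match o with end)
  (fun=> @cut_meet _ q) (fun _ _ _ => False).
have leD : @le_in MeetSemilattices D = @cut_le _ q.
  apply: funext => x; apply: funext => y; apply: propext; apply: iff_sym.
  have [[_ mC _] E] := join_eqs (order_dual (cut_order q)) (@cut_is_meet _ q).
  by rewrite -[le_in x y]/(cut_meet x y = x) mC; exact: (E y x).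
have [[_ _ _ i2 _] [_ _ _ k2 _]] := (iE, kE).
have [M1 M2] := mac_meet oA oB co mA mB (i2 tt) (k2 tt).
exists D, (mac1 i1 k1 (@le_in MeetSemilattices A) (@le_in MeetSemilattices B)),
  (mac2 i1 k1 (@le_in MeetSemilattices A) (@le_in MeetSemilattices B)); split.
- by rewrite /base_sem leD; split; [exact: cut_order|exact: cut_is_meet].
- by split=> [|[]|[]|[]|[]] //; exact: mac1_inj.
- by split=> [|[]|[]|[]|[]] //; exact: mac2_inj.
- exact: mac_com.
- by rewrite leD; split; [exact: mac_le|exact: fin_mac].
Qed.

Lemma sum_rel_heyting (A B C D : heyting) (i1 : C -> A) (k1 : C -> B)
    (i : A -> D) (k : B -> D) :
  hembedding i -> hembedding k -> (forall c, i (i1 c) = k (k1 c)) ->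
  (forall a b, hle (i a) (k b) -> exists c, hle a (i1 c) /\ hle (k1 c) b) ->
  (forall a b, hle (k b) (i a) -> exists c, hle b (k1 c) /\ hle (i1 c) a) ->
  forall x y, hle (sum_map i k x) (sum_map i k y) <->
    sum_rel i1 k1 (@hle A) (@hle B) x y.
Proof.
move=> [iE _ _ _ _] [kE _ _ _ _] com ik ki; have t := heyting_trans (heytingP D).
move=> [x|x] [y|y] /=.
- by rewrite iE.
- split=> [/ik //|[c [xc cy]]]; apply: (t (i (i1 c))); first exact/iE.
  by rewrite com; apply/kE.
- split=> [/ki //|[c [xc cy]]]; apply: (t (k (k1 c))); first exact/kE.
  by rewrite -com; apply/iE.
- by rewrite kE.
Qed.

Lemma hembedding_inj (A B : heyting) (f : A -> B) : hembedding f -> injective f.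
Proof.
move=> [le_ _ _ _ _] x y e; have [[_ anti _] _ _ _ _] := heytingP A.
by apply: anti; apply/le_; rewrite e; exact: heyting_refl (heytingP B) _.
Qed.

Definition heyting_of (S : structure (lang HeytingAlgebras)) (h : base_sem S) :
  heyting := Heyting (proj1 h).

Lemma heyting_of_embedding (S T : structure (lang HeytingAlgebras))
    (hS : base_sem S) (hT : base_sem T) (f : S -> T) :
  base_embedding f -> @hembedding (heyting_of hS) (heyting_of hT) f.
Proof.
move=> fE; have [_ fc _ f2 _] := fE.
split=> [x y|x y|x y|x y|]; first exact: (le_in_embedding x y fE).
- exact: (f2 HJoin).
- exact: (f2 HMeet).
- exact: (f2 HImp).
- by split; [exact: (fc Zero)|exact: (fc One)].
Qed.

Lemma heyting_algebras_amalgamate : base_amalgamates HeytingAlgebras.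
Proof.
move=> A B C i1 k1 hA hB hC iE kE; have ntA := proj2 hA.
pose A' := heyting_of hA; pose B' := heyting_of hB; pose C' := heyting_of hC.
have iH : @hembedding C' A' i1 := heyting_of_embedding hC hA iE.
have kH : @hembedding C' B' k1 := heyting_of_embedding hC hB kE.
pose X := @prime_pair A' B' C' i1 k1.
pose ord (x y : X) := (forall a, (sval x).1 a -> (sval y).1 a) /\
  (forall b, (sval x).2 b -> (sval y).2 b).
have o1 (x : X) : ord x x by [].
have o2 (x y z : X) : ord x y -> ord y z -> ord x z.
  by move=> [a b] [c d]; split=> u; [move=> /a /c|move=> /b /d].
have o3 (x y : X) (xy : ord x y) := proj1 xy.
have o4 (x y : X) (xy : ord x y) := proj2 xy.
have o5 (x : X) (a a' : A') : ~ (sval x).1 (himp a a') ->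
    exists y : X, [/\ ord x y, (sval y).1 a & ~ (sval y).1 a'].
  case: x => -[P Q] /= [pP pQ PQ] /(prime_imp_extend pP) [P' [pP' PP' Pa nP]].
  have [|Q' [pQ' QQ' Q'P]] := prime_lift_above kH pQ (prime_trace iH pP').
    by move=> c /PQ /PP'.
  have yP : [/\ hprime (P', Q').1, hprime (P', Q').2 &
    forall c, (P', Q').1 (i1 c) <-> (P', Q').2 (k1 c)].
    by split=> //= c; rewrite Q'P.
  by exists (exist _ (P', Q') yP).
have o6 (x : X) (b b' : B') : ~ (sval x).2 (himp b b') ->
    exists y : X, [/\ ord x y, (sval y).2 b & ~ (sval y).2 b'].
  case: x => -[P Q] /= [pP pQ PQ] /(prime_imp_extend pQ) [Q' [pQ' QQ' Qb nQ]].
  have [|P' [pP' PP' P'Q]] := prime_lift_above iH pP (prime_trace kH pQ').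
    by move=> c /PQ /QQ'.
  have yP : [/\ hprime (P', Q').1, hprime (P', Q').2 &
    forall c, (P', Q').1 (i1 c) <-> (P', Q').2 (k1 c)].
    by split=> //= c; rewrite P'Q.
  by exists (exist _ (P', Q') yP).
pose D' := upset_algebra o1 o2.
pose D := @Structure (lang HeytingAlgebras) (upset ord)
  (fun c => match c with Zero => hbot D' | One => htop D' end)
  (fun o => match o with end)
  (fun o => match o with HJoin => @hjoin D' | HMeet => @hmeet D' | HImp => @himp D' end)
  (fun _ _ _ => False).
have leD : @le_in HeytingAlgebras D = @hle D'.
  apply: funext => x; apply: funext => y; apply: propext; apply: iff_sym.
  by have [o j _ _ _] := heytingP D'; have [_] := join_eqs o j; exact.
have E1 := amalgam1_embedding iH kH o1 o2 o3 o5.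
have E2 := amalgam2_embedding iH kH o1 o2 o4 o6.
have com := amalgam12 o1 o2 o3 o4.
pose i : A -> D := amalgam1 o1 o2 o3; pose k : B -> D := amalgam2 o1 o2 o4.
have [[_ i_j i_m i_i [i_z i_o]] [_ k_j k_m k_i [k_z k_o]]] := (E1, E2).
exists D, i, k; split.
- split; first by rewrite leD; exact: heytingP D'.
  rewrite -[icst D Zero]/(hbot D') -[icst D One]/(htop D') -i_z -i_o.
  by move/(hembedding_inj E1).
- split=> [|[]|[]|[]|[]] //; exact: (hembedding_inj E1).
- split=> [|[]|[]|[]|[]] //; exact: (hembedding_inj E2).
- exact: com.
- split.
    rewrite leD; apply: (@sum_rel_heyting A' B' C' D' i1 k1 i k E1 E2 com).
      exact: (amalgam12_le iH kH).
    exact: (amalgam21_le iH kH).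
  by move=> fA fB; apply: fin_upset; exact: (@fin_prime_pair A' B').
Qed.

(** * Boolean algebras as Heyting algebras *)

Section Boolean.
Variables (D : Type) (le : D -> D -> Prop) (j m : D -> D -> D) (cmp : D -> D).
Variables (z o : D).
Hypothesis H : is_boolean le j m cmp z o.

Definition bool_imp x y := j (cmp x) y.

Lemma boolean_heyting : is_heyting le j m bool_imp z o.
Proof.
have [ole jle mle bd [dist jc mc]] := H; split=> // x y w.
have [[[r a t] [jl jr jm]] [ml mr mm]] := (ole, jle, mle).
have [[_ jC _] leE] := join_eqs ole jle.
have [[_ mC _] geE] := join_eqs (order_dual ole) mle.
split=> h; rewrite /bool_imp.
  have -> : x = j (m x y) (m x (cmp y)).
    by rewrite -dist jc mC; apply/esym/geE; case: (bd x).
  by apply: (jm); [apply: t h _; exact: jr|apply: t (mr _ _) _; exact: jl].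
apply: (t _ (m y (bool_imp y w))).
  by apply: mm; [exact: mr|apply: t h; exact: ml].
rewrite dist mc; apply: (jm); last exact: mr.
by case: (bd w).
Qed.

Lemma bool_imp_bot x : bool_imp x z = cmp x.
Proof.
have [ole jle _ bd _] := H; have [[_ jC _] leE] := join_eqs ole jle.
by rewrite /bool_imp jC; apply/leE; case: (bd (cmp x)).
Qed.

(** Prime filters of a Boolean algebra are ultrafilters, so a failing implication is refuted at [P]
    itself; this is why equality can serve as [ord]. *)
Lemma bool_prime_imp (P : D -> Prop) x y : is_prime le j m z o P ->
  ~ P (bool_imp x y) -> P x /\ ~ P y.
Proof.
move=> pP; rewrite (prime_join boolean_heyting _ _ pP) => /not_orP [nx ny].
split=> //; have [_ _ _ _ [_ jc _]] := H.
have : P (j x (cmp x)) by rewrite jc; case: pP => -[].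
by rewrite (prime_join boolean_heyting _ _ pP) => -[].
Qed.

End Boolean.

Definition boolean_of (S : structure (lang BooleanAlgebras)) (h : base_sem S) :
  heyting := Heyting (boolean_heyting (proj1 h)).

Lemma boolean_of_embedding (S T : structure (lang BooleanAlgebras))
    (hS : base_sem S) (hT : base_sem T) (f : S -> T) :
  base_embedding f -> @hembedding (boolean_of hS) (boolean_of hT) f.
Proof.
move=> fE; have [_ fc f1 f2 _] := fE.
split=> [x y|x y|x y|x y|]; first exact: (le_in_embedding x y fE).
- exact: (f2 Join).
- exact: (f2 Meet).
- exact: etrans (f2 Join _ _) (congr1 (fun u => iop2 _ u _) (f1 tt x)).
- by split; [exact: (fc Zero)|exact: (fc One)].
Qed.

Lemma boolean_algebras_amalgamate : base_amalgamates BooleanAlgebras.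
Proof.
move=> A B C i1 k1 hA hB hC iE kE; have [bA ntA] := hA; have [bB _] := hB.
pose A' := boolean_of hA; pose B' := boolean_of hB; pose C' := boolean_of hC.
have iH : @hembedding C' A' i1 := boolean_of_embedding hC hA iE.
have kH : @hembedding C' B' k1 := boolean_of_embedding hC hB kE.
pose X := @prime_pair A' B' C' i1 k1.
pose ord (x y : X) := x = y.
have o1 (x : X) : ord x x by [].
have o2 (x y z : X) : ord x y -> ord y z -> ord x z by move=> ->.
have o3 (x y : X) (xy : ord x y) a : (sval x).1 a -> (sval y).1 a by rewrite xy.
have o4 (x y : X) (xy : ord x y) b : (sval x).2 b -> (sval y).2 b by rewrite xy.
have o5 (x : X) (a a' : A') : ~ (sval x).1 (himp a a') ->
    exists y : X, [/\ ord x y, (sval y).1 a & ~ (sval y).1 a'].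
  have [pP _ _] := svalP x; move=> /(bool_prime_imp bA pP) [xa nxa].
  by exists x.
have o6 (x : X) (b b' : B') : ~ (sval x).2 (himp b b') ->
    exists y : X, [/\ ord x y, (sval y).2 b & ~ (sval y).2 b'].
  have [_ pQ _] := svalP x; move=> /(bool_prime_imp bB pQ) [xa nxa].
  by exists x.
pose D' := upset_algebra o1 o2.
pose D := @Structure (lang BooleanAlgebras) (upset ord)
  (fun c => match c with Zero => hbot D' | One => htop D' end)
  (fun _ x => @himp D' x (hbot D'))
  (fun o => match o with Join => @hjoin D' | Meet => @hmeet D' end)
  (fun _ _ _ => False).
have HD := heytingP D'.
have leD : @le_in BooleanAlgebras D = @hle D'.
  apply: funext => x; apply: funext => y; apply: propext; apply: iff_sym.
  by have [o j _ _ _] := HD; have [_] := join_eqs o j; exact.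
have E1 := amalgam1_embedding iH kH o1 o2 o3 o5.
have E2 := amalgam2_embedding iH kH o1 o2 o4 o6.
have com := amalgam12 o1 o2 o3 o4.
pose i : A -> D := amalgam1 o1 o2 o3; pose k : B -> D := amalgam2 o1 o2 o4.
have [[_ i_j i_m i_i [i_z i_o]] [_ k_j k_m k_i [k_z k_o]]] := (E1, E2).
exists D, i, k; split.
- split; last first.
    rewrite -[icst D Zero]/(hbot D') -[icst D One]/(htop D') -i_z -i_o.
    by move/(hembedding_inj E1).
  rewrite leD; have [oD jD mD bD _] := HD; have [_ anti _] := oD; split=> //.
  split=> [x y w|x|x].
  + apply: anti; first exact: (meet_join_le HD).
    apply: (join_le HD); apply: (meet_mono HD); do ?exact: heyting_refl HD _.
      exact: le_join1 HD _ _.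
    exact: le_join2 HD _ _.
  + apply: upset_eq => u /=; split=> // _.
    by have [xu|nxu] := pselect (sval x u); [left|right=> v <-].
  + by apply: upset_eq => u /=; split=> // -[xu /(_ u erefl xu)].
- split=> [|[]|[] x|[]|[]] //; first exact: (hembedding_inj E1).
  by rewrite -[iop1 _ (i x)]/(@himp D' (i x) (hbot D')) -i_z -i_i;
    congr i; exact/esym/(bool_imp_bot bA).
- split=> [|[]|[] x|[]|[]] //; first exact: (hembedding_inj E2).
  by rewrite -[iop1 _ (k x)]/(@himp D' (k x) (hbot D')) -k_z -k_i;
    congr k; exact/esym/(bool_imp_bot bB).
- exact: com.
- split.
    rewrite leD; apply: (@sum_rel_heyting A' B' C' D' i1 k1 i k E1 E2 com).
      exact: (amalgam12_le iH kH).
    exact: (amalgam21_le iH kH).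
  by move=> fA fB; apply: fin_upset; exact: (@fin_prime_pair A' B').
Qed.

Lemma base_amalgamation b : base_amalgamates b.
Proof.
case: b; [exact: partial_orders_amalgamate|exact: lattices_amalgamate|
  exact: join_semilattices_amalgamate|exact: meet_semilattices_amalgamate|
  exact: boolean_algebras_amalgamate|exact: heyting_algebras_amalgamate].
Qed.

(** * Superamalgamation of the expanded theories *)

Lemma theory_superamalgamation t
    (A B C : structure (lang (base_of t))) (i1 : C -> A) (k1 : C -> B) :
  models (theory_of t) A -> models (theory_of t) B -> models (theory_of t) C ->
  embedding i1 -> embedding k1 ->
  exists (D : structure (lang (base_of t))) (i : A -> D) (k : B -> D),
    [/\ models (theory_of t) D, super_amalgam (@le_in (base_of t)) i1 k1 i k &
        fin A -> fin B -> fin D].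
Proof.
move=> /theory_semP [bA lA] /theory_semP [bB lB] /theory_semP [bC _].
move=> /embeddingE [iE ill] /embeddingE [kE kll].
have [D [i [k [bD iD kD com [leE fD]]]]] := base_amalgamation bA bB bC iE kE.
have [[iI ic _ _ _] [kI _ _ _ _]] := (iD, kD).
have llc c c' : ll_in (i1 c) (i1 c') <-> ll_in (k1 c) (k1 c') by rewrite -ill -kll.
have oD := base_sem_order bD.
have [r rP [rA rB]] : exists2 r : D -> D -> Prop, ll_sem (t := t) (with_ll r) &
    ll_extends i k (@ll_in _ A) (@ll_in _ B) r.
  (* The languages depend on [t], so everything built over it is generalized before the case
     analysis. *)
  case: t A B C i1 k1 bA lA bB lB bC iE ill kE kll D i k bD iD kD com leE
    fD iI ic kI llc oD => [b []|] A B C i1 k1 bA lA bB lB bC iE ill kE kll D i k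
    bD iD kD com leE fD iI ic kI llc oD.
  - have [r rP rE] := coarser_amalgam oD com leE llc lA lB.
    by exists r => //; rewrite /= le_in_with_ll.
  - have [r rP rE] := linearization_amalgam oD com leE llc iI kI lA lB.
    by exists r => //; rewrite /= le_in_with_ll.
  - have [[lA' bdA] [lB' bdB]] := (lA, lB).
    have [r [rP rE _]] := auxiliary_amalgam oD leE llc lA' lB'.
    exists r => //; split; first by rewrite le_in_with_ll.
    have [rA _] := rE.
    (* The bounds inherit [c] << [c] from [A]: [i] sends constants to constants and preserves
       [<<]. *)
    case: b A B C i1 k1 bA lA bB lB bC iE ill kE kll D i k bD iD kD com leE
      fD iI ic kI llc oD lA' bdA lB' bdB r rP rE rA =>
      A B C i1 k1 bA lA bB lB bC iE ill kE kll D i k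
      bD iD kD com leE fD iI ic kI llc oD lA' bdA lB' bdB r rP rE rA //= c.
    + by rewrite /ll_in /= -ic; apply/rA; exact: bdA.
    + by rewrite /ll_in /= -ic; apply/rA; exact: bdA.
  - have [[lA' nA] [lB' nB]] := (lA, lB).
    have [r [rP rE rn]] := auxiliary_amalgam oD leE llc lA' lB'.
    exists r => //; split; first by rewrite le_in_with_ll.
    exact: rn nA nB.
have iE' : embedding (i : A -> with_ll r).
  by apply/embeddingE; split=> // x y; exact: rA.
have kE' : embedding (k : B -> with_ll r).
  by apply/embeddingE; split=> // x y; exact: rB.
exists (with_ll r), i, k; split=> //.
- by apply/theory_semP; split=> //; apply/base_sem_with_ll.
- split; last first.
    move=> a b _ _; rewrite le_in_with_ll.
    by split=> [/(leE (inl a) (inr b))|/(leE (inr b) (inl a))].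
  split; first by split=> //; apply: funext => c; exact: com.
  apply/seteqP; split=> [d [[a _ <-] [b _ ab]]|d [c _ <-]]; last first.
    by split; [exists (i1 c)|exists (k1 c) => //=; rewrite com].
  have [refl _ _] := oD.
  (* Strongness: [i a = k b] gives inequalities both ways, hence a common origin in [C]. *)
  have [||c [-> _]] := sum_rel_common (le_in_compat iE kE) (base_sem_order bA)
    (base_sem_order bB) (a := a) (b := b).
  + by apply/leE; rewrite /= ab.
  + by apply/leE; rewrite /= ab.
  + by exists c.
Qed.

(** * Finite models *)

Definition theory_axioms t : seq (formula (lang (base_of t)) var4) :=
  match t with
  | Expansion b e => base_axioms b ++ expansion_axioms b e
  | CausalSpaces => base_axioms PartialOrders ++
        auxiliary_relation (@le_formula PartialOrders var4)
                           (@ll_formula PartialOrders var4) ++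
        antireflexive (@ll_formula PartialOrders var4)
  end.

Lemma theory_axioms_qf t : all (@quantifier_free _ var4) (theory_axioms t).
Proof. by case: t => [[] []|]. Qed.

Lemma theory_ofE t : theory_of t = axiomatized_by (theory_axioms t).
Proof. by case: t. Qed.

Lemma universal_substructure (L : language) axs (A B : structure L) (f : A -> B) :
  all (@quantifier_free L var4) axs -> embedding f ->
  models (axiomatized_by axs) B -> models (axiomatized_by axs) A.
Proof.
move=> qf fE /models_all_hold H; apply/models_all_hold.
elim: axs qf H => //= phi l IH /andP [qphi /IH {}IH] [H /IH Hl]; split=> // x y z w.
apply/(sat_embedding _ fE qphi).
have -> // : f \o env4 x y z w = env4 (f x) (f y) (f z) (f w).
by apply: funext => -[[[[[]|]|]|]|].
Qed.

Lemma theory_substructure t (A B : structure (lang (base_of t))) (f : A -> B) :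
  embedding f -> models (theory_of t) B -> models (theory_of t) A.
Proof.
by rewrite theory_ofE; exact: universal_substructure (theory_axioms_qf t).
Qed.

(** Empty when there are no constants; otherwise the two-element algebra, where each expansion
    forces [<<] to be the order. *)
Definition initial_structure b : structure (lang b) :=
  match b with
  | BooleanAlgebras => @Structure (lang BooleanAlgebras) bool
      (fun c => match c with Zero => false | One => true end)
      (fun _ x => ~~ x)
      (fun o => match o with Join => orb | Meet => andb end)
      (fun _ x y => x ==> y)
  | HeytingAlgebras => @Structure (lang HeytingAlgebras) bool
      (fun c => match c with Zero => false | One => true end)
      (fun o => match o with end)
      (fun o => match o with HJoin => orb | HMeet => andb | HImp => implb end)
      (fun _ x y => x ==> y)
  | PartialOrders => @Structure (lang PartialOrders) void
      id (fun _ => id) (fun _ x _ => x) (fun _ _ _ => True)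
  | Lattices => @Structure (lang Lattices) void
      id (fun _ => id) (fun _ x _ => x) (fun _ _ _ => True)
  | JoinSemilattices => @Structure (lang JoinSemilattices) void
      id (fun _ => id) (fun _ x _ => x) (fun _ _ _ => True)
  | MeetSemilattices => @Structure (lang MeetSemilattices) void
      id (fun _ => id) (fun _ x _ => x) (fun _ _ _ => True)
  end.

Lemma fin_initial_structure b : fin (initial_structure b).
Proof. by case: b; exact: fin_finType. Qed.

Lemma models_initial_structure t : models (theory_of t) (initial_structure (base_of t)).
Proof.
have leB : @le_in BooleanAlgebras (initial_structure BooleanAlgebras) =
    (fun x y : bool => x ==> y).
  by apply: funext => -[]; apply: funext => -[]; apply: propext.
have leH : @le_in HeytingAlgebras (initial_structure HeytingAlgebras) =
    (fun x y : bool => x ==> y).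
  by apply: funext => -[]; apply: funext => -[]; apply: propext.
have ob : is_order (fun x y : bool => x ==> y).
  by split; do ?[case=> //].
have jb : is_join (fun x y : bool => x ==> y) orb by split; do ?[case=> //].
have mb : is_meet (fun x y : bool => x ==> y) andb.
  by rewrite /is_meet /dual; split; do ?[case=> //].
apply/theory_semP; split.
  case: t => [[] e|] /=; do ?by do ?split; case.
  - rewrite leB; split=> //; split=> // [[]|] //.
    by split; do ?[case=> //].
  - rewrite leH; split=> //; split=> // [[]|[] [] []] //.
case: t => [[] []|] /=; do ?by do ?split; case.
all: rewrite ?leB ?leH.
all: try by split.
all: try by split; [split=> //; do ?[case=> //]|case].
all: by split=> [//|x y]; case: x y => [] []; [left|right|left|left].
Qed.

Section Bounds.
Variables (D : Type) (le ll : D -> D -> Prop) (j m : D -> D -> D) (z o : D).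
Hypothesis ole : is_order le.
Hypothesis bounds : forall x, le z x /\ le x o.

Definition bound_of (b : bool) : D := if b then o else z.

Lemma join_bounds x y : is_join le j -> bound_of (x || y) = j (bound_of x) (bound_of y).
Proof.
move=> jle; have [[_ jC jI] leE] := join_eqs ole jle.
have [/leE zo _] := bounds o.
by case: x y => [] []; rewrite /= ?jI ?zo // jC.
Qed.

Lemma meet_bounds x y : is_meet le m -> bound_of (x && y) = m (bound_of x) (bound_of y).
Proof.
move=> mle; have [[_ mC mI] geE] := join_eqs (order_dual ole) mle.
have [zo _] := bounds o; have /geE oz : dual le o z by [].
by case: x y => [] []; rewrite /= ?mI ?oz // mC.
Qed.

(** [ll o z] would identify the bounds, by antisymmetry of [ll] or of [le]. In the auxiliary case
    [ll z o] follows from [ll z z] and [le z o], while [ll z z] and [ll o o] must be assumed. *)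
Lemma ll_bounds_of x y : z <> o ->
  is_coarser le ll \/ [/\ is_auxiliary le ll, ll z z & ll o o] ->
  (x ==> y) <-> ll (bound_of x) (bound_of y).
Proof.
move=> nt H; have [refl anti trans] := ole; have [zo _] := bounds o.
have [zz oz oo noz] : [/\ ll z z, ll z o, ll o o & ~ ll o z].
  case: H => [[[r a t] lell]|[[lle aux] zz oo]].
    by split=> // [|oz]; [exact: lell|apply: nt; apply: a => //; exact: lell].
  split=> // [|/lle oz]; first exact: aux zz zo.
  by apply: nt; exact: anti.
by case: x y => [] [].
Qed.

End Bounds.

Lemma ll_sem_cases b e (S : structure (lang b)) : ll_sem (t := Expansion b e) S ->
  is_coarser (@le_in b S) (@ll_in b S) \/
  is_auxiliary (@le_in b S) (@ll_in b S) /\ ll_bounds_sem S.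
Proof. by case: e => [|[]|]; [left|left|right]. Qed.

Lemma initial_embeds t (A : structure (lang (base_of t))) :
  models (theory_of t) A -> embeds (initial_structure (base_of t)) A.
Proof.
move=> /theory_semP [bA lA].
case: t A bA lA => [[] e|] A bA lA; try by exists (@of_void _); split; case.
- have [[oA jA mA bd [dist jc mc]] nt] := bA.
  have [[_ jC _] leE] := join_eqs oA jA.
  have [[_ mC _] geE] := join_eqs (order_dual oA) mA.
  pose z := icst A (Zero : cst (lang BooleanAlgebras)).
  pose o := icst A (One : cst (lang BooleanAlgebras)).
  exists (bound_of z o : bool -> A); split.
  + have nt' := nesym nt; by move=> [] [].
  + by case.
  + case=> -[].
    * rewrite -[LHS](mc o).
      have /geE : dual (@le_in BooleanAlgebras A) o
          (iop1 (tt : op1 (lang BooleanAlgebras)) o).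
        by case: (bd (iop1 (tt : op1 (lang BooleanAlgebras)) o)).
      exact.
    * rewrite -[LHS](jc z); apply/leE.
      by case: (bd (iop1 (tt : op1 (lang BooleanAlgebras)) z)).
  + case=> x y; [exact: (join_bounds oA bd _ _ jA)|exact: (meet_bounds oA bd _ _ mA)].
  + case=> [[]|] x y; apply: (ll_bounds_of oA bd _ _ nt).
    case: (ll_sem_cases lA) => [|[lA' bA']]; [by left|right].
    by split; [|exact: (bA' Zero)|exact: (bA' One)].
- have [hA nt] := bA; have [oA jA mA bd res] := hA.
  have [_ anti _] := oA.
  pose z := icst A (Zero : cst (lang HeytingAlgebras)).
  pose o := icst A (One : cst (lang HeytingAlgebras)).
  exists (bound_of z o : bool -> A); split.
  + have nt' := nesym nt; by move=> [] [].
  + by case.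
  + by case.
  + case=> x y; [exact: (join_bounds oA bd _ _ jA)|exact: (meet_bounds oA bd _ _ mA)|].
    have ge1 u : le_in o u -> u = o by move=> ou; apply: anti => //; case: (bd u).
    have le0 u : le_in u z -> u = z by move=> ou; apply: anti => //; case: (bd u).
    apply/esym; case: x y => [] [] /=.
    * by apply: ge1; apply/res; exact: meet_le1 hA _ _.
    * apply: le0; have := heyting_refl hA (iop2 (HImp : op2 (lang HeytingAlgebras)) o z).
      move=> /res h; apply: (heyting_trans hA) h; apply: (le_meet hA).
        exact: heyting_refl hA _.
      by case: (bd (iop2 (HImp : op2 (lang HeytingAlgebras)) o z)).
    * by apply: ge1; apply/res; exact: meet_le1 hA _ _.
    * by apply: ge1; apply/res; exact: meet_le2 hA _ _.
  + case=> [[]|] x y; apply: (ll_bounds_of oA bd _ _ nt).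
    case: (ll_sem_cases lA) => [|[lA' bA']]; [by left|right].
    by split; [|exact: (bA' Zero)|exact: (bA' One)].
Qed.

(* Larger than the initial structure, so that strong amalgams over the latter
   force the Fraisse limit to be infinite. *)
Definition larger_structure t : structure (lang (base_of t)) :=
  match t with
  | Expansion BooleanAlgebras e => @Structure (lang BooleanAlgebras) (bool * bool)
      (fun c => match c with Zero => (false, false) | One => (true, true) end)
      (fun _ x => (~~ x.1, ~~ x.2))
      (fun o x y => match o with
         | Join => (x.1 || y.1, x.2 || y.2) | Meet => (x.1 && y.1, x.2 && y.2) end)
      (fun _ x y => match e with
         | AuxiliaryRelation => (x.1 ==> y.1) && (x.2 ==> y.2)
         | _ => (x.1 ==> y.1) && ((x.1 == y.1) ==> (x.2 ==> y.2)) end)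
  | Expansion PartialOrders _ => @Structure (lang PartialOrders) unit
      (fun _ => tt) (fun _ => id) (fun _ x _ => x) (fun _ _ _ => True)
  | Expansion Lattices _ => @Structure (lang Lattices) unit
      (fun _ => tt) (fun _ => id) (fun _ x _ => x) (fun _ _ _ => True)
  | Expansion JoinSemilattices _ => @Structure (lang JoinSemilattices) unit
      (fun _ => tt) (fun _ => id) (fun _ x _ => x) (fun _ _ _ => True)
  | Expansion MeetSemilattices _ => @Structure (lang MeetSemilattices) unit
      (fun _ => tt) (fun _ => id) (fun _ x _ => x) (fun _ _ _ => True)
  | Expansion HeytingAlgebras e => initial_structure HeytingAlgebras
  | CausalSpaces => @Structure (lang PartialOrders) unit
      (fun _ => tt) (fun _ => id) (fun _ x _ => x) (fun r _ _ => isSome r)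
  end.

Lemma models_larger_structure t : models (theory_of t) (larger_structure t).
Proof.
case: t => [[] e|]; try exact: models_initial_structure.
all: apply/theory_semP; split.
all: try by do ?split; do ?case.
all: try by case: e => /=; do ?split; do ?case; try left.
all: have leE (x y : bool * bool) : le_in (b := BooleanAlgebras)
    (A := larger_structure (Expansion BooleanAlgebras e)) x y <->
    (x.1 ==> y.1) && (x.2 ==> y.2) by case: x y => [[] []] [[] []].
- split=> //; split.
  + split=> [x|x y|x y z]; rewrite !leE; first by case: x => [[] []].
      by case: x y => [[] []] [[] []].
    by case: x y z => [[] []] [[] []] [[] []].
  + split=> [x y|x y|x y z]; rewrite !leE; do 2 ?by case: x y => [[] []] [[] []].
    by case: x y z => [[] []] [[] []] [[] []].
  + rewrite /is_meet /dual; split=> [x y|x y|x y z]; rewrite !leE;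
      do 2 ?by case: x y => [[] []] [[] []].
    by case: x y z => [[] []] [[] []] [[] []].
  + by move=> x; rewrite !leE; case: x => [[] []].
  + split=> [x y z|x|x]; first by case: x y z => [[] []] [[] []] [[] []].
      by case: x => [[] []].
    by case: x => [[] []].
(* The lexicographic order on pairs of booleans is linear and coarser than the product order, so it
   serves the first two expansions alike. *)
- have co : is_coarser (fun x y : bool * bool => (x.1 ==> y.1) && (x.2 ==> y.2))
      (fun x y => (x.1 ==> y.1) && ((x.1 == y.1) ==> (x.2 ==> y.2))).
    split; last by move=> [[] []] [[] []].
    split; [by move=> [[] []]|by move=> [[] []] [[] []]|].
    by move=> [[] []] [[] []] [[] []].
  have E : @le_in BooleanAlgebras (larger_structure (Expansion BooleanAlgebras e)) =
      (fun x y : bool * bool => (x.1 ==> y.1) && (x.2 ==> y.2)).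
    by apply: funext => x; apply: funext => y; apply: propext; exact: leE.
  case: e {leE} E => E; rewrite /ll_sem E.
  + exact: co.
  + split; first exact: co.
    by move=> [[] []] [[] []]; do ?[by left|by right].
  + split; last by case.
    split; first by move=> [[] []] [[] []].
    by move=> [[] []] [[] []] [[] []] [[] []].
Qed.

Lemma fin_larger_structure t : fin (larger_structure t).
Proof.
by case: t => [[] e|]; do ?[exact: (fin_finType unit) | exact: (fin_finType bool)];
  exact: (fin_finType (bool * bool)%type).
Qed.

Lemma larger_structure_proper t :
  base_of t <> HeytingAlgebras ->
  exists x : larger_structure t,
    forall f : initial_structure (base_of t) -> larger_structure t,
      embedding f -> ~ range f x.
Proof.
case: t => [[] e|] //= _; try by exists tt => f _ [[]].
(* Both elements of the two-element algebra are constants, and this pair is none. *)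
exists (true, false) => f [_ fc _ _ _] [x _ fx].
case: x fx => fx; first by have := fc One; rewrite /= fx.
by have := fc Zero; rewrite /= fx.
Qed.

(** A finite [M] would lie in [K]. Two copies of it, amalgamated strongly over [C], embed back into
    [M]; the first copy fills [M] by counting, so the second lies inside the first and, by
    strongness, inside [C], against the choice of [y]. *)
Lemma infinite_limit (L : language) (K : set (structure L)) (M C N : structure L)
    (n0 : C -> N) :
  strong_amalgamation_property K ->
  fraisse_limit K M -> K C -> K N -> embedding n0 -> (exists y, ~ range n0 y) ->
  infinite_set [set: M].
Proof.
move=> sap [_ _ MK] KC KN nE [y ny] fM.
have [_ [g gE]] : age M N by rewrite MK.
have [gI _ _ _ _] := gE; have gnE := embedding_comp nE gE.
have KM : K M.
  rewrite -MK; split; first by apply: fin_finitely_generated; apply/finP.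
  by exists id; exact: embedding_id.
have [D [i [k [KD [[iE kE com] rng]]]]] := sap _ _ _ _ _ KM KM KC gnE gnE.
have [_ [h hE]] : age M D by rewrite MK.
have [[iI _ _ _ _] [hI _ _ _ _]] := (iE, hE); have [kI _ _ _ _] := kE.
have [|x] := fin_inj_surj (proj2 (finP M) fM) (f := h \o i) _ (h (k (g y))).
  exact: inj_comp.
move=> /hI ix; have : (range i `&` range k) (k (g y)).
  by split; [exists x|exists (g y)].
rewrite rng => -[c _ e]; apply: ny; exists c => //.
by apply: gI; apply: kI; rewrite -e; have := congr1 (fun u => u c) com.
Qed.

(** * Finitely many terms *)

Lemma finitely_many_term_classes (L : language) (T : theory L) :
  (forall V : finType, exists (G : finType) (kappa : term L V -> G),
     forall t u, kappa t = kappa u ->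
     forall (A : structure L) (v : V -> A), models T A -> eval v t = eval v u) ->
  finitely_many_terms T.
Proof.
move=> H V; have [G [kappa kE]] := H V.
pose F := {g : G | `[< exists t, kappa t = g >]}.
have ex (f : F) : exists t, kappa t = val f by case: f => g /= /asboolP.
have [tau tauE] := choice ex; exists F, tau => t.
have p : `[< exists u, kappa u = kappa t >] by apply/asboolP; exists t.
by exists (exist _ (kappa t) p) => A v; apply: kE; rewrite tauE.
Qed.

Fixpoint term_vars (L : language) (V : finType) (t : term L V) : {set V} :=
  match t with
  | Var x => [set x]%SET
  | Cst _ => finset.set0
  | Op1 _ t => term_vars t
  | Op2 _ t u => (term_vars t :|: term_vars u)%SET
  end.

(** A semilattice term is the join of its variables, so its upper bounds depend on their set alone.
    A general [le] covers meets through the dual order. *)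
Lemma term_vars_join (b : base) (V : finType) (A : structure (lang b))
    (le : A -> A -> Prop) (v : V -> A) (t : term (lang b) V) z :
  (cst (lang b) -> False) -> (op1 (lang b) -> False) ->
  (forall o, is_join le (iop2 (s := A) o)) -> is_order le ->
  le (eval v t) z <-> forall x, x \in term_vars t -> le (v x) z.
Proof.
move=> nc n1 jle ole; have [_ _ tr] := ole.
elim: t => [x|c|o t _|o t IHt u IHu] /=.
- by split=> [h y|h]; [rewrite finset.inE => /eqP ->|apply: h; rewrite finset.inE].
- by case: nc.
- by case: n1.
have [jl jr jm] := jle o; split=> [h x|h].
  rewrite finset.inE => /orP [xt|xu].
    by apply: (proj1 IHt) xt; exact: tr (jl _ _) h.
  by apply: (proj1 IHu) xu; exact: tr (jr _ _) h.
by apply: jm; [apply/IHt|apply/IHu] => x xt; apply: h;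
  rewrite finset.inE xt ?orbT.
Qed.

Lemma semilattice_terms (b : base) (T : theory (lang b)) :
  (cst (lang b) -> False) -> (op1 (lang b) -> False) ->
  (forall A : structure (lang b), models T A -> exists2 le : A -> A -> Prop,
     is_order le & forall o, is_join le (iop2 (s := A) o)) ->
  finitely_many_terms T.
Proof.
move=> nc n1 H; apply: finitely_many_term_classes => V.
exists {set V}, (@term_vars _ V) => t u tu A v /H [le ole jle].
have E z : le (eval v t) z <-> le (eval v u) z.
  by rewrite !(@term_vars_join b V A le v) // tu.
have [r a _] := ole.
by apply: a; [apply/E|apply/E]; exact: r.
Qed.

Fixpoint truth_value (V : Type) (s : V -> bool) (t : term (lang BooleanAlgebras) V) :
    bool :=
  match t with
  | Var x => s x
  | Cst c => match c with Zero => false | One => true end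
  | Op1 _ t => ~~ truth_value s t
  | Op2 o t u => match o with
      | Join => truth_value s t || truth_value s u
      | Meet => truth_value s t && truth_value s u end
  end.

(** The indicator of a prime filter is a homomorphism to the two-element algebra, and so commutes
    with terms. *)
Lemma truth_value_prime (V : Type) (A : structure (lang BooleanAlgebras))
    (h : base_sem A) (P : boolean_of h -> Prop) (v : V -> A) t :
  hprime P -> P (eval v t) <-> truth_value (fun x => `[< P (v x) >]) t.
Proof.
move=> pP; have HA := heytingP (boolean_of h); have [[_ _ _ _ [_ jc mc]] _] := h.
have [[P1 _ _] P0 _] := pP.
elim: t => [x|[]|[] t IH|[] t IHt u IHu] /=.
- by split=> [?|/asboolP //]; apply/asboolP.
- by split=> // /P0.
- by split.
- have /(prime_join HA _ _ pP) : P (hjoin (eval v t : boolean_of h)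
      (iop1 (tt : op1 (lang BooleanAlgebras)) (eval v t))).
    by rewrite -[hjoin _ _]/(iop2 (Join : op2 (lang BooleanAlgebras)) _ _) jc.
  have n : ~ (P (eval v t) /\ P (iop1 (tt : op1 (lang BooleanAlgebras)) (eval v t))).
    move=> /(prime_meet HA _ _ pP).
    by rewrite -[hmeet _ _]/(iop2 (Meet : op2 (lang BooleanAlgebras)) _ _) mc => /P0.
  move=> c; split=> [pn|/negP nt]; first by apply/negP => /IH pt; exact: n.
  by case: c => // /IH.
- apply: iff_trans (prime_join HA _ _ pP) _; rewrite IHt IHu; exact: (rwP orP).
- apply: iff_trans (prime_meet HA _ _ pP) _; rewrite IHt IHu; exact: (rwP andP).
Qed.

Lemma theory_terms t : base_of t <> Lattices -> base_of t <> HeytingAlgebras ->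
  finitely_many_terms (theory_of t).
Proof.
have po (T : theory (lang PartialOrders)) : finitely_many_terms T.
  apply: finitely_many_term_classes => V; exists V.
  exists (fun t : term (lang PartialOrders) V => match t with
    | Var x => x | Cst c => of_void V c
    | Op1 o _ => of_void V o | Op2 o _ _ => of_void V o end).
  by move=> [x|[]|[]|[]] // [y|[]|[]|[]] // ->.
case: t => [[] e|] // _ _.
- apply: (@semilattice_terms JoinSemilattices) => // A.
  move=> /(@theory_semP (Expansion JoinSemilattices e)) [[oA jA] _].
  by exists (@le_in JoinSemilattices A) => // -[].
- apply: (@semilattice_terms MeetSemilattices) => // A.
  move=> /(@theory_semP (Expansion MeetSemilattices e)) [[oA mA] _].
  by exists (dual (@le_in MeetSemilattices A)) => [|[]//]; exact: order_dual.
- apply: finitely_many_term_classes => V.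
  (* The invariant is the truth table; prime filters separate points, so equal tables give equal
     values. *)
  exists {ffun {ffun V -> bool} -> bool},
    (fun t => [ffun s : {ffun V -> bool} => truth_value s t]).
  move=> t u tu A v /(@theory_semP (Expansion BooleanAlgebras e)) [h _].
  have HA := heytingP (boolean_of h).
  have E (P : boolean_of h -> Prop) : hprime P -> P (eval v t) <-> P (eval v u).
    move=> pP; rewrite !(truth_value_prime _ _ pP).
    have := congr1 (fun g : {ffun {ffun V -> bool} -> bool} =>
      g [ffun x => `[< P (v x) >]]) tu.
    rewrite !ffunE; have -> : ([ffun x => `[< P (v x) >]] : V -> bool) =
      (fun x => `[< P (v x) >]) by apply: funext => x; rewrite ffunE.
    by move=> ->.
  have [[_ anti _] _ _ _ _] := HA.
  by apply: anti; apply: contrapT => /(prime_exists HA) [P [pP Px nPy]];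
    apply: nPy; apply/(E P pP).
Qed.

(** * Fraisse limits of the finite models *)

Lemma fin_bound : fin bound.
Proof.
by exists bool, (fun b => if b then One else Zero) => -[]; [exists false|exists true].
Qed.

Lemma fin_lattice_op : fin lattice_op.
Proof.
by exists bool, (fun b => if b then Meet else Join) => -[]; [exists false|exists true].
Qed.

Lemma fin_heyting_op : fin heyting_op.
Proof.
exists (option bool),
  (fun o => if o is Some b then if b then HMeet else HImp else HJoin).
by case; [exists None|exists (Some true)|exists (Some false)].
Qed.

Lemma fin_lang b : [/\ fin (cst (lang b)), fin (op1 (lang b)),
  fin (op2 (lang b)) & fin (rel2 (lang b))].
Proof.
have [v u] := (fin_finType void, fin_finType unit).
by case: b; split=> //=;
  do ?[exact: fin_bound | exact: fin_lattice_op | exact: fin_heyting_op |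
       exact: v | exact: u | apply: fin_option].
Qed.

Lemma fin_gen (L : language) (T : theory L) (A : structure L) V (v : V -> A) :
  finitely_many_terms T -> models T A -> fin V -> fin (gen v).
Proof.
move=> ft TA [W [p ps]]; have [s sE] := choice ps.
have [F [tau tauE]] := ft W.
exists F, (fun f => gen_elt v (rename_term p (tau f))) => -[x [t tx]].
have [f fE] := tauE (rename_term s t); exists f; apply: eq_exist.
rewrite eval_rename -fE // eval_rename -tx.
by congr eval; apply: funext => y /=; rewrite sE.
Qed.

(** An axiom has four variables and no quantifier, so each instance is decided in the substructure
    generated by its four values. *)
Lemma universal_local (L : language) axs (A : structure L) :
  all (@quantifier_free L var4) axs ->
  (forall V (v : V -> A), fin V -> models (axiomatized_by axs) (gen v)) ->
  models (axiomatized_by axs) A.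
Proof.
move=> qf H; apply/models_all_hold.
have {}H V (v : V -> A) : fin V -> all_hold (gen v) axs.
  by move=> fV; apply/models_all_hold; exact: H.
elim: axs qf H => //= phi l IH /andP [qphi ql] H; split; last first.
  by apply: IH => // V v fV; case: (H V v fV).
move=> x y z w; pose v := env4 x y z w.
have /(_ _ v (fin_finType var4)) [+ _] := H.
move=> /(_ (gen_elt v (Var (Some (Some (Some None)))))
  (gen_elt v (Var (Some (Some None)))) (gen_elt v (Var (Some None)))
  (gen_elt v (Var None))).
move=> /(sat_embedding _ (gen_embedding v) qphi).
by congr sat; apply: funext => -[[[[[]|]|]|]|].
Qed.

Theorem theorem1p2 (t : theory_name) :
  strong_amalgamation_property (models (theory_of t)) /\
  superamalgamation_property (@le_in (base_of t)) (models (theory_of t)) /\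
  exists M : structure (lang (base_of t)),
    fraisse_limit (finite_models (theory_of t)) M /\
    (base_of t <> Lattices -> base_of t <> HeytingAlgebras ->
      omega_categorical (Th M) /\
      quantifier_elimination (Th M) /\
      model_completion (theory_of t) (Th M)).
Proof.
set T := theory_of t; set K := finite_models T.
have sup : superamalgamation_property (@le_in (base_of t)) (models T).
  move=> A B C i1 k1 TA TB TC iE kE.
  have [D [i [k [TD sD _]]]] := theory_superamalgamation TA TB TC iE kE.
  by exists D, i, k.
split; first by move=> A B C i1 k1 TA TB TC iE kE;
  have [D [i [k [TD [sD _]]]]] := sup _ _ _ _ _ TA TB TC iE kE; exists D, i, k.
split=> //.
have Kfin A : K A -> fin A by move=> [_ /finP].
have Ksub (A B : structure (lang (base_of t))) (f : A -> B) :
    embedding f -> K B -> K A.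
  move=> fE [TB /finP fB]; split; first exact: theory_substructure fE TB.
  by apply/finP; apply: fin_inj fB; case: fE => fI _ _ _ _; exact: fI.
have Ksap : strong_amalgamation_property K.
  move=> A B C i1 k1 [TA /finP fA] [TB /finP fB] [TC _] iE kE.
  have [D [i [k [TD [sD _] fD]]]] := theory_superamalgamation TA TB TC iE kE.
  by exists D, i, k; split=> //; split=> //; apply/finP; exact: fD.
have KC : K (initial_structure (base_of t)).
  split; first exact: models_initial_structure.
  by apply/finP; exact: fin_initial_structure.
have [fc f1 f2 fr] := fin_lang (base_of t).
have [A B C i1 k1 KA KB KC' iE kE|A [TA _]|M MF] :=
    @fraisse_exists _ fc f1 f2 fr K Kfin Ksub _ _ KC.
- by have [D [i [k [KD [am _]]]]] := Ksap _ _ _ _ _ KA KB KC' iE kE; exists D, i, k.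
- exact: initial_embeds.
exists M; split=> // nL nH.
have [cM hM ageM] := MF; have ft := theory_terms nL nH.
(* [M] need not be in the class, but its finitely generated substructures are, being in its age. *)
have TM : models T M.
  rewrite /T theory_ofE; apply: universal_local (theory_axioms_qf t) _.
  move=> V v fV; rewrite -theory_ofE.
  have : age M (gen v).
    split; first exact: gen_finitely_generated.
    by exists sval; exact: gen_embedding.
  by rewrite ageM => -[].
have infM : infinite_set [set: M].
  have KN : K (larger_structure t).
    split; first exact: models_larger_structure.
    by apply/finP; exact: fin_larger_structure.
  have [n0 nE] := initial_embeds (proj1 KN).
  have [x nx] := larger_structure_proper nH.
  exact: infinite_limit Ksap MF KC KN nE (ex_intro _ x (nx _ nE)).
split; last split.
- split; first by exists M; split.
  by move=> A B MA [cA _] MB [cB _]; exact: (homogeneous_categorical ft fr TM hM).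
- exact: (homogeneous_quantifier_elimination ft fr TM hM).
split.
- by move=> A; exact: models_Th.
- move=> A TA.
  (* The default element required by [embeds_ultrapower]; infinity of [M] provides one. *)
  have [m0 _] : exists m : M, True.
    apply: contrapT => n; apply: infM; apply/finP; exists void, (@of_void _) => m.
    by case: n; exists m.
  (* Finitely generated substructures of [A] are finite by [fin_gen], hence in the age of [M]. *)
  apply: (embeds_ultrapower m0) => V v fV.
  have : K (gen v).
    split; first exact: theory_substructure (gen_embedding v) TA.
    by apply/finP; exact: fin_gen ft TA fV.
  by rewrite -ageM => -[].
- move=> A B C f g _ MB MC fE gE.
  exact: (homogeneous_completeness ft fr TM hM).
Qed.
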